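(* Let $\{(Y_t,X_t)\}_{t=1}^\infty$ be an ergodic hidden Markov model satisfying A1 and A2, let $\tilde V^n=v^n(X^n)$, where the finite Viterbi alignments $v^n$ are chosen consistently, and put $$\bar R_\infty(X^n)=-\frac1n\ln\mathbf P(Y^n=\tilde V^n\mid X^n).$$ Suppose that for every $s\in S$ the function $\ln f_s$ is $P_s$-integrable. Then $$-\bar R_\infty(X^n)\ \longrightarrow\ \sum_{s\in S}m_s\int\ln f_s(x)\,Q_s(dx)+E[\ln p_{V_1^*V_2^*}]+H_X\ =:\ -\bar R_\infty\quad\text{almost surely and in }L_1 .$$
   Context: Hidden Markov model (HMM): $Y=\{Y_t\}$ is a stationary Markov chain with finite state space $S=\{1,\dots,|S|\}$ and irreducible aperiodic transition matrix $(P(i,j))$, also written $p_{ij}=P(i,j)=\mathbf P(Y_2=j\mid Y_1=i)$. $X=\{X_t\}$ takes values in a measurable space $(\mathcal X,\mathcal B)$ (usually $\mathbb R^d$ with the Borel sets); given $Y$, the $X_t$ are conditionally independent, and the law of $X_t$ depends on $Y$ only through $Y_t$. The emission distributions $P_s=\mathbf P(X_1\in\cdot\mid Y_1=s)$ have densities $f_s$ with respect to a reference measure $\mu$. Such a model is called ergodic. Write $X^n=(X_1,\dots,X_n)$, $Y^n=(Y_1,\dots,Y_n)$. $\mathbf P(Y^n=\tilde V^n\mid X^n)$ denotes the function $x^n\mapsto\mathbf P(Y^n=v^n(x^n)\mid X^n=x^n)$ evaluated at $X^n$. Let $G_s=\{x\in\mathcal X:f_s(x)>0\}$. A set $C\subset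 S$ is a cluster if $\min_{j\in C}P_j(\cap_{s\in C}G_s)>0$ and $\max_{j\notin C}P_j(\cap_{s\in C}G_s)=0$. A1: there is a cluster $C\subset S$ such that the matrix $R=(P(i,j))_{i,j\in C}$ is primitive, i.e. $R^r$ is strictly positive for some positive integer $r$. A2: for each $l\in S$, $P_l(\{x\in\mathcal X: f_l(x)p_l^*>\max_{s\ne l}f_s(x)p_s^*\})>0$, where $p_l^*=\max_j p_{jl}$. For the cluster $C$ in A1 there exist a set $\mathcal X_o\subset\cap_{s\in C}G_s$ and $\epsilon>0$, $M<\infty$ with $\mu(\mathcal X_o)>0$ and, for all $x\in\mathcal X_o$: $\epsilon<\min_{s\in C}f_s(x)$, $\max_{s\in C}f_s(x)<M$, $\max_{s\notin C}f_s(x)=0$. Such a set is fixed, and $W_t=\min\{\tau\ge t+r+1: X_{\tau-r}^{\tau}\in\mathcal X_o^{r+1}\}$, $U_t=\max\{\tau\le t-r-1: X_\tau^{\tau+r}\in\mathcal X_o^{r+1}\}$, where $X_a^b=(X_a,\dots,X_b)$. A finite Viterbi alignment is a map $v^n:\mathcal X^n\to S^n$ with $v^n(x^n)\in\arg\max_{s^n\in S^n}\mathbf P(Y^n=s^n\mid X^n=x^n)$. The alignments extend to an infinite Viterbi alignment $v:\mathcal X^\infty\to S^\infty$ if for almost every realization $x^\infty$ and every $k$ there is $m\geq k$ such that for all $n\ge m$ the first $k$ elements of $v^n(x^n)$ and $v(x^\infty)$ coincide. Put $V=\{V_t\}_{t\ge1}=v(X)$. Consistent choice: it is known that under A1, A2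 the finite Viterbi alignments (ties broken suitably) can be chosen so that an infinite Viterbi alignment exists and the following holds; such a choice is called consistent. (R1) $Z=(X,Y,V)$ is a positive recurrent aperiodic classical regenerative process with respect to some renewal process $\{S_t\}_{t\ge0}$ (i.e. for each $k$ the shifted process $\theta_{S_k}(Z,S)$ is independent of the past up to $S_k$ and its law does not depend on $k$; $T_1=S_1-S_0$ satisfies $ET_1<\infty$ and $\mathbf P(T_1\in a\mathbb N)<1$ for all $a>1$). (R2) There is an integer $m>0$ with $S_0>m$, such that for all $j\ge0$ with $S_j+m\le n$, $\tilde V_t^n=V_t$ for all $t\le S_j$, and $S_j-S_{j-1}\ge m$ for $j\ge1$. (R3) If $S_k>t$ then $W_t\le S_k+m$; if $S_k<t$ then $U_t>S_k-m$. Stationary objects: $Z^*=\{(X_t^*,Y_t^*,V_t^* )\}_{t\ge1}$ denotes the stationary version of the regenerative process $Z$, i.e. the stationary regenerative process whose law after its first renewal time equals that of $Z$ after $S_0$. The random vector $(X_0,Y_0,V_0)$ (time-zero marginal of the stationary double-sided process $\{(X_t,Y_t,V_t)\}_{t\in\mathbb Z}$ of the HMM and its infinite Viterbi alignment) has the law of $(X_1^*,Y_1^*,V_1^* )$. For $s\in S$, $m_s=\mathbf P(V_0=s)$ and $Q_s=\mathbf P(X_0\in\cdot\mid V_0=s)$, so that $m_s\int g\,dQ_s=E(g(X_0)I_{\{V_0=s\}})$. Also $E[\ln p_{V_1^*V_2^*}]=\sum_{i,j\in S}\ln p_{ij}\,\mathbf P(V_1^*=i,V_2^*=j)$. $H_X$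 is the entropy rate of $X$: with $p(x^n)$ the likelihood (density of $X^n$ with respect to $\mu^{n}$), $H_X=-\lim_n\frac1n E\ln p(X^n)$ (equivalently, the a.s. limit of $-\frac1n\ln p(X^n)$). *)

(* Defs.v *)
From HB Require Import structures.
From mathcomp Require Import all_boot all_order all_algebra.
From mathcomp Require Import all_classical all_reals all_analysis.

Set Implicit Arguments.
Unset Strict Implicit.
Unset Printing Implicit Defensive.

Import Order.TTheory GRing.Theory Num.Theory.
Import numFieldNormedType.Exports.

Local Open Scope classical_set_scope.
Local Open Scope ring_scope.

(* A process is a family indexed by [nat] whose index [t]
   stands for time [t + 1]: [X 0, X 1, ...] are X_1, X_2, ... The state space
   {1, ..., |S|} is ['I_N.+1], with |S| = N + 1 and every subset measurable. *)

HB.instance Definition _ (n : nat) := isPointed.Build 'I_n.+1 ord0.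

HB.instance Definition _ (n : nat) := @isMeasurable.Build
  default_measure_display 'I_n.+1 discrete_measurable
  discrete_measurable0 discrete_measurableC discrete_measurableU.

Lemma product_sigma_finite d1 d2 (T1 : measurableType d1)
    (T2 : measurableType d2) (R : realType)
    (m1 : {sigma_finite_measure set T1 -> \bar R})
    (m2 : {sigma_finite_measure set T2 -> \bar R}) :
  sigma_finite setT (m1 \x m2)%E.
Proof.
have /sigma_finiteP[F [TF ndF Foo]] := sigma_finiteT m1.
have /sigma_finiteP[G [TG ndG Goo]] := sigma_finiteT m2.
exists (fun n => F n `*` G n).
  rewrite -setXTT TF TG predeqE => -[x y]; split.
    move=> [/= [n _ Fnx] [k _ Gky]]; exists (maxn n k) => //; split.
    - by move: x Fnx; exact/subsetPset/ndF/leq_maxl.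
    - by move: y Gky; exact/subsetPset/ndG/leq_maxr.
  by move=> [n _ []/= ? ?]; split; exists n.
move=> k; have [? ?] := Foo k; have [? ?] := Goo k.
split; first exact: measurableX.
by rewrite product_measure1E// lte_mul_pinfty// ge0_fin_numE.
Qed.

Section power_measure.
Local Open Scope ereal_scope.
Context d (T : measurableType d) (R : realType).
Variable mu : {sigma_finite_measure set T -> \bar R}.

Definition cons_pair n (z : T * n.-tuple T) : n.+1.-tuple T :=
  [the n.+1.-tuple T of z.1 :: z.2].

Lemma measurable_cons_pair n : measurable_fun setT (@cons_pair n).
Proof. exact: measurable_cons. Qed.

Lemma cons_pair_preimage n (A : set (n.+1.-tuple T)) :
  measurable A -> measurable (@cons_pair n @^-1` A).
Proof.
by move=> mA; rewrite -[X in measurable X]setTI; exact: measurable_cons_pair.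
Qed.

Section cons_measure.
Variables (n : nat) (nu : {sigma_finite_measure set (n.-tuple T) -> \bar R}).

(* the image of the product measure by (x, (x_1, .., x_n)) |-> (x, x_1, .., x_n) *)
Definition cons_measure (A : set (n.+1.-tuple T)) : \bar R :=
  (mu \x nu) (@cons_pair n @^-1` A).

Let cons_measure0 : cons_measure set0 = 0.
Proof. by rewrite /cons_measure preimage_set0 measure0. Qed.

Let cons_measure_ge0 A : 0 <= cons_measure A.
Proof. by rewrite /cons_measure /product_measure1 integral_ge0. Qed.

Let cons_measure_sigma_additive : semi_sigma_additive cons_measure.
Proof.
move=> F mF tF mUF; rewrite /cons_measure preimage_bigcup.
apply: measure_semi_sigma_additive.
- by move=> k; exact: cons_pair_preimage.
- apply/trivIsetP => /= i j _ _ ij; rewrite -preimage_setI.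
  by move/trivIsetP : tF => /(_ _ _ _ _ ij) ->//; rewrite preimage_set0.
- by rewrite -preimage_bigcup; exact: cons_pair_preimage.
Qed.

HB.instance Definition _ := isMeasure.Build _ _ _ cons_measure
  cons_measure0 cons_measure_ge0 cons_measure_sigma_additive.

Let cons_measure_sigma_finite : sigma_finite setT cons_measure.
Proof.
have [F FT Foo] := product_sigma_finite mu nu.
pose g (x : n.+1.-tuple T) : T * n.-tuple T := (thead x, [tuple of behead x]).
have mg : measurable_fun setT g.
  apply: measurable_fun_pair; last exact: measurable_behead.
  exact: measurable_tnth.
have gK z : g (cons_pair z) = z.
  by case: z => x s; congr pair => //; apply/val_inj.
exists (fun i => g @^-1` F i).
  by rewrite -preimage_bigcup -FT preimage_setT.
move=> i; have [mFi Fioo] := Foo i; split.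
  by rewrite -[X in measurable X]setTI; exact: mg.
rewrite /cons_measure (_ : _ @^-1` _ = F i)//.
by apply/seteqP; split => z /=; rewrite gK.
Qed.

HB.instance Definition _ := Measure_isSigmaFinite.Build _ _ _ cons_measure
  cons_measure_sigma_finite.

End cons_measure.

Fixpoint power_measure n : {sigma_finite_measure set (n.-tuple T) -> \bar R} :=
  match n with
  | 0%N => dirac ([tuple] : 0.-tuple T)
  | m.+1 => cons_measure (power_measure m)
  end.

End power_measure.

Section transition_matrix.
Context (R : realType) (n : nat).
Implicit Type p : 'M[R]_n.

Definition stochastic p :=
  (forall i j, 0 <= p i j) /\ (forall i, \sum_j p i j = 1).

Definition irreducible p := forall i j, exists k, 0 < (p ^+ k) i j.

(* 1 is the only common divisor of the possible return times to each state *)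
Definition aperiodic p := forall i (c : nat),
  (forall k, (0 < k)%N -> 0 < (p ^+ k) i i -> (c %| k)%N) -> c = 1%N.

Definition submatrix p (C : {set 'I_n}) : 'M[R]_#|C| :=
  mxsub enum_val enum_val p.

End transition_matrix.

Section processes.
Local Open Scope ereal_scope.
Context d (Omega : measurableType d) (R : realType).
Variable P : probability Omega R.

Definition prefix T n (x : nat -> T) : n.-tuple T := [tuple x i | i < n].

Definition stationary d' (T : measurableType d') (Z : nat -> Omega -> T) :=
  forall (t n : nat) (A : nat -> set T), (forall i, measurable (A i)) ->
    P [set w | forall i, (i < n)%N -> A i (Z (t + i)%N w)] =
    P [set w | forall i, (i < n)%N -> A i (Z i w)].

Definition markov_chain n (p : 'M[R]_n.+1) (Y : nat -> Omega -> 'I_n.+1) :=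
  (forall t, measurable_fun setT (Y t)) /\
  forall (k : nat) (s : nat -> 'I_n.+1),
    P [set w | forall i, (i < k.+2)%N -> Y i w = s i] =
    P [set w | forall i, (i < k.+1)%N -> Y i w = s i] * (p (s k) (s k.+1))%:E.

(* given Y, the X_t are independent and X_t has law [k (Y_t)]; conditioning on
   Y_1, .., Y_l for every l suffices *)
Definition emits d' (T : measurableType d') n (X : nat -> Omega -> T)
    (Y : nat -> Omega -> 'I_n.+1) (k : 'I_n.+1 -> probability T R) :=
  (forall t, measurable_fun setT (X t)) /\
  forall (l : nat) (s : nat -> 'I_n.+1) (A : nat -> set T),
    (forall i, measurable (A i)) ->
    P [set w | forall i, (i < l)%N -> Y i w = s i /\ A i (X i w)] =
    P [set w | forall i, (i < l)%N -> Y i w = s i] *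
      \prod_(i < l) k (s i) (A i).

(* [k s] is the conditional law of [X] given [Y = s]; it is unconstrained when
   [Y = s] has probability 0 *)
Definition conditional_law d' (T : measurableType d') n (X : Omega -> T)
    (Y : Omega -> 'I_n.+1) (k : 'I_n.+1 -> probability T R) :=
  forall s (A : set T), measurable A ->
    P [set w | A (X w) /\ Y w = s] = P [set w | Y w = s] * k s A.

(* [g] is a version of x |-> P(Y = s | X = x) *)
Definition conditional_probability d' (T : measurableType d') d''
    (U : measurableType d'') (Y : Omega -> U) (X : Omega -> T) (s : U)
    (g : T -> R) :=
  measurable_fun setT g /\
  forall B : set T, measurable B ->
    P [set w | Y w = s /\ B (X w)] = \int[P]_(w in X @^-1` B) (g (X w))%:E.

Definition density d' (T : measurableType d') (nu : set T -> \bar R)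
    (mu : set T -> \bar R) (g : T -> R) :=
  [/\ measurable_fun setT g, forall x, (0 <= g x)%R &
    forall A, measurable A -> nu A = \int[mu]_(x in A) (g x)%:E].

End processes.

(* For a renewal process S, the shift theta_(S_k) sends (Z_t)_(t >= 1) to
   (Z_(S_k + t))_(t >= 1), and the past up to S_k consists of S_0, .., S_k and
   Z_1, .., Z_(S_k). Both are described by their cylinder events. *)
Section regenerative.
Local Open Scope ereal_scope.
Context d (Omega : measurableType d) (R : realType).
Variable P : probability Omega R.
Context d' (T : measurableType d').
Variables (Z : nat -> Omega -> T) (S : nat -> Omega -> nat).

Definition past_event (k : nat) (s : nat -> nat) (A : nat -> set T) :=
  [set w | (forall i, (i <= k)%N -> S i w = s i) /\
           (forall t, (t < s k)%N -> A t (Z t w))].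

Definition shifted_process_event (k n : nat) (B : nat -> set T) :=
  [set w | forall i, (i < n)%N -> B i (Z (S k w + i)%N w)].

Definition shifted_event (k n : nat) (B : nat -> set T) (u : nat -> nat) :=
  shifted_process_event k n B `&`
  [set w | forall i, (i < n)%N -> (S (k + i)%N w - S k w)%N = u i].

Definition regenerative :=
  [/\ (forall t, measurable_fun setT (Z t)) /\
      (forall k, measurable_fun setT (S k)),
      {ae P, forall w, forall k, (S k w < S k.+1 w)%N},
      (forall k s A n B u,
        (forall i, measurable (A i)) -> (forall i, measurable (B i)) ->
        P (past_event k s A `&` shifted_event k n B u) =
        P (past_event k s A) * P (shifted_event k n B u)) &
      (forall k n B u, (forall i, measurable (B i)) ->
        P (shifted_event k n B u) = P (shifted_event 0 n B u))].

Definition positive_recurrent :=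
  \int[P]_w ((S 1 w - S 0 w)%N%:R)%:E < +oo.

Definition renewal_aperiodic :=
  forall a : nat, (1 < a)%N -> P [set w | (a %| (S 1 w - S 0 w))%N] < 1.

End regenerative.

(* only the processes are compared after their first renewals, not the renewal
   times *)
Definition stationary_version (R : realType)
    d (Omega : measurableType d) (P : probability Omega R)
    d1 (Omega1 : measurableType d1) (P1 : probability Omega1 R)
    d' (T : measurableType d')
    (Z : nat -> Omega -> T) (S : nat -> Omega -> nat)
    (Zs : nat -> Omega1 -> T) (Ss : nat -> Omega1 -> nat) :=
  [/\ regenerative P1 Zs Ss, stationary P1 Zs &
      forall n (B : nat -> set T), (forall i, measurable (B i)) ->
        P1 (shifted_process_event Zs Ss 0 n B) =
        P (shifted_process_event Z S 0 n B)].

Section hidden_markov_model.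
Local Open Scope ereal_scope.
Context d (Omega : measurableType d) (R : realType).
Variable P : probability Omega R.
Context d' (XX : measurableType d').
Variable mu : {sigma_finite_measure set XX -> \bar R}.
Variable N : nat.
Local Notation state := 'I_N.+1.
Variables (X : nat -> Omega -> XX) (Y : nat -> Omega -> state).
Variables (p : 'M[R]_N.+1) (f : state -> XX -> R).
Variable Pe : state -> probability XX R.

Definition ergodic_HMM :=
  [/\ stochastic p, irreducible p & aperiodic p] /\
  [/\ markov_chain P p Y, stationary P Y, emits P X Y Pe &
      forall s, density (Pe s) mu (f s)].

Definition G (s : state) : set XX := [set x | (0 < f s x)%R].

Definition capG (C : {set state}) : set XX :=
  [set x | forall s, s \in C -> G s x].

Definition cluster (C : {set state}) :=
  (forall j, j \in C -> 0 < Pe j (capG C)) /\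
  (forall j, j \notin C -> Pe j (capG C) = 0).

Definition A1 (C : {set state}) (r : nat) :=
  [/\ cluster C, (0 < r)%N & forall i j, (0 < (submatrix p C ^+ r) i j)%R].

Definition pstar (l : state) : R := \big[Num.max/0%R]_j p j l.

(* the values f_s(x) p_s^* are nonnegative, so 0 is a neutral start for max *)
Definition A2 := forall l : state,
  0 < Pe l [set x | (\big[Num.max/0]_(s | s != l) (f s x * pstar s) <
                     f l x * pstar l)%R].

Definition good_set (C : {set state}) (Xo : set XX) (eps M : R) :=
  [/\ measurable Xo, Xo `<=` capG C, (0 < eps)%R, 0 < mu Xo &
      forall x, Xo x ->
        [/\ forall s, s \in C -> (eps < f s x)%R,
            forall s, s \in C -> (f s x < M)%R &
            forall s, s \notin C -> f s x = 0%R]].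

(* X_a, .., X_(a + r) all lie in Xo; [a] is a time, hence [a >= 1] *)
Definition visit (Xo : set XX) (r a : nat) (w : Omega) :=
  forall i, (a <= i <= a + r)%N -> Xo (X i.-1 w).

(* a minimum over the empty set is +oo, a maximum over the empty set is -oo *)
Definition W (Xo : set XX) (r t : nat) (w : Omega) : \bar R :=
  ereal_inf [set (tau%:R)%:E | tau in
    [set tau : nat | (t + r + 1 <= tau)%N /\ visit Xo r (tau - r) w]].

Definition U (Xo : set XX) (r t : nat) (w : Omega) : \bar R :=
  ereal_sup [set (tau%:R)%:E | tau in
    [set tau : nat |
      [/\ (1 <= tau)%N, (tau + r + 1 <= t)%N & visit Xo r tau w]]].

Definition Xn n (w : Omega) : n.-tuple XX := prefix n (X ^~ w).
Definition Yn n (w : Omega) : n.-tuple state := prefix n (Y ^~ w).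

(* [post n s x] is P(Y^n = s | X^n = x) *)
Variable post : forall n, n.-tuple state -> n.-tuple XX -> R.

Definition posterior := forall n (s : n.-tuple state),
  conditional_probability P (@Yn n) (@Xn n) s (post s).

Variable v : forall n, n.-tuple XX -> n.-tuple state.

Definition Viterbi_alignment := forall n, measurable_fun setT (@v n) /\
  forall (x : n.-tuple XX) (s : n.-tuple state), (post s x <= post (v x) x)%R.

(* [tilde_V n t] is the entry at time [t + 1] of v^n(X^n), for [t < n] *)
Definition tilde_V n (t : nat) (w : Omega) : state := nth ord0 (v (Xn n w)) t.

Variable vinf : (nat -> XX) -> nat -> state.

Definition V (t : nat) (w : Omega) : state := vinf (X ^~ w) t.

Definition infinite_Viterbi_alignment :=
  {ae P, forall w, forall k, exists2 m, (k <= m)%N &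
    forall n, (m <= n)%N -> forall t, (t < k)%N -> tilde_V n t w = V t w}.

Definition triple d1 (Omega1 : measurableType d1) (A : nat -> Omega1 -> XX)
    (B C : nat -> Omega1 -> state) (t : nat) (w : Omega1) :
    (XX * state * state)%type :=
  (A t w, B t w, C t w).

Definition consistent (Xo : set XX) (r : nat) (S : nat -> Omega -> nat) :=
  [/\ regenerative P (triple X Y V) S,
      positive_recurrent P S,
      renewal_aperiodic P S &
      exists2 m : nat, (0 < m)%N & {ae P, forall w,
        [/\ (m < S 0 w)%N,
            forall j n, (S j w + m <= n)%N ->
              forall t, (t < S j w)%N -> tilde_V n t w = V t w,
            forall j, (m <= S j.+1 w - S j w)%N &
            forall k t, (1 <= t)%N ->
              ((t < S k w)%N -> W Xo r t w <= ((S k w + m)%N%:R)%:E) /\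
              ((S k w < t)%N -> ((S k w)%:R - m%:R)%:E < U Xo r t w)]}].

Definition risk n (w : Omega) : \bar R :=
  (- n%:R^-1)%:E * lne (post (v (Xn n w)) (Xn n w))%:E.

(* [lik n] is the density of X^n with respect to mu^n *)
Variable lik : forall n, n.-tuple XX -> R.

Definition likelihood := forall n,
  density (fun B => P (@Xn n @^-1` B)) (power_measure mu n) (@lik n).

Definition entropy_rate : \bar R :=
  - limn (fun n => (n%:R^-1)%:E * \int[P]_w lne (lik (Xn n w))%:E).

End hidden_markov_model.

(* for a stationary version [(Xs, _, Vs)] defined on
   [(Omega1, P1)] and Q_s the law of [Xs 0] given [Vs 0 = s] *)
Definition limit_value (R : realType) d (Omega1 : measurableType d)
    (P1 : probability Omega1 R) d' (XX : measurableType d') (N : nat)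
    (p : 'M[R]_N.+1) (f : 'I_N.+1 -> XX -> R)
    (Vs : nat -> Omega1 -> 'I_N.+1) (Q : 'I_N.+1 -> probability XX R)
    (HX : \bar R) : \bar R :=
  (\sum_s P1 [set w | Vs 0%N w = s] * \int[Q s]_x lne (f s x)%:E
   + \sum_i \sum_j
       lne (p i j)%:E * P1 [set w | Vs 0%N w = i /\ Vs 1%N w = j]
   + HX)%E.

(* Main.v *)
(* Let L_n be the likelihood of X^n and g_n(s) the joint likelihood of the path
   s and X^n. Almost surely, ln P(Y^n = v^n(X^n) | X^n) = G_n - ln L_n with G_n =
   max_s ln g_n(s), and this difference lies between -n ln |S| and 0, so the
   L_1 convergence follows from the almost sure one by dominated convergence.

   ln L_n / n: up to a constant factor per block, L_n is bounded by the product
   of the likelihoods of consecutive blocks of length k; conversely that product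
   is the density of a probability, so by Markov's inequality and Borel-Cantelli
   it exceeds L_n by at most a subexponential factor. The strong law for
   regenerative processes applied to block log-likelihoods then gives a limit,
   which is minus the entropy rate.

   G_n / n: since V is a candidate path, G_n is at least the log-likelihood of
   (V, X) at n; since the Viterbi path agrees with V up to the last renewal S_j
   with S_j + m <= n, G_n is at most the log-likelihood of (V, X) at S_j plus
   the sum of the positive parts of ln f over S_j <= t < n. The gap n - S_j is
   o(n), so both bounds, divided by n, converge by the strong law to
   E ln f_V(X) + E ln p_(V_1 V_2). The needed integrability of ln f_V(X) comes
   from comparing the Viterbi path with the true path Y. *)
Require Import Defs.
From HB Require Import structures.
From mathcomp Require Import all_boot all_order all_algebra.
From mathcomp Require Import all_classical all_reals all_analysis.
From mathcomp Require Import measurable_realfun.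
From mathcomp Require Import ring lra zify.
Set Implicit Arguments.
Unset Strict Implicit.
Unset Printing Implicit Defensive.
Import Order.TTheory GRing.Theory Num.Theory.
Import numFieldNormedType.Exports.
Local Open Scope classical_set_scope.
Local Open Scope ring_scope.

(** * Strong law of large numbers *)

Section interpolation.
Context {R : realType}.

(** The block comparison does the work of a subadditive ergodic theorem. The constant per block is
    [C], the sum of the [1 / pi j], for which [p i j <= C * pi j]; the resulting sandwich, read for
    all block lengths at once, determines a limit that is the same for almost every sample point.
    The strong law is needed for functions of a window of [K] coordinates, whose cycle sums are
    independent only when the cycles are more than [K] apart; Etemadi's proof tolerates this,
    because dependent neighbours merely multiply the variance bound. The stationary version lives on
    another probability space and shares with [Z] only the law after a renewal. Positivity and
    integrability under it are therefore extracted from time averages of [Z]: a bound on averages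
    that recurs at arbitrarily late times already bounds a stationary integral. The hypothesis
    controls [ln f_s] under [P_s] only. Its positive part is moved to other states by comparing
    [f_s] with [f_j]; for the negative part along the decoded path no pointwise bound is at hand.
    The pair (X, Y) renews at the same times and is already stationary, hence is its own stationary
    version. *)

Lemma nat_interval_containing (k : nat -> nat) (m : nat) :
  (k 0 <= m)%N -> (exists n, (m < k n)%N) ->
  exists2 n, (k n <= m)%N & (m < k n.+1)%N.
Proof.
move=> k0 exn; have [n mn nmin] := ex_minnP exn.
case: n mn nmin => [|n] mn nmin; first by rewrite ltnNge k0 in mn.
exists n => //; rewrite leqNgt; apply/negP => /nmin.
by rewrite ltnn.
Qed.

(** Between [k n] and [k n.+1] monotonicity of [a] changes the average by a factor of at most [rho].
    Each [rho > 1] may come with its own subsequence. *)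
Lemma cvg_average_interpolation (a : nat -> R) (c : R) :
  {homo a : i j / (i <= j)%N >-> i <= j} -> (forall i, 0 <= a i) ->
  (forall rho : R, 1 < rho -> exists k : nat -> nat,
    [/\ {homo k : i j / (i <= j)%N},
        forall m, exists n, (m < k n)%N,
        \forall n \near \oo, (k n.+1)%:R <= rho * (k n)%:R &
        (fun n => a (k n) / (k n)%:R) @ \oo --> c]) ->
  (fun n => a n / n%:R) @ \oo --> c.
Proof.
move=> nda a0 H.
have c0 : 0 <= c.
  have [k [_ _ _ kc]] := H 2 (ltr1n _ _).
  apply: (cvgr_to_ge kc); apply: nearW => n.
  by rewrite divr_ge0.
apply/cvgrPdist_le => e e0.
(* The upper estimate is [(c + d) * (1 + d)], at most [2 * (c + 1)] since [d <= 1]. The lower one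
   loses [d + d * x] with [x <= 2 * (c + 1)], whence the factor [2 * (c + 1) + 1]. *)
pose d := Num.min 1 (e / (2 * (c + 1) + 1)).
have d0 : 0 < d by rewrite lt_min ltr01/= divr_gt0//; lra.
have d1 : d <= 1 by rewrite ge_min lexx.
have de : d * (2 * (c + 1) + 1) <= e.
  by rewrite -ler_pdivlMr; [rewrite ge_min lexx orbT|lra].
have [k [ndk ubk rk kc]] := H (1 + d) ltac:(lra).
move/cvgrPdist_le : kc => /(_ d d0) kc.
have [n0 _ Hn0] := rk; have [n1 _ Hn1] := kc.
pose n2 := maxn n0 n1.
exists (maxn 1 (k n2)) => // m /=; rewrite geq_max => /andP[m1 kn2m].
have [n nm mn] : exists2 n, (k (n2 + n) <= m)%N & (m < k (n2 + n.+1))%N.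
  apply: (nat_interval_containing (k := fun i => k (n2 + i)%N)).
    by rewrite addn0.
  have [n mn] := ubk m; exists n.
  by apply: (leq_trans mn); apply: ndk; apply: leq_addl.
rewrite addnS in mn; set N := (n2 + n)%N in nm mn.
have N0 : (n0 <= N)%N by rewrite /N /n2; lia.
have N1 : (n1 <= N)%N by rewrite /N /n2; lia.
have h1 := Hn0 _ N0; have h2 := Hn1 _ N1; have h3 := Hn1 _ (leqW N1).
rewrite /= in h1 h2 h3.
have m0 : 0 < m%:R :> R by rewrite ltr0n.
have kN1 : 0 < (k N.+1)%:R :> R by rewrite ltr0n; lia.
have kN : 0 < (k N)%:R :> R.
  by have := lt_le_trans kN1 h1; rewrite pmulr_rgt0//; lra.
move: h2; rewrite ler_norml => /andP[_].
rewrite lerBlDr -lerBlDl ler_pdivlMr// => h2.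
move: h3; rewrite ler_norml => /andP[+ _].
rewrite lerBrDr addrC -lerBrDr opprK ler_pdivrMr// => h3.
have nmR : (k N)%:R <= m%:R :> R by rewrite ler_nat.
have mnR : m%:R <= (k N.+1)%:R :> R by rewrite ler_nat ltnW.
have a1 := nda _ _ nm; have a2 := nda _ _ (ltnW mn).
have U : a m / m%:R <= (c + d) * (1 + d).
  rewrite ler_pdivrMr//; apply: (le_trans a2); apply: (le_trans h3).
  rewrite -mulrA ler_wpM2l//; first lra.
  by apply: (le_trans h1); rewrite ler_pM2l//; lra.
have L : (c - d) <= (a m / m%:R) * (1 + d).
  rewrite mulrAC ler_pdivlMr//.
  have [cd|cd] := leP 0 (c - d).
    apply: (@le_trans _ _ ((c - d) * (k N.+1)%:R)); first by rewrite ler_wpM2l.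
    apply: (@le_trans _ _ ((c - d) * ((1 + d) * (k N)%:R))).
      by rewrite ler_wpM2l.
    rewrite mulrCA mulrC ler_wpM2r//; first lra.
    by apply: le_trans a1.
  apply: (@le_trans _ _ 0); first by rewrite mulr_le0_ge0// ltW.
  by rewrite mulr_ge0//; lra.
have X0 : 0 <= a m / m%:R by rewrite divr_ge0// ltW.
have XU : a m / m%:R <= 2 * (c + 1).
  by apply: (le_trans U); nra.
rewrite ler_norml; apply/andP; split; nra.
Qed.

End interpolation.

Section ae_series.
Context d (T : measurableType d) (R : realType) (P : {measure set T -> \bar R}).

(** The form in which Borel-Cantelli is used throughout: a nonnegative series with finite integral
    is finite almost everywhere, so its terms tend to 0. *)
Lemma ae_cvg0_of_summable_integrals (f : nat -> T -> R) :
  (forall n, measurable_fun setT (f n)) -> (forall n w, 0 <= f n w) ->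
  (\sum_(n <oo) \int[P]_w (f n w)%:E < +oo)%E ->
  {ae P, forall w, (fun n => f n w) @ \oo --> (0 : R)}.
Proof.
move=> mf f0 foo.
have mF n : measurable_fun setT (EFin \o f n) by exact/measurable_EFinP.
have F0 n w : (0 <= (f n w)%:E)%E by rewrite lee_fin.
have I : P.-integrable setT (fun w => \sum_(n <oo) (f n w)%:E)%E.
  apply/integrableP; split.
    apply: (@ge0_emeasurable_sum _ T R setT (fun n w => (f n w)%:E) xpredT).
    - by move=> k x _ _; exact: F0.
    - by move=> k _; exact: mF.
  under eq_integral do rewrite gee0_abs ?nneseries_ge0//.
  by rewrite integral_nneseries.
apply: filterS (integrable_ae measurableT I) => w /(_ Logic.I) fin.
apply: cvg_series_cvg_0.
have : (fun n => \sum_(0 <= i < n) (f i w)%:E)%E @ \oo -->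
       (\sum_(n <oo) (f n w)%:E)%E by exact: is_cvg_nneseries.
rewrite -(fineK fin) => /fine_cvgP[_] h.
apply/cvg_ex; exists (fine (\sum_(n <oo) (f n w)%:E)%E).
suff -> : series (fun n => f n w) =
    fine \o (fun n => \sum_(0 <= i < n) (f i w)%:E)%E by [].
by apply/funext => n /=; rewrite sumEFin.
Qed.

End ae_series.

Section bounded_rv.
Context d (T : measurableType d) (R : realType) (P : probability T R).

Definition bounded_rv (f : T -> R) :=
  measurable_fun setT f /\ exists M : R, forall w, `|f w| <= M.

Local Notation E f := (Rintegral P setT f).

Lemma bounded_rv_integrable f : bounded_rv f -> P.-integrable setT (EFin \o f).
Proof.
move=> [mf [M fM]]; apply: measurable_bounded_integrable => //.
  exact: le_lt_trans (probability_le1 P measurableT) (ltry _).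
by exists M; split; [exact: num_real|move=> x Mx w _; exact: le_trans (fM w) (ltW Mx)].
Qed.

Lemma bounded_rv_cst c : bounded_rv (fun=> c).
Proof. by split; [exact: measurable_cst|exists `|c|]. Qed.

Lemma bounded_rvD f g : bounded_rv f -> bounded_rv g ->
  bounded_rv (fun w => f w + g w).
Proof.
move=> [mf [M fM]] [mg [M' gM']]; split; first exact: measurable_funD.
by exists (M + M') => w; rewrite (le_trans (ler_normD _ _))// lerD.
Qed.

Lemma bounded_rvM f g : bounded_rv f -> bounded_rv g ->
  bounded_rv (fun w => f w * g w).
Proof.
move=> [mf [M fM]] [mg [M' gM']]; split; first exact: measurable_funM.
by exists (M * M') => w; rewrite normrM ler_pM.
Qed.

Lemma bounded_rv_sum (I : Type) (r : seq I) (f : I -> T -> R) :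
  (forall i, bounded_rv (f i)) -> bounded_rv (fun w => \sum_(i <- r) f i w).
Proof.
move=> bf; elim: r => [|i r IH].
  under [X in bounded_rv X]eq_fun do rewrite big_nil; exact: bounded_rv_cst.
under [X in bounded_rv X]eq_fun do rewrite big_cons; exact: bounded_rvD.
Qed.

Lemma Rintegral_boundedD f g : bounded_rv f -> bounded_rv g ->
  E (fun w => f w + g w) = E f + E g.
Proof. by move=> bf bg; apply: RintegralD => //; exact: bounded_rv_integrable. Qed.

Lemma Rintegral_boundedZ c f : bounded_rv f -> E (fun w => c * f w) = c * E f.
Proof. by move=> bf; apply: RintegralZl => //; exact: bounded_rv_integrable. Qed.

Lemma Rintegral_prob_cst c : E (fun=> c) = c.
Proof.
by rewrite Rintegral_cst// [X in fine X](probability_setT P) mulr1.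
Qed.

Lemma Rintegral_bounded_sum (I : Type) (r : seq I) (f : I -> T -> R) :
  (forall i, bounded_rv (f i)) ->
  E (fun w => \sum_(i <- r) f i w) = \sum_(i <- r) E (f i).
Proof.
move=> bf; elim: r => [|i r IH].
  rewrite big_nil -[RHS]Rintegral_prob_cst.
  by apply: eq_Rintegral => w _; rewrite big_nil.
rewrite big_cons -IH -Rintegral_boundedD//; last exact: bounded_rv_sum.
by apply: eq_Rintegral => w _; rewrite big_cons.
Qed.

Lemma le_Rintegral_bounded f g : bounded_rv f -> bounded_rv g ->
  (forall w, f w <= g w) -> E f <= E g.
Proof.
by move=> bf bg fg; apply: le_Rintegral => //; exact: bounded_rv_integrable.
Qed.

Lemma sum_near_le (K i n : nat) :
  (\sum_(j < n) ((i < j + K) && (j < i + K)) <= 2 * K)%N.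
Proof.
rewrite -(big_mkord xpredT (fun j => nat_of_bool ((i < j + K)%N && (j < i + K)%N))).
rewrite -big_mkcond sum1_count/= -size_filter.
rewrite -(size_iota (i - K) (2 * K)); apply: uniq_leq_size.
  by rewrite filter_uniq// iota_uniq.
by move=> j; rewrite mem_filter !mem_iota; lia.
Qed.

(** Indices at distance at least [K] have covariance 0, and every index has at most [2 * K] nearer
    ones. A near covariance is at most [q], by [x * y <= (x ^+ 2 + y ^+ 2) / 2]. *)
Lemma second_moment_centered_sum (y : nat -> T -> R) (m q : R) (K n : nat) :
  (forall i, bounded_rv (y i)) -> (forall i, E (y i) = m) ->
  (forall i, E (fun w => y i w * y i w) = q) ->
  (forall i j, (i + K <= j)%N -> E (fun w => y i w * y j w) = m * m) ->
  E (fun w => (\sum_(i < n) y i w - n%:R * m) * (\sum_(i < n) y i w - n%:R * m))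
    <= (2 * K)%:R * n%:R * q.
Proof.
move=> by_ ym yq yK.
have q0 : 0 <= q.
  by rewrite -(yq 0%N); apply: Rintegral_ge0 => w _; rewrite -expr2 sqr_ge0.
pose c i w := y i w + - m.
have bc i : bounded_rv (c i) by apply: bounded_rvD => //; exact: bounded_rv_cst.
have Ec i j : E (fun w => c i w * c j w) = E (fun w => y i w * y j w) - m * m.
  transitivity (E (fun w => y i w * y j w + ((- m) * y i w + ((- m) * y j w + m * m)))).
    by apply: eq_Rintegral => w _; rewrite /c; ring.
  have b1 := bounded_rvM (by_ i) (by_ j).
  have b2 k := bounded_rvM (bounded_rv_cst (- m)) (by_ k).
  have b3 := bounded_rv_cst (m * m).
  rewrite Rintegral_boundedD//; last by do !apply: bounded_rvD.
  rewrite Rintegral_boundedD//; last by do !apply: bounded_rvD.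
  rewrite Rintegral_boundedD// Rintegral_prob_cst !Rintegral_boundedZ// !ym.
  by ring.
rewrite (_ : E _ = \sum_(i < n) \sum_(j < n) E (fun w => c i w * c j w)); last first.
  transitivity (E (fun w => \sum_(i < n) \sum_(j < n) c i w * c j w)).
    apply: eq_Rintegral => w _.
    have -> : \sum_(i < n) y i w - n%:R * m = \sum_(i < n) c i w.
      rewrite big_split/= sumr_const card_ord.
      by rewrite mulNrn mulr_natl.
    rewrite mulr_suml; apply: eq_bigr => i _.
    by rewrite mulr_sumr.
  rewrite Rintegral_bounded_sum; last first.
    by move=> i; apply: bounded_rv_sum => j; exact: bounded_rvM.
  apply: eq_bigr => i _; rewrite Rintegral_bounded_sum//.
  by move=> j; exact: bounded_rvM.
have near i j : E (fun w => c i w * c j w) <=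
    ((i < j + K)%N && (j < i + K)%N)%:R * q.
  rewrite Ec; have [ij|ij] := ltnP i (j + K); last first.
    rewrite mul0r (_ : E _ = m * m) ?subrr// -(yK _ _ ij).
    by apply: eq_Rintegral => w _; rewrite mulrC.
  have [ji|ji] := ltnP j (i + K); last by rewrite (yK _ _ ji) subrr mul0r.
  rewrite mul1r lerBlDr; apply: (@le_trans _ _ q); last first.
    by rewrite lerDl -expr2 sqr_ge0.
  have b2 k := bounded_rvM (by_ k) (by_ k).
  apply: (@le_trans _ _ (E (fun w => 2^-1 * (y i w * y i w + y j w * y j w)))).
    apply: le_Rintegral_bounded; first exact: bounded_rvM.
      by apply: bounded_rvM; [exact: bounded_rv_cst|exact: bounded_rvD].
    by move=> w; have := sqr_ge0 (y i w - y j w); nra.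
  rewrite Rintegral_boundedZ; last exact: bounded_rvD.
  rewrite Rintegral_boundedD// !yq; lra.
apply: (@le_trans _ _ (\sum_(i < n) (2 * K)%:R * q)); last first.
  by rewrite sumr_const card_ord -[X in X <= _]mulr_natl mulrCA mulrA.
apply: ler_sum => i _.
apply: (@le_trans _ _ (\sum_(j < n) ((i < j + K)%N && (j < i + K)%N)%:R * q)).
  by apply: ler_sum => j _; exact: near.
rewrite -mulr_suml ler_wpM2r// -natr_sum ler_nat; exact: sum_near_le.
Qed.

End bounded_rv.

Section laws.
Context d1 d2 d3 (T1 : measurableType d1) (T2 : measurableType d2)
  (U : measurableType d3) (R : realType).
Variables (P1 : {measure set T1 -> \bar R}) (P2 : {measure set T2 -> \bar R}).

Lemma ge0_integral_eq_law (X1 : T1 -> U) (X2 : T2 -> U) (f : U -> \bar R) :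
  measurable_fun setT X1 -> measurable_fun setT X2 ->
  (forall A, measurable A -> P1 (X1 @^-1` A) = P2 (X2 @^-1` A)) ->
  measurable_fun setT f -> (forall x, 0 <= f x)%E ->
  (\int[P1]_w f (X1 w) = \int[P2]_w f (X2 w))%E.
Proof.
move=> mX1 mX2 XX mf f0.
pose Y1 : {mfun T1 >-> U} := HB.pack X1 (isMeasurableFun.Build _ _ _ _ _ mX1).
pose Y2 : {mfun T2 >-> U} := HB.pack X2 (isMeasurableFun.Build _ _ _ _ _ mX2).
transitivity (\int[pushforward P1 Y1]_x f x)%E.
  by rewrite ge0_integral_pushforward.
transitivity (\int[pushforward P2 Y2]_x f x)%E.
  by apply: eq_measure_integral => A mA _; exact: XX.
by rewrite ge0_integral_pushforward.
Qed.

End laws.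

Section independence.
Context d d1 d2 (T : measurableType d) (U1 : measurableType d1)
  (U2 : measurableType d2) (R : realType) (P : probability T R).

Definition independent_rv (X : T -> U1) (Y : T -> U2) :=
  forall A B, measurable A -> measurable B ->
  P (X @^-1` A `&` Y @^-1` B) = (P (X @^-1` A) * P (Y @^-1` B))%E.

(** Independence says that the joint law agrees with the product law on rectangles, hence
    everywhere; Tonelli then separates the factors. *)
Lemma ge0_integral_independent (X : T -> U1) (Y : T -> U2)
    (u : U1 -> \bar R) (v : U2 -> \bar R) :
  measurable_fun setT X -> measurable_fun setT Y -> independent_rv X Y ->
  measurable_fun setT u -> measurable_fun setT v ->
  (forall x, 0 <= u x)%E -> (forall x, 0 <= v x)%E ->
  (\int[P]_w (u (X w) * v (Y w)) = (\int[P]_w u (X w)) * \int[P]_w v (Y w))%E.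
Proof.
move=> mX mY XY mu mv u0 v0.
pose X' : {mfun T >-> U1} := HB.pack X (isMeasurableFun.Build _ _ _ _ _ mX).
pose Y' : {mfun T >-> U2} := HB.pack Y (isMeasurableFun.Build _ _ _ _ _ mY).
have mXY : measurable_fun setT (fun w => (X w, Y w)).
  exact: measurable_fun_pair.
pose Z' : {mfun T >-> (U1 * U2)%type} :=
  HB.pack (fun w => (X w, Y w)) (isMeasurableFun.Build _ _ _ _ _ mXY).
pose f (z : U1 * U2) := (u z.1 * v z.2)%E.
have mf : measurable_fun setT f.
  by apply: emeasurable_funM; apply: measurableT_comp.
have f0 z : (0 <= f z)%E by rewrite mule_ge0.
transitivity (\int[distribution P Z']_z f z)%E.
  by rewrite ge0_integral_pushforward.
transitivity (\int[(distribution P X' \x distribution P Y')%E]_z f z)%E.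
  apply: eq_measure_integral => A mA _; apply/esym.
  apply: product_measure_unique => //.
rewrite fubini_tonelli1//.
transitivity (\int[distribution P X']_x (u x * \int[distribution P Y']_y v y))%E.
  by apply: eq_integral => x _; rewrite -ge0_integralZl.
rewrite ge0_integralZr//; last exact: integral_ge0.
by congr (_ * _)%E; rewrite ge0_integral_pushforward.
Qed.

End independence.

Section geometric_sums.
Context {R : realType}.
Implicit Types b x : R.

Lemma geometric_sum_le b N : 0 <= b < 1 -> \sum_(n < N) b ^+ n <= (1 - b)^-1.
Proof.
move=> /andP[b0 b1]; elim: N => [|N IH]; first by rewrite big_ord0 invr_ge0; lra.
rewrite big_ord_recl expr0.
under eq_bigr do rewrite exprS.
rewrite -mulr_sumr.
apply: (@le_trans _ _ (1 + b * (1 - b)^-1)); first by rewrite lerD2l ler_wpM2l.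
suff -> : 1 + b * (1 - b)^-1 = (1 - b)^-1 by [].
by field; lra.
Qed.

(** After multiplication by [x] this bounds [x ^+ 2 * b ^+ n], summed over the truncation levels
    [b^-1 ^+ n] that are at least [x], by a multiple of [x]. For [x > 1] the first term drops out
    and the rest is the same sum for [x * b]. *)
Lemma truncated_geometric_sum_le b x N : 0 < b < 1 -> 0 <= x ->
  x * \sum_(n < N) (x * b ^+ n <= 1)%R%:R * b ^+ n <= (1 - b)^-1.
Proof.
move=> /andP[b0 b1]; elim: N x => [|N IH] x x0.
  by rewrite big_ord0 mulr0 invr_ge0; lra.
have [x1|x1] := leP x 1.
  apply: (@le_trans _ _ (1 * \sum_(n < N.+1) b ^+ n)); last first.
    by rewrite mul1r geometric_sum_le// b1 andbT ltW.
  apply: ler_pM => //.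
    by apply: sumr_ge0 => i _; rewrite mulr_ge0// exprn_ge0// ltW.
  apply: ler_sum => i _; rewrite ler_piMl ?exprn_ge0 ?(ltW b0)//.
  by rewrite lern1 leq_b1.
rewrite big_ord_recl expr0 !mulr1 (_ : (x <= 1) = false) ?mul0r ?add0r; last first.
  by rewrite leNgt x1.
have := IH (x * b) (mulr_ge0 x0 (ltW b0)).
apply: le_trans; rewrite -mulrA ler_wpM2l// mulr_sumr.
apply: ler_sum => i _.
by rewrite lift0 !exprS (mulrA x) [leRHS]mulrCA.
Qed.

(** The levels below [x] form a geometric progression, whose sum is comparable to its largest term.
    It will control the expected number of variables above the truncation level. *)
Lemma lacunary_sum_le b x N : 0 < b < 1 -> 0 <= x ->
  \sum_(n < N) (b^-1 ^+ n < x)%R%:R * b^-1 ^+ n <= x * (1 - b)^-1.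
Proof.
move=> /andP[b0 b1] x0; elim: N => [|N IH].
  by rewrite big_ord0 mulr_ge0// invr_ge0; lra.
have [h|h] := ltP (b^-1 ^+ N) x; last first.
  by rewrite big_ord_recr/= (_ : (b^-1 ^+ N < x) = false) ?mul0r ?addr0// ltNge h.
apply: (@le_trans _ _ (b^-1 ^+ N * \sum_(n < N.+1) b ^+ n)).
  rewrite mulr_sumr (reindex_inj rev_ord_inj)/=; apply: ler_sum => i _.
  rewrite subSS !exprVn.
  have iN : (i <= N)%N by rewrite -ltnS.
  have expB m k : (k <= m)%N -> b ^- (m - k) = b ^- m * b ^+ k.
    move=> km; rewrite -{2}(subnK km) exprD invfM -mulrA mulVf ?mulr1//.
    by rewrite expf_neq0// gt_eqF.
  rewrite (expB _ _ iN).
  rewrite ler_piMl//; first by rewrite mulr_ge0 ?invr_ge0 ?exprn_ge0// ltW.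
  by rewrite lern1 leq_b1.
apply: ler_pM => //; first by rewrite exprn_ge0// invr_ge0 ltW.
- by apply: sumr_ge0 => i _; rewrite exprn_ge0// ltW.
- exact: ltW.
- by rewrite geometric_sum_le// b1 andbT ltW.
Qed.

End geometric_sums.

Section summable.
Context d (T : measurableType d) (R : realType) (P : {measure set T -> \bar R}).

(** A pathwise bound of the partial sums by a multiple of [xi] spares any computation with the tail
    of the law of [xi]. *)
Lemma summable_integrals_of_bound (g : nat -> T -> R) (xi : T -> R) (C : R) :
  (forall n, measurable_fun setT (g n)) -> (forall n w, 0 <= g n w) ->
  measurable_fun setT xi -> 0 <= C -> (forall w, 0 <= xi w) ->
  (forall N w, \sum_(n < N) g n w <= C * xi w) ->
  (\int[P]_w (xi w)%:E < +oo)%E ->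
  (\sum_(n <oo) \int[P]_w (g n w)%:E < +oo)%E.
Proof.
move=> mg g0 mxi C0 xi0 gC xioo.
have mG n : measurable_fun setT (EFin \o g n) by exact/measurable_EFinP.
have mX : measurable_fun setT (EFin \o xi) by exact/measurable_EFinP.
rewrite -(integral_nneseries P measurableT mG); last first.
  by move=> n w _; rewrite lee_fin.
apply: (@le_lt_trans _ _ (\int[P]_w (C%:E * (xi w)%:E))%E); last first.
  rewrite ge0_integralZl_EFin//; last by move=> w _; rewrite lee_fin.
  rewrite lte_mul_pinfty//.
apply: ge0_le_integral => //.
- by move=> w _; apply: nneseries_ge0 => n _ _; rewrite lee_fin.
- apply: (@ge0_emeasurable_sum _ T R setT (fun n w => (g n w)%:E) xpredT).
    by move=> k x _ _; rewrite lee_fin.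
  by move=> k _; exact: mG.
- by apply: measurable_funeM.
move=> w _; apply: lime_le.
  by apply: is_cvg_nneseries => n _ _; rewrite lee_fin.
apply: nearW => N; rewrite sumEFin -EFinM lee_fin big_mkord; exact: gC.
Qed.

End summable.

Section slln.
Context d (T : measurableType d) (R : realType) (P : probability T R).
Variables (xi : nat -> T -> R) (K : nat).
Hypothesis mxi : forall i, measurable_fun setT (xi i).
Hypothesis xi0 : forall i w, 0 <= xi i w.
Hypothesis xi_id : forall i A, measurable A ->
  P (xi i @^-1` A) = P (xi 0%N @^-1` A).
Hypothesis xi_indep : forall i j, (i + K <= j)%N ->
  independent_rv P (xi i) (xi j).
Hypothesis xi_int : (\int[P]_w (xi 0%N w)%:E < +oo)%E.

Let e := fine (\int[P]_w (xi 0%N w)%:E).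

(** The test [0 <= x] makes [tr c] nonnegative on the whole line, as the transfer of expectations in
    [E_id] asks. *)
Let tr (c x : R) := if (0 <= x) && (x <= c) then x else 0.

Let tr_ge0 c x : 0 <= tr c x.
Proof. by rewrite /tr; case: ifP => [/andP[]|]. Qed.

Let mtr c : measurable_fun setT (tr c).
Proof.
apply: measurable_fun_ifT => //; apply: measurable_and.
  by apply: measurable_fun_ler => //; exact: measurable_cst.
by apply: measurable_fun_ler => //; exact: measurable_cst.
Qed.

Let btr c i : bounded_rv (fun w => tr c (xi i w)).
Proof.
split; first exact: measurableT_comp (mtr c) (mxi i).
exists `|c| => w; rewrite /tr; case: ifP => [/andP[x0 xc]|_]; last by rewrite normr0.
by rewrite ger0_norm// (le_trans xc)// ler_norm.
Qed.

Let E_id (u : R -> R) i : measurable_fun setT u -> (forall x, 0 <= u x) ->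
  (\int[P]_w (u (xi i w))%:E = \int[P]_w (u (xi 0%N w))%:E)%E.
Proof.
move=> mu u0.
apply: (ge0_integral_eq_law (f := EFin \o u)) => //.
- exact: xi_id.
- exact/measurable_EFinP.
Qed.

Let ER_id c i : Rintegral P setT (fun w => tr c (xi i w)) =
  Rintegral P setT (fun w => tr c (xi 0%N w)).
Proof. by rewrite /Rintegral E_id. Qed.

Let ER2_id c i : Rintegral P setT (fun w => tr c (xi i w) * tr c (xi i w)) =
  Rintegral P setT (fun w => tr c (xi 0%N w) * tr c (xi 0%N w)).
Proof.
rewrite /Rintegral (E_id (u := fun x => tr c x * tr c x))//.
  exact: measurable_funM.
by move=> x; rewrite mulr_ge0.
Qed.

Let ERM c i j : (i + K <= j)%N ->
  Rintegral P setT (fun w => tr c (xi i w) * tr c (xi j w)) =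
  Rintegral P setT (fun w => tr c (xi 0%N w)) *
  Rintegral P setT (fun w => tr c (xi 0%N w)).
Proof.
move=> ij; rewrite -{1}(ER_id c i) -(ER_id c j).
have fin k : (\int[P]_w (tr c (xi k w))%:E \is a fin_num)%E.
  exact: integrable_fin_num (bounded_rv_integrable P (btr c k)).
rewrite /Rintegral -fineM//; congr fine.
rewrite -(ge0_integral_independent (P := P) (X := xi i) (Y := xi j)
  (u := EFin \o tr c) (v := EFin \o tr c))//; try exact/measurable_EFinP.
- exact: xi_indep.
- by move=> x; rewrite lee_fin.
- by move=> x; rewrite lee_fin.
Qed.

Section geometric_subsequence.
Variable b : R.
Hypothesis b01 : 0 < b < 1.

Let b0 : 0 < b. Proof. by case/andP : b01. Qed.
Let b1 : b < 1. Proof. by case/andP : b01. Qed.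
(** The times are the integer parts [k n], but the truncation level is [a n] itself, for which
    [a n * b ^+ n = 1] holds exactly. *)
Let a n := b^-1 ^+ n.
Let k n := Num.trunc (a n).

Let a_gt0 n : 0 < a n. Proof. by rewrite exprn_gt0// invr_gt0. Qed.
Let a_ge1 n : 1 <= a n. Proof. by rewrite exprn_ege1// invf_ge1// ltW. Qed.
Let ab n : a n * b ^+ n = 1.
Proof. by rewrite /a exprVn mulVf// expf_neq0// gt_eqF. Qed.
Let k_le n : (k n)%:R <= a n.
Proof. by case/andP : (truncn_itv (ltW (a_gt0 n))). Qed.
Let k_gt n : a n < (k n)%:R + 1.
Proof. by rewrite natr1; case/andP : (truncn_itv (ltW (a_gt0 n))). Qed.
Let k_ge1 n : 1 <= (k n)%:R :> R.
Proof. by rewrite ler1n truncn_ge_nat ?a_ge1// ltW. Qed.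
Let k_gt0 n : 0 < (k n)%:R :> R.
Proof. exact: lt_le_trans (k_ge1 n). Qed.
Let k_ge n : a n / 2 <= (k n)%:R.
Proof. by have := k_gt n; have := k_ge1 n; lra. Qed.

Let C_ge0 : 0 <= (1 - b)^-1.
Proof. by rewrite invr_ge0 subr_ge0 ltW. Qed.

Let m n := Rintegral P setT (fun w => tr (a n) (xi 0%N w)).

Let b_cvg0 (x : R) : (fun n => x * b ^+ n) @ \oo --> (0 : R).
Proof.
rewrite -(mulr0 x); apply: cvgMr; apply: cvg_expr.
by rewrite gtr0_norm.
Qed.

Let cvg_m : m @ \oo --> e.
Proof.
have fi : P.-integrable setT (EFin \o xi 0%N).
  apply/integrableP; split; first exact/measurable_EFinP.
  by under eq_integral do rewrite /= ger0_norm//.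
have [_ _] := @dominated_convergence _ _ _ P setT measurableT
  (fun n w => (tr (a n) (xi 0%N w))%:E) (EFin \o xi 0%N) (EFin \o xi 0%N)
  ltac:(move=> n; apply/measurable_EFinP; exact: measurableT_comp (mtr (a n)) (mxi 0))
  ltac:(exact/measurable_EFinP)
  ltac:(apply: aeW => w _; apply: cvg_near_cst;
    have := b_cvg0 (xi 0%N w) => /cvgr_le/(_ 1 ltr01); apply: filterS => n /= h;
    rewrite /tr xi0/= (_ : xi 0%N w <= a n)//;
    by rewrite -(ler_pM2r (exprn_gt0 n b0)) ab) fi
  ltac:(apply: aeW => w n _ /=; rewrite lee_fin ger0_norm// /tr;
    by case: ifP => // _).
rewrite -(fineK (integrable_fin_num measurableT fi)) => /fine_cvgP[_].
exact.
Qed.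

(** The variance of the truncated sum is at most [2 * K * k n] times the truncated second moment.
    Division by the square of [k n] leaves a multiple of [b ^+ n] times that moment, which is
    summable by [truncated_geometric_sum_le]. *)
Let cvg_var : {ae P, forall w,
  (fun n => ((\sum_(i < k n) tr (a n) (xi i w) - (k n)%:R * m n) *
            (\sum_(i < k n) tr (a n) (xi i w) - (k n)%:R * m n)) *
            (k n)%:R ^- 2) @ \oo --> (0 : R)}.
Proof.
have bs n : bounded_rv (fun w => \sum_(i < k n) tr (a n) (xi i w) - (k n)%:R * m n).
  apply: bounded_rvD; last exact: bounded_rv_cst.
  by apply: bounded_rv_sum => i; exact: btr.
have bss n := bounded_rvM (bs n) (bs n).
have bsc n := bounded_rvM (bss n) (bounded_rv_cst T ((k n)%:R ^- 2)).
apply: (ae_cvg0_of_summable_integrals (P := P) (f := fun n w => _)).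
- by move=> n; have [] := bsc n.
- by move=> n w; rewrite mulr_ge0// ?invr_ge0 ?exprn_ge0// -expr2 sqr_ge0.
pose g n w := b ^+ n * (tr (a n) (xi 0%N w) * tr (a n) (xi 0%N w)).
have bg n : bounded_rv (g n).
  by apply: bounded_rvM; [exact: bounded_rv_cst|exact: bounded_rvM].
have g0 n w : 0 <= g n w by rewrite !mulr_ge0// exprn_ge0// ltW.
have gB N w : \sum_(n < N) g n w <= (1 - b)^-1 * xi 0%N w.
  have := truncated_geometric_sum_le N b01 (xi0 0%N w).
  move=> /(ler_wpM2r (xi0 0%N w)); apply: le_trans.
  rewrite mulrAC mulr_sumr; apply: ler_sum => i _.
  rewrite /g /tr xi0/= -(ler_pM2r (exprn_gt0 i b0) (xi 0%N w)) ab.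
  by case: ifP => _; rewrite ?(mulr0, mul0r)// mul1r mulrC.
have gs := summable_integrals_of_bound (P := P) (C := (1 - b)^-1) (fun n => (bg n).1) g0 (mxi 0)
  C_ge0 (xi0 0%N) gB xi_int.
apply: (@le_lt_trans _ _
  (\sum_(n <oo) ((4 * (2 * K)%:R)%:E * \int[P]_w (g n w)%:E))%E); last first.
  rewrite nneseriesZl; last by move=> n _; apply: integral_ge0 => w _; rewrite lee_fin.
  by rewrite lte_mul_pinfty//.
apply: lee_nneseries => n _.
  move=> _; apply: integral_ge0 => w _; rewrite lee_fin.
  by rewrite mulr_ge0// ?invr_ge0 ?exprn_ge0// -expr2 sqr_ge0.
have F1 := integrable_fin_num measurableT (bounded_rv_integrable P (bsc n)).
have F2 := integrable_fin_num measurableT (bounded_rv_integrable P (bg n)).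
rewrite -(fineK F1) -(fineK F2) -EFinM lee_fin.
have -> : fine (\int[P]_w (EFin \o g n) w) = Rintegral P setT (g n) by [].
rewrite [leLHS](_ : _ = (k n)%:R ^- 2 * Rintegral P setT (fun w =>
  (\sum_(i < k n) tr (a n) (xi i w) - (k n)%:R * m n) *
  (\sum_(i < k n) tr (a n) (xi i w) - (k n)%:R * m n))); last first.
  rewrite -(Rintegral_boundedZ P _ (bss n)).
  by apply: eq_Rintegral => w _; rewrite mulrC.
rewrite /g Rintegral_boundedZ; last exact: bounded_rvM.
set q := Rintegral P setT (fun w => tr (a n) (xi 0%N w) * tr (a n) (xi 0%N w)).
have q0 : 0 <= q.
  by apply: Rintegral_ge0 => w _; rewrite mulr_ge0.
have V := second_moment_centered_sum (K := K) (k n) (btr (a n)) (ER_id (a n))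
  (ER2_id (a n)) (@ERM (a n)).
apply: (@le_trans _ _ ((k n)%:R ^- 2 * ((2 * K)%:R * (k n)%:R * q))).
  by rewrite ler_wpM2l// invr_ge0 exprn_ge0.
have -> : (k n)%:R ^- 2 * ((2 * K)%:R * (k n)%:R * q) =
    (2 * K)%:R * q * (k n)%:R^-1.
  by field; rewrite gt_eqF.
rewrite [leRHS](_ : _ = (2 * K)%:R * q * (4 * b ^+ n)); last by ring.
rewrite ler_wpM2l//; first by rewrite mulr_ge0.
rewrite -[leLHS]mul1r ler_pdivrMr// -[leLHS](ab n).
rewrite [leRHS]mulrAC ler_pM2r ?exprn_gt0//.
by have := k_ge n; have := a_gt0 n; lra.
Qed.

(** The expected number of indices below [k n] whose variable exceeds [a n] is at most
    [a n * P (xi 0 > a n)], a summable sequence. The number therefore tends to 0, and a single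
    exceedance would make it at least 1. *)
Let ev_trunc : {ae P, forall w, \forall n \near \oo,
  forall i, (i < k n)%N -> xi i w <= a n}.
Proof.
pose h (c x : R) : R := (c < x)%R%:R.
have mh c : measurable_fun setT (h c).
  rewrite (_ : h c = fun x => if c < x then 1 else 0); last first.
    by apply/funext => x; rewrite /h; case: (c < x).
  apply: measurable_fun_ifT => //; apply: measurable_fun_ltr => //.
have bh c i : bounded_rv (fun w => h c (xi i w)).
  split; first exact: measurableT_comp (mh c) (mxi i).
  by exists 1 => w; rewrite ger0_norm// lern1 leq_b1.
have : {ae P, forall w,
    (fun n => \sum_(i < k n) h (a n) (xi i w)) @ \oo --> (0 : R)}.
  apply: (ae_cvg0_of_summable_integrals (P := P) (f := fun n w => _)).
  - by move=> n; have [] := @bounded_rv_sum _ _ R _ (index_enum 'I_(k n)) _ (fun i => bh (a n) i).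
  - by move=> n w; apply: sumr_ge0.
  pose g n w := a n * h (a n) (xi 0%N w).
  have bg n : bounded_rv (g n).
    by apply: bounded_rvM; [exact: bounded_rv_cst|exact: bh].
  have g0 n w : 0 <= g n w by rewrite mulr_ge0// ltW.
  have gB N w : \sum_(n < N) g n w <= (1 - b)^-1 * xi 0%N w.
    have := lacunary_sum_le N b01 (xi0 0%N w).
    rewrite mulrC; apply: le_trans.
    by apply: ler_sum => i _; rewrite /g mulrC.
  have gs := summable_integrals_of_bound (P := P) (C := (1 - b)^-1) (fun n => (bg n).1) g0 (mxi 0)
    C_ge0 (xi0 0%N) gB xi_int.
  apply: le_lt_trans gs; apply: lee_nneseries => n _.
    by move=> _; apply: integral_ge0 => w _; rewrite lee_fin sumr_ge0.
  under eq_integral do rewrite -sumEFin.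
  rewrite ge0_integral_sum//; first last.
  - by move=> i w _; rewrite lee_fin.
  - by move=> i; apply/measurable_EFinP; have [] := bh (a n) i.
  under eq_bigr do rewrite (E_id (u := h (a n)))//.
  rewrite /g; under [leRHS]eq_integral do rewrite EFinM.
  rewrite ge0_integralZl_EFin//; first last.
  - exact: ltW.
  - by apply/measurable_EFinP; have [] := bh (a n) 0%N.
  - by move=> w _; rewrite lee_fin.
  have F := integrable_fin_num measurableT (bounded_rv_integrable P (bh (a n) 0%N)).
  rewrite -(fineK F) sumEFin -EFinM lee_fin sumr_const card_ord -mulr_natl.
  rewrite ler_wpM2r//; apply: fine_ge0; apply: integral_ge0 => w _.
  by rewrite lee_fin.
apply: filterS => w /cvgr_lt/(_ 1 ltr01); apply: filterS => n hn i ik.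
rewrite leNgt; apply/negP => axi; move: hn.
rewrite (bigD1 (Ordinal ik))//= {1}/h axi ltNge lerDl.
by rewrite sumr_ge0.
Qed.

Lemma slln_geometric_subsequence : {ae P, forall w,
  (fun n => (\sum_(i < k n) xi i w) / (k n)%:R) @ \oo --> e}.
Proof.
apply: filterS2 cvg_var ev_trunc => w h1 h2.
have h3 : (fun n => (\sum_(i < k n) tr (a n) (xi i w)) / (k n)%:R - m n) @ \oo
    --> (0 : R).
  apply/cvgrPdist_le => x x0.
  have xx : 0 < x ^+ 2 by rewrite exprn_gt0.
  have [n0 _ hn0] := cvgr_le _ h1 _ xx; exists n0 => // n /hn0 /= hn.
  rewrite sub0r normrN -(@ler_pXn2r _ 2)// ?nnegrE ?normr_ge0// ?(ltW x0)//.
  rewrite real_normK ?num_real//; apply: le_trans hn.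
  rewrite le_eqVlt; apply/orP; left; apply/eqP.
  by field; rewrite gt_eqF.
have -> : e = 0 + e by rewrite add0r.
apply: (cvg_trans _ (cvgD h3 cvg_m)); apply: near_eq_cvg.
apply: filterS h2 => n hn /=; rewrite subrK; congr (_ / _).
by apply: eq_bigr => i _; rewrite /tr xi0/= hn.
Qed.

(** Rounding down costs at most a factor [b] once [a n >= (1 - b)^-1], so consecutive times have
    ratio at most [b ^- 2] instead of [b^-1]. *)
Lemma geometric_subsequence_growth (rho : R) : b ^- 2 <= rho ->
  [/\ {homo k : i j / (i <= j)%N},
      forall i, exists n, (i < k n)%N &
      \forall n \near \oo, (k n.+1)%:R <= rho * (k n)%:R :> R].
Proof.
move=> brho; have nda : {homo a : i j / (i <= j)%N >-> i <= j}.
  by move=> i j ij; apply: ler_weXn2l => //; rewrite invf_ge1// ltW.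
have big (x : R) : 0 < x -> \forall n \near \oo, x <= a n.
  move=> x0; have := b_cvg0 x => /cvgr_le/(_ 1 ltr01); apply: filterS => n h.
  by rewrite -(ler_pM2r (exprn_gt0 n b0)) ab.
split.
- by move=> i j ij; apply: le_truncn; exact: nda.
- move=> i; have [n _ /(_ n (leqnn _)) /= h] := big i.+1%:R (ltr0Sn _ _).
  by exists n; rewrite truncn_ge_nat// ltW.
have c0 : 0 < (1 - b)^-1 by rewrite invr_gt0 subr_gt0.
have := big _ c0; apply: filterS => n.
rewrite -[leLHS]mul1r ler_pdivrMr ?subr_gt0//.
move=> h; have kn := k_gt n.
have kb : a n * b <= (k n)%:R by lra.
apply: (le_trans (k_le n.+1)).
apply: (@le_trans _ _ (b ^- 2 * (a n * b))).
  rewrite le_eqVlt; apply/orP; left; apply/eqP; rewrite /a exprS; field.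
  by rewrite gt_eqF.
by apply: ler_pM => //; rewrite ?invr_ge0 ?exprn_ge0// ?mulr_ge0// ltW.
Qed.

End geometric_subsequence.

(** Etemadi's strong law. Nonnegativity allows the interpolation between geometric times, and
    independence is asked only of pairs at distance at least [K], which is what window functions of
    a regenerative process provide. *)
Theorem slln : {ae P, forall w,
  (fun n => (\sum_(i < n) xi i w) / n%:R) @ \oo --> e}.
Proof.
(* Countably many ratios, tending to 1, keep the exceptional set null. *)
pose b (q : nat) : R := (1 + q.+1%:R^-1)^-1.
have b01 q : 0 < b q < 1.
  have q0 : 0 < q.+1%:R^-1 :> R by rewrite invr_gt0.
  apply/andP; split; first by rewrite invr_gt0 addr_gt0.
  by rewrite invf_lt1 ?addr_gt0// ltrDl.
have := ae_foralln (fun q => slln_geometric_subsequence (b01 q)).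
apply: filterS => w hw.
apply: cvg_average_interpolation.
- move=> i j ij; rewrite -(subnKC ij) big_split_ord/= lerDl.
  by rewrite sumr_ge0.
- by move=> i; rewrite sumr_ge0.
move=> rho rho1.
have [q hq] : exists q, b q ^- 2 <= rho.
  (* For [0 < x <= 1] one has [(1 + x) ^+ 2 <= 1 + 3 * x], so [3 * x <= rho - 1] suffices. *)
  exists (Num.trunc (3 / (rho - 1))).
  set q := Num.trunc _.
  have /andP[_] := truncn_itv (x := 3 / (rho - 1)) ltac:(by rewrite divr_ge0; lra).
  rewrite -/q ltr_pdivrMr ?subr_gt0// => h.
  rewrite /b -exprVn invrK.
  have q0 : 0 < q.+1%:R :> R by [].
  have q1 : 1 <= q.+1%:R :> R by rewrite ler1n.
  have i0 : 0 < q.+1%:R^-1 :> R by rewrite invr_gt0.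
  have i1 : q.+1%:R^-1 <= 1 :> R by rewrite invf_le1.
  have : 3 * q.+1%:R^-1 <= rho - 1 by rewrite ler_pdivrMr// mulrC ltW.
  move: i0 i1; rewrite expr2; set x := _^-1 => i0 i1 h3; nra.
have [h1 h2 h3] := geometric_subsequence_growth (b01 q) hq.
eexists; split; [exact: h1|exact: h2|exact: h3|exact: hw].
Qed.

End slln.

(** * Regenerative processes *)

Lemma measurable_fun_nat_index d d' (T : measurableType d)
    (U : measurableType d') (tau : T -> nat) (g : nat -> T -> U) :
  measurable_fun setT tau -> (forall n, measurable_fun setT (g n)) ->
  measurable_fun setT (fun w => g (tau w) w).
Proof.
move=> mtau mg _ A mA; rewrite setTI.
rewrite (_ : _ @^-1` A = \bigcup_n (tau @^-1` [set n] `&` (g n @^-1` A))).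
  apply: bigcupT_measurable => n; apply: measurableI.
    by rewrite -[X in measurable X]setTI; exact: mtau.
  by rewrite -[X in measurable X]setTI; exact: mg.
apply/seteqP; split => [w Aw|w [n _ [/= tn gA]]]; last by rewrite /= tn.
by exists (tau w).
Qed.

Lemma measurable_fun_natP d (T : measurableType d) (tau : T -> nat) :
  (forall n, measurable [set w | tau w = n]) -> measurable_fun setT tau.
Proof.
move=> mtau _ A _; rewrite setTI.
rewrite (_ : _ @^-1` A = \bigcup_(n in A) [set w | tau w = n]).
  by apply: bigcup_measurable => n _; exact: mtau.
by apply/seteqP; split => [w Aw|w [n An /= e]]; [exists (tau w)|rewrite /= e].
Qed.

(** * Path spaces, cylinder events and independence of cycles *)

Section seqspace.
Context d (T : measurableType d).

Definition seq_cylinders : set (set (nat -> T)) :=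
  [set C | exists n (B : nat -> set T), (forall i, measurable (B i)) /\
    C = [set x | forall i, (i < n)%N -> B i (x i)]].

(** The product sigma-algebra, generated by the cylinders in which [stationary] and
    [stationary_version] are stated; equalities on those events then extend to all measurable
    ones. *)
Definition seqspace := g_sigma_algebraType seq_cylinders.

HB.instance Definition _ := Measurable.on seqspace.

Lemma seq_cylinders_setI : setI_closed seq_cylinders.
Proof.
move=> _ _ [n [B [mB ->]]] [m [C [mC ->]]].
exists (maxn n m), (fun i => (if (i < n)%N then B i else setT) `&`
                             (if (i < m)%N then C i else setT)).
split.
  by move=> i; apply: measurableI; case: ifP.
apply/seteqP; split => [x [Bx Cx] i _|x BCx].
  by split; case: ifP => // h; [exact: Bx|exact: Cx].
split => i h; have := BCx i; rewrite leq_max h ?orbT => /(_ isT)[]//.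
Qed.

Lemma seq_cylinders_setT : seq_cylinders setT.
Proof. by exists 0%N, (fun=> setT); split => //; apply/seteqP; split. Qed.

Lemma measurable_seq_cylinder n (B : nat -> set T) :
  (forall i, measurable (B i)) ->
  measurable ([set x : seqspace | forall i, (i < n)%N -> B i (x i)]).
Proof. by move=> mB; apply: sub_sigma_algebra; exists n, B. Qed.

Lemma measurable_coord i : measurable_fun setT (fun x : seqspace => x i).
Proof.
move=> _ A mA; rewrite setTI.
rewrite (_ : _ @^-1` A = [set x : seqspace | forall j, (j < i.+1)%N ->
    (if j == i then A else setT) (x j)]).
  apply: (measurable_seq_cylinder i.+1
    (B := fun j => if j == i then A else setT)).
  by move=> j; case: ifP.
apply/seteqP; split => [x Ax j _|x /(_ i (ltnSn _))]; last by rewrite eqxx.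
by case: eqP => // ->.
Qed.

Lemma measurable_fun_seq d' (W : measurableType d') (f : W -> nat -> T) :
  (forall i, measurable_fun setT (fun w => f w i)) ->
  measurable_fun setT (f : W -> seqspace).
Proof.
move=> mf; apply: (@measurability _ _ W (g_sigma_algebraType seq_cylinders) setT f seq_cylinders) => //.
move=> _ [_ [n [B [mB ->]]] <-].
rewrite setTI (_ : f @^-1` _ = \bigcap_(i in [set i | (i < n)%N])
  ((fun w => f w i) @^-1` B i)).
  apply: bigcap_measurableType => i _.
  by rewrite -[X in measurable X]setTI; exact: mf.
by apply/seteqP; split.
Qed.

Lemma measurable_shift n :
  measurable_fun setT ((fun x i => x (n + i)%N) : seqspace -> seqspace).
Proof. by apply: measurable_fun_seq => i; exact: measurable_coord. Qed.

End seqspace.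

Section equal_laws.
Context d1 d2 (W1 : measurableType d1) (W2 : measurableType d2) (R : realType)
  (P1 : probability W1 R) (P2 : probability W2 R).

Lemma eq_law_of_pi_system (U : pointedType) (G : set (set U))
    (f1 : W1 -> U) (f2 : W2 -> U) :
  setI_closed G -> G setT ->
  (forall A, G A -> measurable (f1 @^-1` A)) ->
  (forall A, G A -> measurable (f2 @^-1` A)) ->
  (forall A, G A -> P1 (f1 @^-1` A) = P2 (f2 @^-1` A)) ->
  forall A, <<s G >> A -> P1 (f1 @^-1` A) = P2 (f2 @^-1` A).
Proof.
move=> GI GT mf1 mf2 ff A sA.
have m1 : measurable_fun setT (f1 : W1 -> g_sigma_algebraType G).
  apply: (@measurability _ _ W1 (g_sigma_algebraType G) setT f1 G) => //.
  by move=> _ [B GB <-]; rewrite setTI; exact: mf1.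
have m2 : measurable_fun setT (f2 : W2 -> g_sigma_algebraType G).
  apply: (@measurability _ _ W2 (g_sigma_algebraType G) setT f2 G) => //.
  by move=> _ [B GB <-]; rewrite setTI; exact: mf2.
pose g1 : {mfun W1 >-> g_sigma_algebraType G} :=
  HB.pack (f1 : W1 -> g_sigma_algebraType G) (isMeasurableFun.Build _ _ _ _ _ m1).
pose g2 : {mfun W2 >-> g_sigma_algebraType G} :=
  HB.pack (f2 : W2 -> g_sigma_algebraType G) (isMeasurableFun.Build _ _ _ _ _ m2).
pose n1 : {measure set (g_sigma_algebraType G) -> \bar R} := distribution P1 g1.
pose n2 : {measure set (g_sigma_algebraType G) -> \bar R} := distribution P2 g2.
apply: (@measure_unique _ R (g_sigma_algebraType G) G (fun=> setT)
  erefl GI (fun=> GT) _ n1 n2 ff _ A sA).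
  by apply/seteqP; split => // x _; exists 0%N.
by move=> _; exact: le_lt_trans (probability_le1 (distribution P1 g1) measurableT) (ltry _).
Qed.

Lemma eq_law_seq d (T : measurableType d) (f1 : W1 -> nat -> T)
    (f2 : W2 -> nat -> T) :
  (forall i, measurable_fun setT (fun w => f1 w i)) ->
  (forall i, measurable_fun setT (fun w => f2 w i)) ->
  (forall n (B : nat -> set T), (forall i, measurable (B i)) ->
    P1 [set w | forall i, (i < n)%N -> B i (f1 w i)] =
    P2 [set w | forall i, (i < n)%N -> B i (f2 w i)]) ->
  forall A : set (seqspace T), measurable A -> P1 (f1 @^-1` A) = P2 (f2 @^-1` A).
Proof.
move=> mf1 mf2 ff A mA.
apply: (eq_law_of_pi_system (G := @seq_cylinders _ T)) => //.
- exact: seq_cylinders_setI.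
- exact: seq_cylinders_setT.
- move=> B GB; rewrite -[X in measurable X]setTI.
  by apply: measurable_fun_seq => //; exact: sub_sigma_algebra.
- move=> B GB; rewrite -[X in measurable X]setTI.
  by apply: measurable_fun_seq => //; exact: sub_sigma_algebra.
- by move=> _ [n [B [mB ->]]]; exact: ff.
Qed.

End equal_laws.

Section independence_pi_system.
Context d (T : measurableType d) (R : realType) (P : probability T R).

(** For fixed [B] the events independent of [B] form a Dynkin class. Measurability is part of the
    conclusion because [<<s G >>] is in general only a sub-sigma-algebra. *)
Lemma independent_sigma_of_pi_system (G : set (set T)) (B : set T) :
  setI_closed G -> (forall A, G A -> measurable A) -> measurable B ->
  (forall A, G A -> P (A `&` B) = (P A * P B)%E) ->
  forall A, <<s G >> A -> measurable A /\ P (A `&` B) = (P A * P B)%E.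
Proof.
move=> GI GM mB GB A sA.
have mG (C : set T) : <<s G >> C -> measurable C.
  apply: smallest_sub => //.
  exact: sigma_algebra_measurable.
split; first exact: mG.
have finP C : measurable C -> P C \is a fin_num by exact: fin_num_measure.
have ltP C : measurable C -> (P C < +oo)%E.
  by move=> mC; exact: le_lt_trans (probability_le1 P mC) (ltry _).
have HC C : measurable C -> P (C `&` B) = (P C * P B)%E ->
    P (~` C `&` B) = (P (~` C) * P B)%E.
  move=> mC CB; have -> : ~` C `&` B = B `\` C by rewrite setDE setIC.
  rewrite measureD//; last exact: ltP.
  rewrite [X in (_ - X)%E = _](_ : _ = (P C * P B)%E); last first.
    by rewrite setIC; exact: CB.
  rewrite (probability_setC P mC).
  by rewrite muleBl ?mul1e ?finP// fin_num_adde_defr// finP.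
have HU (F : (set T)^nat) : (forall n, measurable (F n)) -> trivIset setT F ->
    (forall n, P (F n `&` B) = (P (F n) * P B)%E) ->
    P (\bigcup_k F k `&` B) = (P (\bigcup_k F k) * P B)%E.
  move=> mF tF FB; rewrite setI_bigcupl measure_semi_bigcup//; last 3 first.
  + by move=> n; exact: measurableI.
  + exact: trivIset_setIr.
  + by apply: bigcupT_measurable => n; exact: measurableI.
  rewrite measure_semi_bigcup//; last exact: bigcupT_measurable.
  transitivity (\sum_(n <oo) (P B * P (F n)))%E.
    by apply: eq_eseriesr => n _; rewrite muleC; exact: FB.
  by rewrite -(fineK (finP B mB)) nneseriesZl// muleC.
apply: (@dynkin_induction _ (g_sigma_algebraType G) G
  (fun A => P (A `&` B) = (P A * P B)%E)) => //.
- by rewrite setTI probability_setT mul1e.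
- by move=> C mC; exact: HC (mG C mC).
- by move=> F mF; exact: HU (fun n => mG (F n) (mF n)).
Qed.

End independence_pi_system.

Lemma ae_eq_measure d (T : measurableType d) (R : realType)
    (P : {measure set T -> \bar R}) (A B : set T) :
  measurable A -> measurable B ->
  {ae P, forall w, A w <-> B w} -> P A = P B.
Proof.
move=> mA mB AB.
have AB1 : {ae P, forall w, setT w -> (\1_A w)%:E = (\1_B w)%:E :> \bar R}.
  apply: filterS AB => w AB _; congr EFin; rewrite !indicE.
  by congr (nat_of_bool _)%:R; apply/idP/idP; rewrite !inE => /AB.
rewrite -(setIT A) -(setIT B) -!integral_indic//.
by apply: ge0_ae_eq_integral => //; exact/measurable_EFinP.
Qed.

Section joint_paths.
Context d (T : measurableType d).

Definition joint_cylinder n (B : nat -> set T) (u : nat -> nat) :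
    set ((nat -> T) * (nat -> nat)) :=
  [set z | (forall i, (i < n)%N -> B i (z.1 i)) /\
           (forall i, (i < n)%N -> z.2 i = u i)].

(* the empty set is added to make a pi-system: distinct values of [u] are
   incompatible *)
Definition joint_cylinders : set (set ((nat -> T) * (nat -> nat))) :=
  [set C | C = set0 \/ exists n B u, (forall i, measurable (B i)) /\
    C = joint_cylinder n B u].

Definition joint_paths := g_sigma_algebraType joint_cylinders.

HB.instance Definition _ := Measurable.on joint_paths.

Lemma joint_cylinders_setI : setI_closed joint_cylinders.
Proof.
move=> A1 A2 [->|[n [B [u [mB ->]]]]]; first by rewrite set0I; left.
move=> [->|[m [C [v [mC ->]]]]]; first by rewrite setI0; left.
have [uv|uv] := pselect (forall i, (i < n)%N -> (i < m)%N -> u i = v i).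
  right; exists (maxn n m), (fun i => (if (i < n)%N then B i else setT) `&`
    (if (i < m)%N then C i else setT)), (fun i => if (i < n)%N then u i else v i).
  split; first by move=> i; apply: measurableI; case: ifP.
  apply/seteqP; split => [z [[Bz uz] [Cz vz]]|z [BCz uvz]].
    split => i; rewrite leq_max => im.
      by split; case: ifP => // h; [exact: Bz|exact: Cz].
    case: ifP im => [h _|_ /= h]; [exact: uz|exact: vz].
  split; split => i h.
  - by have := BCz i; rewrite leq_max h/= => /(_ isT)[].
  - by have := uvz i; rewrite leq_max h/= => /(_ isT).
  - by have := BCz i; rewrite leq_max h orbT/= => /(_ isT)[].
  - have := uvz i; rewrite leq_max h orbT/= => /(_ isT) ->.
    by case: ifP => // hn; exact: uv.
left; apply/seteqP; split => // z [[_ uz] [_ vz]]; apply: uv => i h1 h2.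
by rewrite -uz// -vz.
Qed.

Lemma joint_cylinders_setT : joint_cylinders setT.
Proof.
by right; exists 0%N, (fun=> setT), (fun=> 0%N); split => //; apply/seteqP; split.
Qed.

Lemma measurable_joint_cylinder n (B : nat -> set T) (u : nat -> nat) :
  (forall i, measurable (B i)) ->
  measurable (joint_cylinder n B u : set joint_paths).
Proof. by move=> mB; apply: sub_sigma_algebra; right; exists n, B, u. Qed.

(** A joint cylinder fixes renewal times along with the process and so never isolates one
    coordinate. The union over the countably many finite lists of renewal times removes this
    constraint. *)
Lemma measurable_joint_coord1 i :
  measurable_fun setT (fun z : joint_paths => z.1 i).
Proof.
move=> _ A mA; rewrite setTI.
pose B j := if j == i then A else setT.
rewrite (_ : _ @^-1` A =
    \bigcup_(s in @setT (seq nat)) joint_cylinder i.+1 B (nth 0%N s)).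
  apply: countable_bigcupT_measurable => // s; apply: measurable_joint_cylinder.
  by move=> j; rewrite /B; case: ifP.
apply/seteqP; split => [z Az|z [s _ [/(_ i (ltnSn _))]]].
  exists (mkseq z.2 i.+1) => //; split => j ji; last by rewrite nth_mkseq.
  by rewrite /B; case: eqP => // ->.
by rewrite /B eqxx.
Qed.

Lemma measurable_joint_coord2 i :
  measurable_fun setT (fun z : joint_paths => z.2 i).
Proof.
apply: measurable_fun_natP => n.
rewrite (_ : [set _ | _] =
    \bigcup_(s in @setT (seq nat)) (if nth 0%N s i == n
      then joint_cylinder i.+1 (fun=> setT) (nth 0%N s) else set0)).
  apply: countable_bigcupT_measurable => // s; case: ifP => _ //.
  exact: measurable_joint_cylinder.
apply/seteqP; split => [z zn|z [s _]].
  exists (mkseq z.2 i.+1) => //; rewrite nth_mkseq// zn eqxx.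
  by split => // j ji; rewrite nth_mkseq.
by case: eqP => // <- [_ /(_ i (ltnSn _))].
Qed.

(** [z.2 1] is the length of the first cycle. The paths handed to [h] run on beyond the end of that
    cycle, so consecutive cycle sums need not be independent. *)
Definition cycle_sum (R : realType) (h : (nat -> T) -> R)
    (z : (nat -> T) * (nat -> nat)) : R :=
  \sum_(i < z.2 1%N) h (fun t => z.1 (i + t)%N).

Lemma measurable_cycle_sum (R : realType) (h : (nat -> T) -> R) :
  measurable_fun setT (h : seqspace T -> R) ->
  measurable_fun setT (cycle_sum h : joint_paths -> R).
Proof.
move=> mh.
apply: (measurable_fun_nat_index (tau := fun z : joint_paths => z.2 1%N)
  (g := fun n (z : joint_paths) => \sum_(i < n) h (fun t => z.1 (i + t)%N))).
  exact: measurable_joint_coord2.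
move=> n; apply: measurable_sum => i.
apply: (measurableT_comp mh).
by apply: measurable_fun_seq => t; exact: measurable_joint_coord1.
Qed.

End joint_paths.

Section cycles.
Context d (Omega : measurableType d) (R : realType) (P : probability Omega R).
Context d' (T : measurableType d').
Variables (Z : nat -> Omega -> T) (S : nat -> Omega -> nat).
Hypothesis reg : regenerative P Z S.

Let mZ t : measurable_fun setT (Z t).
Proof. by case: reg => -[]. Qed.

Let mS k : measurable_fun setT (S k).
Proof. by case: reg => -[]. Qed.

Definition renewal_path k (w : Omega) : (nat -> T) * (nat -> nat) :=
  (fun i => Z (S k w + i)%N w, fun i => (S (k + i)%N w - S k w)%N).

Lemma renewal_path_preimage k n B u :
  renewal_path k @^-1` joint_cylinder n B u = shifted_event Z S k n B u.
Proof. by []. Qed.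

Let mSn k n : measurable [set w | S k w = n].
Proof.
rewrite -[X in measurable X]setTI.
exact: (mS k measurableT (Y := [set n])).
Qed.

Lemma measurable_process_at_renewal k i :
  measurable_fun setT (fun w => Z (S k w + i)%N w).
Proof. exact: (measurable_fun_nat_index (g := fun n w => Z (n + i)%N w)). Qed.

Lemma measurable_renewal_increment k i :
  measurable_fun setT (fun w => (S (k + i)%N w - S k w)%N).
Proof.
apply: (measurable_fun_nat_index (g := fun n w => (S (k + i)%N w - n)%N)) => // n.
by apply: (measurableT_comp (f := fun m => (m - n)%N)) => //; exact: mS.
Qed.

Lemma measurable_renewal_path k :
  measurable_fun setT (renewal_path k : Omega -> joint_paths T).
Proof.
apply: (@measurability _ _ Omega (g_sigma_algebraType (@joint_cylinders _ T))
  setT (renewal_path k) (@joint_cylinders _ T)) => //.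
move=> _ [_ [->|[n [B [u [mB ->]]]]] <-]; first by rewrite preimage_set0 setI0.
rewrite setTI renewal_path_preimage; apply: measurableI.
  rewrite (_ : shifted_process_event _ _ _ _ _ =
    \bigcap_(i in [set i | (i < n)%N]) ((fun w => Z (S k w + i)%N w) @^-1` B i)).
    apply: bigcap_measurableType => i _.
    by rewrite -[X in measurable X]setTI; exact: measurable_process_at_renewal.
  by apply/seteqP; split.
rewrite (_ : [set _ | _] =
  \bigcap_(i in [set i | (i < n)%N])
    ((fun w => (S (k + i)%N w - S k w)%N) @^-1` [set u i])).
  apply: bigcap_measurableType => i _.
  by rewrite -[X in measurable X]setTI; exact: measurable_renewal_increment.
by apply/seteqP; split.
Qed.

Lemma renewal_path_law k (A : set (joint_paths T)) : measurable A ->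
  P (renewal_path k @^-1` A) = P (renewal_path 0 @^-1` A).
Proof.
move=> mA.
apply: (eq_law_of_pi_system (G := @joint_cylinders _ T)) => //.
- exact: joint_cylinders_setI.
- exact: joint_cylinders_setT.
- move=> B GB; rewrite -[X in measurable X]setTI.
  by apply: measurable_renewal_path => //; exact: sub_sigma_algebra.
- move=> B GB; rewrite -[X in measurable X]setTI.
  by apply: measurable_renewal_path => //; exact: sub_sigma_algebra.
- move=> _ [->|[n [B [u [mB ->]]]]]; first by rewrite !preimage_set0 !measure0.
  by rewrite !renewal_path_preimage; case: reg => _ _ _; exact.
Qed.

Definition past_system k : set (set Omega) :=
  [set E | E = set0 \/ exists s A, (forall i, measurable (A i)) /\
    E = past_event Z S k s A].

Lemma past_system_setI k : setI_closed (past_system k).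
Proof.
move=> A1 A2 [->|[s [A [mA ->]]]]; first by rewrite set0I; left.
move=> [->|[s' [A' [mA' ->]]]]; first by rewrite setI0; left.
have [ss|ss] := pselect (forall i, (i <= k)%N -> s i = s' i).
  right; exists s, (fun t => A t `&` A' t); split.
    by move=> i; exact: measurableI.
  apply/seteqP; split => [w [[sw Aw] [s'w A'w]]|w [sw AA]].
    by split => // t ts; split; [exact: Aw|apply: A'w; rewrite -ss].
  split; split => //.
  - by move=> t ts; case: (AA t ts).
  - by move=> i ik; rewrite -ss// sw.
  - by move=> t; rewrite -ss// => ts; case: (AA t ts).
left; apply/seteqP; split => // w [[sw _] [s'w _]]; apply: ss => i ik.
by rewrite -sw// -s'w.
Qed.

Lemma past_system_measurable k E : past_system k E -> measurable E.
Proof.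
move=> [->//|[s [A [mA ->]]]].
rewrite (_ : past_event _ _ _ _ _ =
  (\bigcap_(i in [set i | (i <= k)%N]) [set w | S i w = s i]) `&`
  (\bigcap_(t in [set t | (t < s k)%N]) (Z t @^-1` A t))).
  apply: measurableI; apply: bigcap_measurableType => i _ //.
  by rewrite -[X in measurable X]setTI; exact: mZ.
by apply/seteqP; split.
Qed.

(** The Dynkin argument is run twice: for a fixed future cylinder over the past events, then for a
    fixed past event over the future ones. *)
Lemma past_independent_of_renewal_path k E (F : set (joint_paths T)) :
  <<s past_system k >> E -> measurable F ->
  measurable E /\
  P (E `&` renewal_path k @^-1` F) = (P E * P (renewal_path k @^-1` F))%E.
Proof.
move=> sE mF.
have mpre (C : set (joint_paths T)) : measurable C -> measurable (renewal_path k @^-1` C).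
  by move=> mC; rewrite -[X in measurable X]setTI; exact: measurable_renewal_path.
have H C : @joint_cylinders _ T C -> measurable E /\
    P (E `&` renewal_path k @^-1` C) = (P E * P (renewal_path k @^-1` C))%E.
  move=> jC; apply: (independent_sigma_of_pi_system (G := past_system k)) => //.
  - exact: past_system_setI.
  - exact: past_system_measurable.
  - by apply: mpre; exact: sub_sigma_algebra.
  - move=> _ [->|[s [A [mA ->]]]]; first by rewrite set0I !measure0 mul0e.
    case: jC => [->|[n [B [u [mB ->]]]]].
      by rewrite preimage_set0 setI0 !measure0 mule0.
    by rewrite renewal_path_preimage; case: reg => _ _ + _; exact.
have mE : measurable E by case: (H setT (@joint_cylinders_setT _ T)).
split => //.
rewrite setIC muleC.
pose G := preimage_set_system setT (renewal_path k) (@joint_cylinders _ T).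
suff [] : measurable (renewal_path k @^-1` F) /\
    P (renewal_path k @^-1` F `&` E) = (P (renewal_path k @^-1` F) * P E)%E by [].
apply: (independent_sigma_of_pi_system (G := G)) => //.
- move=> _ _ [A jA <-] [B jB <-]; rewrite !setTI.
  exists (A `&` B); first exact: joint_cylinders_setI.
  by rewrite setTI preimage_setI.
- by move=> _ [A jA <-]; rewrite setTI; apply: mpre; exact: sub_sigma_algebra.
- move=> _ [A jA <-]; rewrite setTI setIC [RHS]muleC.
  by have [] := H _ jA.
- rewrite /G g_sigma_preimageE; exists F; first exact: mF.
  by rewrite setTI.
Qed.

(** [Z t] itself is not determined by the past of [S k]; replacing it by a constant from time [S k]
    on makes it measurable with respect to [past k]. *)
Let stopped k (w : Omega) t : T := if (t < S k w)%N then Z t w else point.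

Let past k := g_sigma_algebraType (past_system k).

Let measurable_past_event k s A : (forall i, measurable (A i)) ->
  measurable (past_event Z S k s A : set (past k)).
Proof. by move=> mA; apply: sub_sigma_algebra; right; exists s, A. Qed.

Let past_event_mkseq k A w (t := S k w) :
  (forall i, (i < t)%N -> A i (Z i w)) ->
  past_event Z S k (nth 0%N (mkseq (S^~ w) k.+1)) A w.
Proof.
move=> Aw; split => [i ik|]; first by rewrite nth_mkseq.
by rewrite nth_mkseq// => i it; exact: Aw.
Qed.

Let measurable_past_renewal k i : (i <= k)%N ->
  measurable_fun setT (S i : past k -> nat).
Proof.
move=> ik; apply: measurable_fun_natP => n.
rewrite (_ : [set _ | _] = \bigcup_(s in @setT (seq nat))
  (if nth 0%N s i == n then past_event Z S k (nth 0%N s) (fun=> setT) else set0)).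
  apply: countable_bigcupT_measurable => // s; case: ifP => _ //.
  exact: measurable_past_event.
apply/seteqP; split => [w wn|w [s _]].
  exists (mkseq (S^~ w) k.+1) => //; rewrite nth_mkseq// wn eqxx.
  exact: past_event_mkseq.
by case: eqP => // <- [/(_ i ik)].
Qed.

Let measurable_stopped k t : measurable_fun setT (fun w : past k => stopped k w t).
Proof.
move=> _ A mA; rewrite setTI.
pose B j := if j == t then A else setT.
rewrite (_ : _ @^-1` A = \bigcup_(s in @setT (seq nat))
  (if (t < nth 0%N s k)%N then past_event Z S k (nth 0%N s) B else
   if point \in A then past_event Z S k (nth 0%N s) (fun=> setT) else set0)).
  apply: countable_bigcupT_measurable => // s; case: ifP => _.
    by apply: measurable_past_event => j; rewrite /B; case: ifP.
  by case: ifP => _ //; exact: measurable_past_event.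
apply/seteqP; split => [w|w [s _]].
  rewrite /= /stopped => h; exists (mkseq (S^~ w) k.+1) => //.
  rewrite nth_mkseq//; case: ifP h => h Aw.
    by apply: past_event_mkseq => i _; rewrite /B; case: eqP => // ->.
  by rewrite mem_set//; exact: past_event_mkseq.
case: ifP => h.
  move=> [sw /(_ t h)]; rewrite /B eqxx /= /stopped.
  by rewrite sw// h.
case: ifPn => // /set_mem Ap [sw _] /=; rewrite /stopped sw// h//.
Qed.

Section one_function.
Variables (h : (nat -> T) -> R) (K : nat).
Hypothesis mh : measurable_fun setT (h : seqspace T -> R).
Hypothesis h_ge0 : forall x, 0 <= h x.
Hypothesis hK : forall x y, (forall i, (i < K)%N -> x i = y i) -> h x = h y.

Definition cycle_rv k (w : Omega) : R := cycle_sum h (renewal_path k w).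

Lemma measurable_cycle_rv k : measurable_fun setT (cycle_rv k).
Proof.
exact: measurableT_comp (measurable_cycle_sum mh) (measurable_renewal_path k).
Qed.

Lemma renewal_growth (w : Omega) a b : (forall k, (S k w < S k.+1 w)%N) ->
  (S a w + b <= S (a + b) w)%N.
Proof.
move=> incr; elim: b => [|b IH]; first by rewrite !addn0.
by rewrite !addnS; apply: leq_ltn_trans IH _; exact: incr.
Qed.

(** A window opened in cycle [j] reads times below [S j.+1 + K]. Each renewal advances by at least
    one step, so these times precede [S (j.+1 + K)], hence [S k]; the cycle sum [k] depends only on
    what follows [S k]. *)
Lemma cycle_rv_independent j k : (j + K.+1 <= k)%N ->
  independent_rv P (cycle_rv j) (cycle_rv k).
Proof.
move=> jk A B mA mB.
(* The same cycle sum read on the stopped process. It is measurable with respect to the past, and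
   equals [cycle_rv j] only almost surely because [S] increases only almost surely. *)
pose xi' (w : Omega) := \sum_(i < (S j.+1 w - S j w)%N)
  h (fun t => stopped k w (S j w + (i + t))%N).
have jk' : (j <= k)%N by lia.
have jk1 : (j.+1 <= k)%N by lia.
have mxi' : measurable_fun setT (xi' : past k -> R).
  apply: (measurable_fun_nat_index (tau := S j : past k -> nat)
    (g := fun m (w : past k) => \sum_(i < (S j.+1 w - m)%N)
       h (fun t => stopped k w (m + (i + t))%N))).
    exact: measurable_past_renewal.
  move=> m; apply: (measurable_fun_nat_index
    (tau := (fun w => S j.+1 w - m)%N : past k -> nat)
    (g := fun n (w : past k) => \sum_(i < n)
       h (fun t => stopped k w (m + (i + t))%N))).
    apply: (measurableT_comp (f := fun n => (n - m)%N)) => //.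
    exact: measurable_past_renewal.
  move=> n; apply: measurable_sum => i; apply: (measurableT_comp mh).
  by apply: measurable_fun_seq => t; exact: measurable_stopped.
have eqxi : {ae P, forall w, cycle_rv j w = xi' w}.
  have [_ incr _ _] := reg; apply: filterS incr => w incr.
  rewrite /cycle_rv /cycle_sum /xi' /= addn1; apply: eq_bigr => i _.
  apply: hK => t tK; rewrite /stopped ifT//.
  have g1 := renewal_growth j.+1 K incr.
  have g2 := renewal_growth (j.+1 + K) (k - (j.+1 + K)) incr.
  have -> : k = (j.+1 + K + (k - (j.+1 + K)))%N by lia.
  have := ltn_ord i; lia.
have sE : <<s past_system k >> (xi' @^-1` A).
  have := mxi' measurableT A mA; rewrite setTI; exact.
have mF : measurable ((cycle_sum h : joint_paths T -> R) @^-1` B).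
  by rewrite -[X in measurable X]setTI; exact: measurable_cycle_sum.
have [mE PE] := past_independent_of_renewal_path sE mF.
have mAj : measurable (cycle_rv j @^-1` A).
  by rewrite -[X in measurable X]setTI; exact: measurable_cycle_rv.
have mBk : measurable (cycle_rv k @^-1` B).
  by rewrite -[X in measurable X]setTI; exact: measurable_cycle_rv.
rewrite (_ : P (cycle_rv j @^-1` A) = P (xi' @^-1` A)); last first.
  by apply: ae_eq_measure => //; apply: filterS eqxi => w /= ->.
rewrite -PE; apply: ae_eq_measure.
- exact: measurableI.
- exact: measurableI.
- by apply: filterS eqxi => w /= ->.
Qed.

Lemma cycle_rv_slln :
  (\int[P]_w (cycle_rv 0 w)%:E < +oo)%E ->
  {ae P, forall w, (fun n => (\sum_(i < n) cycle_rv i w) / n%:R) @ \oo -->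
    fine (\int[P]_w (cycle_rv 0 w)%:E)}.
Proof.
apply: (slln (K := K.+1)).
- exact: measurable_cycle_rv.
- by move=> i w; apply: sumr_ge0.
- move=> i A mA.
  apply: (renewal_path_law i (A := (cycle_sum h : joint_paths T -> R) @^-1` A)).
  by rewrite -[X in measurable X]setTI; exact: measurable_cycle_sum.
- exact: cycle_rv_independent.
Qed.

End one_function.
End cycles.

Section average_limits.
Context {R : realType}.

Lemma cvg_cst_div_nat (c : R) : (fun n => c / n%:R) @ \oo --> (0 : R).
Proof.
rewrite -(mulr0 c); apply: cvgMr.
apply/cvgrPdist_le => e e0; exists (Num.trunc e^-1).+1 => // n /= en.
rewrite sub0r normrN ger0_norm ?invr_ge0//.
have n0 : 0 < n%:R :> R by rewrite ltr0n (leq_trans _ en).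
rewrite invf_ple ?posrE//; apply: ltW.
have /andP[_] := truncn_itv (x := e^-1) ltac:(by rewrite invr_ge0 ltW).
by move=> /lt_le_trans; apply; rewrite ler_nat.
Qed.

Lemma cvg_average_shift (u : nat -> R) (c : R) s :
  (fun n => u n / n%:R) @ \oo --> c -> (fun n => u (s + n)%N / n%:R) @ \oo --> c.
Proof.
move=> uc.
have h1 : (fun n => u (s + n)%N / (s + n)%:R) @ \oo --> c.
  move: uc => /cvgrPdist_le uc; apply/cvgrPdist_le => e e0.
  have [N _ hN] := uc e e0; exists N => // n /= Nn; apply: hN => /=.
  exact: leq_trans Nn (leq_addl _ _).
have h2 : (fun n => (1 : R) + s%:R / n%:R) @ \oo --> (1 : R).
  rewrite -[X in _ --> X]addr0; apply: cvgD; first exact: cvg_cst.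
  exact: cvg_cst_div_nat.
have h3 : (fun n => u (s + n)%N / (s + n)%:R * (1 + s%:R / n%:R)) @ \oo --> c.
  by rewrite -[X in _ --> X]mulr1; exact: cvgM.
apply: (cvg_trans _ h3); apply: near_eq_cvg.
exists 1%N => // n /= n1.
have n0 : n%:R != 0 :> R by rewrite pnatr_eq0 -lt0n.
have sn0 : (s + n)%:R != 0 :> R by rewrite pnatr_eq0 -lt0n addn_gt0 n1 orbT.
rewrite natrD in sn0 *.
by field; rewrite n0.
Qed.

End average_limits.

Lemma big_ord_cat_nat (V : zmodType) (f : nat -> V) m n : (m <= n)%N ->
  \sum_(t < n) f t = \sum_(t < m) f t + \sum_(i < n - m) f (m + i)%N.
Proof.
move=> mn; have [k ->] : exists k, n = (m + k)%N by exists (n - m)%N; lia.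
by rewrite addKn big_split_ord.
Qed.

Section renewal_averages.
Context d (Omega : measurableType d) (R : realType) (P : probability Omega R).
Context d' (T : measurableType d').
Variables (Z : nat -> Omega -> T) (S : nat -> Omega -> nat).
Hypothesis reg : regenerative P Z S.
Hypothesis prec : positive_recurrent P S.

Let mZ t : measurable_fun setT (Z t).
Proof. by case: reg => -[]. Qed.

Let mS k : measurable_fun setT (S k).
Proof. by case: reg => -[]. Qed.

Definition process_path (w : Omega) t (i : nat) : T := Z (t + i)%N w.

Definition cycle_mean (h : (nat -> T) -> R) : R :=
  fine (\int[P]_w (cycle_rv Z S h 0 w)%:E).

Definition mean_cycle_length := cycle_mean (fun=> 1).

Lemma cycle_rv_cst1 k w : cycle_rv Z S (fun=> 1 : R) k w = (S k.+1 w - S k w)%:R.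
Proof.
by rewrite /cycle_rv /cycle_sum/= addn1 sumr_const card_ord.
Qed.

Lemma measurable_fun1 : measurable_fun setT ((fun=> 1) : seqspace T -> R).
Proof. exact: measurable_cst. Qed.

Lemma cycle_length_integrable : (\int[P]_w (cycle_rv Z S (fun=> 1 : R) 0 w)%:E < +oo)%E.
Proof.
by under eq_integral do rewrite cycle_rv_cst1.
Qed.

Lemma mean_cycle_length_ge1 : 1 <= mean_cycle_length.
Proof.
have mc := measurable_cycle_rv reg measurable_fun1 0.
have [_ incr _ _] := reg.
have fin : (\int[P]_w (cycle_rv Z S (fun=> 1 : R) 0 w)%:E)%E \is a fin_num.
  rewrite ge0_fin_numE ?cycle_length_integrable//.
  by apply: integral_ge0 => w _; rewrite lee_fin cycle_rv_cst1.
rewrite -lee_fin /mean_cycle_length /cycle_mean fineK//.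
rewrite -[leLHS](_ : (\int[P]_w (cst 1%:E w) = 1)%E); last first.
  by rewrite integral_cst// mul1e; exact: probability_setT.
apply: ae_ge0_le_integral => //.
- by move=> w _; rewrite lee_fin cycle_rv_cst1.
- exact/measurable_EFinP.
apply: filterS incr => w incr _.
by rewrite lee_fin cycle_rv_cst1 ler1n subn_gt0.
Qed.

Lemma sum_to_renewal (h : (nat -> T) -> R) w J : (forall k, (S k w < S k.+1 w)%N) ->
  \sum_(t < S J w) h (process_path w t) =
  \sum_(t < S 0 w) h (process_path w t) + \sum_(j < J) cycle_rv Z S h j w.
Proof.
move=> incr; elim: J => [|J IH]; first by rewrite big_ord0 addr0.
rewrite big_ord_recr/= addrA -IH.
rewrite (big_ord_cat_nat (fun t => h (process_path w t)) (ltnW (incr J))).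
congr (_ + _).
rewrite /cycle_rv /cycle_sum/= addn1; apply: eq_bigr => i _.
by congr h; apply/funext => t; rewrite /process_path addnA.
Qed.

Section window.
Variables (h : (nat -> T) -> R) (K : nat).
Hypothesis mh : measurable_fun setT (h : seqspace T -> R).
Hypothesis h_ge0 : forall x, 0 <= h x.
Hypothesis hK : forall x y, (forall i, (i < K)%N -> x i = y i) -> h x = h y.
Hypothesis hint : (\int[P]_w (cycle_rv Z S h 0 w)%:E < +oo)%E.

(** Up to the part before [S 0], the sum to time [S J] consists of [J] cycle sums; dividing the
    strong law for [h] by the one for the cycle lengths gives the limit along renewal times. The
    ratio of consecutive renewal times tends to 1, so interpolation fills the gaps. *)
Lemma renewal_average : {ae P, forall w,
  (fun n => (\sum_(t < n) h (process_path w t)) / n%:R) @ \oo -->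
  cycle_mean h / mean_cycle_length}.
Proof.
have A1 := cycle_rv_slln reg mh h_ge0 hK hint.
have A2 := cycle_rv_slln reg (K := 0) measurable_fun1 (fun=> ler01)
  (fun _ _ _ => erefl) cycle_length_integrable.
have [_ incr _ _] := reg.
have t1 := mean_cycle_length_ge1.
apply: filterS3 A1 A2 incr => w; rewrite -/(cycle_mean h).
rewrite -/(cycle_mean (fun=> 1)) -/mean_cycle_length => h1 h2 incr.
set tau := mean_cycle_length in t1 h2 *.
have t0 : 0 < tau by exact: lt_le_trans t1.
have Sn : {homo S^~ w : i j / (i <= j)%N}.
  move=> i j ij; rewrite -(subnKC ij).
  exact: leq_trans (leq_addr _ _) (renewal_growth _ _ incr).
pose a n := \sum_(t < n) h (process_path w t).
have aS : (fun J => a (S J w) / J%:R) @ \oo --> cycle_mean h.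
  have h3 : (fun J => a (S 0 w) / J%:R + (\sum_(j < J) cycle_rv Z S h j w) / J%:R)
      @ \oo --> cycle_mean h.
    by rewrite -[X in _ --> X]add0r; apply: cvgD => //; exact: cvg_cst_div_nat.
  apply: (cvg_trans _ h3); apply: near_eq_cvg; apply: nearW => J /=.
  by rewrite -mulrDl /a (sum_to_renewal h J incr).
have SJ : (fun J => (S J w)%:R / J%:R) @ \oo --> tau.
  have h3 : (fun J => (S 0 w)%:R / J%:R +
      (\sum_(j < J) cycle_rv Z S (fun=> 1) j w) / J%:R) @ \oo --> tau.
    by rewrite -[X in _ --> X]add0r; apply: cvgD => //; exact: cvg_cst_div_nat.
  apply: (cvg_trans _ h3); apply: near_eq_cvg; apply: nearW => J /=.
  rewrite -mulrDl; congr (_ / _).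
  have := sum_to_renewal (fun=> 1) J incr.
  by rewrite !sumr_const !card_ord => ->.
apply: (cvg_average_interpolation (a := a)).
- move=> i j ij; rewrite /a -(subnKC ij) big_split_ord/= lerDl.
  by rewrite sumr_ge0.
- by move=> i; rewrite sumr_ge0.
move=> rho rho1; exists (S^~ w); split => //.
- move=> m; exists m.+1.
  by have := renewal_growth 0 m.+1 incr; rewrite add0n; lia.
(* Chosen so that [(1 + dl) ^+ 2 <= 1 + 3 * dl = rho * (1 - dl)]: [S n.+1] and [S n] are within
   relative error [dl] of their linear growth, and one more [dl] absorbs the step from [n] to
   [n.+1]. *)
- pose dl := (rho - 1) / (rho + 3).
  have dl0 : 0 < dl by rewrite divr_gt0//; lra.
  have dlE : dl * (rho + 3) = rho - 1 by rewrite /dl mulfVK//; lra.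
  have dl1 : dl < 1 by rewrite /dl ltr_pdivrMr; lra.
  have td0 : 0 < tau * dl by rewrite mulr_gt0.
  move/cvgrPdist_le : SJ => /(_ _ td0)[N1 _ HN1].
  exists (maxn N1 (Num.trunc dl^-1).+1) => // n /=; rewrite geq_max => /andP[n1 n2].
  have := HN1 _ n1; have := HN1 _ (leqW n1) => /=.
  have n0 : 0 < n%:R :> R by rewrite ltr0n; lia.
  have dn : 1 <= dl * n%:R.
    rewrite mulrC -ler_pdivrMr// mul1r.
    have /andP[_ /ltW] := truncn_itv (x := dl^-1) ltac:(by rewrite invr_ge0 ltW).
    by move=> /le_trans; apply; rewrite ler_nat.
  rewrite !ler_distlC => /andP[_ hu] /andP[hl _].
  rewrite ler_pdivrMr// -[n.+1%:R]natr1 in hu; rewrite ler_pdivlMr// in hl.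
  apply: (le_trans hu).
  apply: (@le_trans _ _ (rho * ((tau - tau * dl) * n%:R))); last first.
    by rewrite ler_wpM2l//; lra.
  apply: (@le_trans _ _ ((tau + tau * dl) * ((1 + dl) * n%:R))).
    by rewrite ler_wpM2l//; [rewrite addr_ge0// ltW|lra].
  have -> : (tau + tau * dl) * ((1 + dl) * n%:R) =
    (tau * n%:R) * ((1 + dl) * (1 + dl)) by ring.
  have -> : rho * ((tau - tau * dl) * n%:R) = (tau * n%:R) * (rho * (1 - dl)) by ring.
  rewrite ler_pM2l ?mulr_gt0//; nra.
- have tn0 : tau != 0 by rewrite gt_eqF.
  have h3 : (fun J => (a (S J w) / J%:R) * ((S J w)%:R / J%:R)^-1) @ \oo -->
      cycle_mean h / tau by apply: cvgM => //; exact: cvgV.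
  apply: (cvg_trans _ h3); apply: near_eq_cvg; exists 1%N => // J /= J1.
  have J0 : J%:R != 0 :> R by rewrite pnatr_eq0 -lt0n.
  have SJ0 : (S J w)%:R != 0 :> R.
    rewrite pnatr_eq0 -lt0n; have := renewal_growth 0 J incr.
    by rewrite add0n; lia.
  by field; rewrite J0 SJ0.
Qed.

End window.

Lemma bounded_cycle_integrable (h : (nat -> T) -> R) (B : R) :
  measurable_fun setT (h : seqspace T -> R) -> (forall x, 0 <= h x <= B) ->
  (\int[P]_w (cycle_rv Z S h 0 w)%:E < +oo)%E.
Proof.
move=> mh hB.
have B0 : 0 <= B by have /andP[/le_trans] := hB point; apply.
apply: (@le_lt_trans _ _ (\int[P]_w (B%:E * (cycle_rv Z S (fun=> 1 : R) 0 w)%:E))%E).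
  apply: ge0_le_integral => //.
  - move=> w _; rewrite lee_fin; apply: sumr_ge0 => i _.
    by case/andP: (hB (fun t => (renewal_path Z S 0 w).1 (i + t)%N)).
  - by apply/measurable_EFinP; exact: (measurable_cycle_rv reg mh).
  - apply: measurable_funeM; apply/measurable_EFinP.
    exact: (measurable_cycle_rv reg measurable_fun1).
  - move=> w _; rewrite -EFinM lee_fin /cycle_rv /cycle_sum mulr_sumr.
    apply: ler_sum => i _; rewrite mulr1.
    by case/andP: (hB (fun t => (renewal_path Z S 0 w).1 (i + t)%N)).
rewrite ge0_integralZl_EFin//.
- by rewrite lte_mul_pinfty// cycle_length_integrable.
- by move=> w _; rewrite lee_fin cycle_rv_cst1.
- by apply/measurable_EFinP; exact: (measurable_cycle_rv reg measurable_fun1).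
Qed.

End renewal_averages.

Section bounded_convergence.
Context d (Omega : measurableType d) (R : realType) (P : probability Omega R).

Lemma bounded_convergence (A : nat -> Omega -> R) (c B : R) :
  (forall n, measurable_fun setT (A n)) -> (forall n w, `|A n w| <= B) ->
  {ae P, forall w, (fun n => A n w) @ \oo --> c} ->
  (fun n => Rintegral P setT (A n)) @ \oo --> c.
Proof.
move=> mA AB Ac.
have iB : P.-integrable setT (EFin \o (fun=> B)).
  by apply: bounded_rv_integrable; exact: bounded_rv_cst.
have [_ _] := @dominated_convergence _ _ _ P setT measurableT
  (fun n w => (A n w)%:E) (EFin \o (fun=> c)) (EFin \o (fun=> B))
  ltac:(move=> n; exact/measurable_EFinP) ltac:(exact/measurable_EFinP)
  ltac:(apply: filterS Ac => w Ac _; apply: cvg_EFin => //; exact: nearW)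
  iB ltac:(apply: aeW => w n _ /=; rewrite lee_fin; exact: AB).
have -> : (\int[P]_(x in setT) (EFin \o (fun=> c)) x = c%:E)%E.
  by rewrite integral_cst// [X in (_ * X)%E](probability_setT P) mule1.
by move=> /fine_cvgP[_].
Qed.

End bounded_convergence.

(** * Cycle means as stationary expectations *)

Section identification.
Context d (Omega : measurableType d) (R : realType) (P : probability Omega R).
Context d1 (Omega1 : measurableType d1) (P1 : probability Omega1 R).
Context d' (T : measurableType d').
Variables (Z : nat -> Omega -> T) (S : nat -> Omega -> nat).
Variables (Zs : nat -> Omega1 -> T) (Ss : nat -> Omega1 -> nat).
Hypothesis reg : regenerative P Z S.
Hypothesis prec : positive_recurrent P S.
Hypothesis stat : stationary_version P P1 Z S Zs Ss.

Let regs : regenerative P1 Zs Ss. Proof. by case: stat. Qed.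

Let mZs t : measurable_fun setT (Zs t).
Proof. by case: regs => -[]. Qed.

Let mSs k : measurable_fun setT (Ss k).
Proof. by case: regs => -[]. Qed.

Let x (w : Omega) i := Z (S 0 w + i)%N w.
Let x1 (w : Omega1) i := Zs (Ss 0 w + i)%N w.

Let mx : measurable_fun setT (x : Omega -> seqspace T).
Proof. by apply: measurable_fun_seq => i; exact: (measurable_process_at_renewal reg). Qed.

Let mx1 : measurable_fun setT (x1 : Omega1 -> seqspace T).
Proof.
by apply: measurable_fun_seq => i; exact: (measurable_process_at_renewal regs).
Qed.

Lemma measurable_process_path t :
  measurable_fun setT ((fun w => process_path Zs w t) : Omega1 -> seqspace T).
Proof. by apply: measurable_fun_seq => i; exact: (mZs (t + i)). Qed.

Lemma stationary_mean (f : (nat -> T) -> \bar R) t :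
  measurable_fun setT (f : seqspace T -> \bar R) -> (forall x, 0 <= f x)%E ->
  (\int[P1]_w f (process_path Zs w t) = \int[P1]_w f (process_path Zs w 0))%E.
Proof.
move=> mf f0; apply: (ge0_integral_eq_law (U := seqspace T)) => //.
- exact: measurable_process_path.
- exact: measurable_process_path.
move=> A mA.
apply: (eq_law_seq (f1 := fun w => process_path Zs w t)
  (f2 := fun w => process_path Zs w 0)) => //.
- by move=> i; exact: (mZs (t + i)).
by move=> n B mB; case: stat => _ st _; exact: (st t n B mB).
Qed.

Lemma post_renewal_mean (f : (nat -> T) -> \bar R) :
  measurable_fun setT (f : seqspace T -> \bar R) -> (forall x, 0 <= f x)%E ->
  (\int[P]_w f (x w) = \int[P1]_w f (x1 w))%E.
Proof.
move=> mf f0; apply: (ge0_integral_eq_law (U := seqspace T)) => //.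
move=> A mA; apply: (eq_law_seq (f1 := x) (f2 := x1)) => //.
- by move=> i; exact: (measurable_process_at_renewal reg).
- by move=> i; exact: (measurable_process_at_renewal regs).
by move=> n B mB; apply/esym; case: stat => _ _; exact.
Qed.

Section window.
Variables (h : (nat -> T) -> R) (K : nat).
Hypothesis mh : measurable_fun setT (h : seqspace T -> R).
Hypothesis hK : forall x y, (forall i, (i < K)%N -> x i = y i) -> h x = h y.

Section bounded.
Variable B : R.
Hypothesis hB : forall x, 0 <= h x <= B.

Let h0 y : 0 <= h y. Proof. by case/andP : (hB y). Qed.
Let hleB y : h y <= B. Proof. by case/andP : (hB y). Qed.
Let B0 : 0 <= B. Proof. exact: le_trans (h0 point) (hleB point). Qed.

Let avg n (y : nat -> T) : R := (\sum_(t < n) h (fun i => y (t + i)%N)) / n%:R.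

Let mavg n : measurable_fun setT (avg n : seqspace T -> R).
Proof.
apply: measurable_funM; last exact: measurable_cst.
apply: measurable_sum => t; apply: (measurableT_comp mh).
exact: measurable_shift.
Qed.

Let avg_ge0 n y : 0 <= avg n y.
Proof. by rewrite divr_ge0// sumr_ge0. Qed.

Let avg_le n y : avg n y <= B.
Proof.
case: n => [|n]; first by rewrite /avg big_ord0 mul0r.
rewrite /avg ler_pdivrMr// (le_trans (y := \sum_(t < n.+1) B))//.
  by apply: ler_sum => i _.
by rewrite sumr_const card_ord mulr_natr.
Qed.

Let bavg d2 (W : measurableType d2) (y : W -> nat -> T) n :
  measurable_fun setT (y : W -> seqspace T) ->
  bounded_rv (fun w => avg n (y w)).
Proof.
move=> my; split; first exact: measurableT_comp (mavg n) my.
by exists B => w; rewrite ger0_norm.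
Qed.

Let cvg_post_renewal : {ae P, forall w, (fun n => avg n (x w)) @ \oo -->
  cycle_mean P Z S h / mean_cycle_length P Z S}.
Proof.
have := renewal_average reg prec mh h0 hK (bounded_cycle_integrable reg prec mh hB).
apply: filterS => w /(cvg_average_shift (S 0 w)) c1.
pose a n := \sum_(t < n) h (process_path Z w t).
have h3 : (fun n => a (S 0 w + n)%N / n%:R + (- a (S 0 w)) / n%:R) @ \oo -->
    cycle_mean P Z S h / mean_cycle_length P Z S.
  rewrite -[X in _ --> X]addr0; apply: cvgD; first exact: c1.
  exact: cvg_cst_div_nat.
apply: (cvg_trans _ h3); apply: near_eq_cvg; apply: nearW => n /=.
rewrite -mulrDl; congr (_ / _).
rewrite /a (big_ord_cat_nat (fun t => h (process_path Z w t)) (leq_addr n (S 0 w))).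
rewrite addrAC subrr add0r addKn; apply: eq_bigr => t _; congr h.
by apply/funext => i; rewrite /x /process_path addnA.
Qed.

Let mean_avg n : Rintegral P1 setT (fun w => avg n.+1 (process_path Zs w 0)) =
  Rintegral P1 setT (fun w => h (process_path Zs w 0)).
Proof.
have b t : bounded_rv (fun w => h (process_path Zs w t)).
  split; first exact: measurableT_comp mh (measurable_process_path t).
  by exists B => w; rewrite ger0_norm.
transitivity (Rintegral P1 setT (fun w => n.+1%:R^-1 *
    \sum_(t < n.+1) h (process_path Zs w t))).
  by apply: eq_Rintegral => w _; rewrite mulrC.
rewrite Rintegral_boundedZ; last exact: bounded_rv_sum.
rewrite Rintegral_bounded_sum// (eq_bigr (fun=>
  Rintegral P1 setT (fun w => h (process_path Zs w 0)))); last first.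
  move=> t _; rewrite /Rintegral; congr fine.
  apply: (stationary_mean (f := fun y => (h y)%:E)).
    exact/measurable_EFinP.
  by move=> y; rewrite lee_fin.
by rewrite sumr_const card_ord -[X in _ * X]mulr_natl mulKf.
Qed.

(** Averages started at the first renewal have the same law for [Z] and [Zs], so their means under
    [P1] tend to the almost sure limit [c] found under [P]. Moving the start from [Ss 0] to 0
    changes the sum by at most [B * Ss 0], and from time 0 stationarity makes every mean equal to
    that of [h]. *)
Lemma bounded_renewal_mean :
  Rintegral P1 setT (fun w => h (process_path Zs w 0)) =
  cycle_mean P Z S h / mean_cycle_length P Z S.
Proof.
set c := _ / _.
have L1 : (fun n => Rintegral P setT (fun w => avg n (x w))) @ \oo --> c.
  apply: (bounded_convergence (B := B)) cvg_post_renewal.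
  - by move=> n; have [] := @bavg _ _ x n mx.
  - by move=> n w; rewrite ger0_norm.
have L2 : (fun n => Rintegral P1 setT (fun w => avg n (x1 w))) @ \oo --> c.
  rewrite [X in X @ \oo --> _](_ : _ =
    fun n => Rintegral P setT (fun w => avg n (x w)))//.
  apply/funext => n; rewrite /Rintegral; congr fine.
  apply/esym; apply: (post_renewal_mean (f := fun y => (avg n y)%:E)).
    exact/measurable_EFinP.
  by move=> y; rewrite lee_fin.
have L3 : (fun n => Rintegral P1 setT (fun w =>
    avg n (x1 w) + - 1 * avg n (process_path Zs w 0))) @ \oo --> (0 : R).
  apply: (bounded_convergence (B := B)).
  - move=> n.
    have [m1 _] := @bavg _ _ x1 n mx1.
    have [m2 _] := @bavg _ _ _ n (measurable_process_path 0).
    apply: measurable_funD => //.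
    by apply: measurable_funM => //; exact: measurable_cst.
  - move=> n w; rewrite mulN1r ler_norml.
    have := avg_ge0 n (x1 w); have := avg_le n (x1 w).
    have := avg_ge0 n (process_path Zs w 0); have := avg_le n (process_path Zs w 0).
    by move=> *; apply/andP; split; lra.
  (* With [s = Ss 0 w], the two sums of [n] terms differ by the [s] terms gained at the end minus
     the [s] terms lost at the beginning. *)
  apply: aeW => w; apply/cvgrPdist_le => e e0.
  have := cvg_cst_div_nat (B * (Ss 0 w)%:R) => /cvgrPdist_le/(_ e e0)[N _ hN].
  exists N => // n /= /hN /=.
  rewrite sub0r normrN ger0_norm ?divr_ge0 ?mulr_ge0//; apply: le_trans.
  rewrite sub0r normrN mulN1r /avg -mulrBl normrM [X in _ * X]ger0_norm ?invr_ge0//.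
  rewrite ler_wpM2r ?invr_ge0//.
  set s := Ss 0 w.
  pose a n := \sum_(t < n) h (process_path Zs w t).
  have aB m : 0 <= a m <= B * m%:R.
    rewrite sumr_ge0//= mulr_natr; apply: (@le_trans _ _ (\sum_(t < m) B)).
      exact: ler_sum.
    by rewrite sumr_const card_ord.
  have aD : a (s + n)%N = a s + \sum_(t < n) h (fun i => x1 w (t + i)%N).
    rewrite /a (big_ord_cat_nat (fun t => h (process_path Zs w t)) (leq_addr n s)).
    rewrite addKn; congr (_ + _); apply: eq_bigr => t _; congr h.
    by apply/funext => i; rewrite /x1 /process_path addnA.
  have aD' : a (s + n)%N = a n + \sum_(t < s) h (process_path Zs w (n + t)).
    by rewrite addnC /a (big_ord_cat_nat (fun t => h (process_path Zs w t))
      (leq_addr s n)) addKn.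
  have s0 : 0 <= \sum_(t < s) h (process_path Zs w (n + t)) <= B * s%:R.
    rewrite sumr_ge0//= mulr_natr; apply: (@le_trans _ _ (\sum_(t < s) B)).
      exact: ler_sum.
    by rewrite sumr_const card_ord.
  have E : \sum_(t < n) h (fun i => x1 w (t + i)%N) -
      \sum_(t < n) h (fun i => process_path Zs w 0 (t + i)%N) =
      \sum_(t < s) h (process_path Zs w (n + t)) - a s.
    have -> : \sum_(t < n) h (fun i => process_path Zs w 0 (t + i)%N) = a n by [].
    have -> : \sum_(t < n) h (fun i => x1 w (t + i)%N) = a (s + n)%N - a s.
      by rewrite aD addrC addKr.
    by rewrite aD'; ring.
  rewrite E; have /andP[a1 a2] := aB s; have /andP[s1 s2] := s0.
  by rewrite ler_norml; apply/andP; split; lra.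
have L4 : (fun n => Rintegral P1 setT (fun w => avg n (x1 w)) -
    Rintegral P1 setT (fun w => avg n (process_path Zs w 0))) @ \oo --> (0 : R).
  apply: (cvg_trans _ L3); apply: near_eq_cvg; apply: nearW => n.
  have b1 := @bavg _ _ x1 n mx1.
  have b2 := @bavg _ _ _ n (measurable_process_path 0).
  rewrite Rintegral_boundedD//; last first.
    by apply: bounded_rvM => //; exact: bounded_rv_cst.
  by rewrite Rintegral_boundedZ// mulN1r.
have L5 : (fun n => Rintegral P1 setT (fun w => avg n (process_path Zs w 0)))
    @ \oo --> c.
  have L : (fun n => Rintegral P1 setT (fun w => avg n (x1 w)) -
      (Rintegral P1 setT (fun w => avg n (x1 w)) -
       Rintegral P1 setT (fun w => avg n (process_path Zs w 0)))) @ \oo --> c.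
    by rewrite -[X in _ --> X]subr0; exact: cvgB.
  apply: (cvg_trans _ L); apply: near_eq_cvg; apply: nearW => n /=.
  by rewrite opprB addrCA subrr addr0.
have L6 : (fun n : nat => Rintegral P1 setT (fun w => h (process_path Zs w 0)))
    @ \oo --> c.
  apply: (cvg_trans _ L5); apply: near_eq_cvg; exists 1%N => // -[//|n] _ /=.
  exact: mean_avg.
by apply: cvg_unique L6 => //; exact: cvg_cst.
Qed.

End bounded.
End window.
End identification.

Section eventually_constant.
Context d (W : measurableType d) (R : realType) (Q : {measure set W -> \bar R}).

Lemma cvg_integral_eventually_constant (g : nat -> W -> R) (f : W -> R) :
  (forall n, measurable_fun setT (g n)) -> (forall n w, 0 <= g n w) ->
  (forall w, {homo g^~ w : n m / (n <= m)%N >-> n <= m}) ->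
  (forall w, \forall n \near \oo, g n w = f w) ->
  ((fun n => \int[Q]_w (g n w)%:E) @ \oo --> \int[Q]_w (f w)%:E)%E.
Proof.
move=> mg g0 ndg gf.
have := @cvg_monotone_convergence _ W R Q setT measurableT (fun n w => (g n w)%:E)
  ltac:(by move=> n; exact/measurable_EFinP)
  ltac:(by move=> n w _; rewrite lee_fin)
  ltac:(by move=> w _ n m nm; rewrite lee_fin; exact: ndg).
rewrite (_ : (\int[Q]_w limn (fun n => (g n w)%:E) = \int[Q]_w (f w)%:E)%E)//.
apply: eq_integral => w _; apply/cvg_lim => //; apply: cvg_near_cst.
by apply: filterS (gf w) => n ->.
Qed.

End eventually_constant.

Section regenerative_slln.
Context d (Omega : measurableType d) (R : realType) (P : probability Omega R).
Context d1 (Omega1 : measurableType d1) (P1 : probability Omega1 R).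
Context d' (T : measurableType d').
Variables (Z : nat -> Omega -> T) (S : nat -> Omega -> nat).
Variables (Zs : nat -> Omega1 -> T) (Ss : nat -> Omega1 -> nat).
Hypothesis reg : regenerative P Z S.
Hypothesis prec : positive_recurrent P S.
Hypothesis stat : stationary_version P P1 Z S Zs Ss.
Variables (h : (nat -> T) -> R) (K : nat).
Hypothesis mh : measurable_fun setT (h : seqspace T -> R).
Hypothesis h0 : forall x, 0 <= h x.
Hypothesis hK : forall x y, (forall i, (i < K)%N -> x i = y i) -> h x = h y.

Let regs : regenerative P1 Zs Ss. Proof. by case: stat. Qed.

Let tr (M : nat) (y : nat -> T) : R := Num.min (h y) M%:R.

Let mtr M : measurable_fun setT (tr M : seqspace T -> R).
Proof. by apply: measurable_minr => //; exact: measurable_cst. Qed.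

Let tr_bound M y : 0 <= tr M y <= M%:R.
Proof. by rewrite /tr le_min h0 ler0n ge_min lexx orbT. Qed.

Let trK M x y : (forall i, (i < K)%N -> x i = y i) -> tr M x = tr M y.
Proof. by rewrite /tr => /hK ->. Qed.

Let ndtr y : {homo tr^~ y : n m / (n <= m)%N >-> n <= m}.
Proof.
move=> n m nm; rewrite /tr le_min ge_min lexx/= ge_min.
by rewrite ler_nat nm orbT.
Qed.

Let tr_id M (y : nat -> T) : h y <= M%:R -> tr M y = h y.
Proof. by move=> hM; rewrite /tr min_l. Qed.

Let nat_above (c : R) : exists M : nat, c <= M%:R.
Proof.
exists (Num.trunc `|c|).+1.
have /andP[_ /ltW] := truncn_itv (x := `|c|) (normr_ge0 _).
exact: le_trans (ler_norm _).
Qed.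

(** Both sides are monotone limits of their truncations, for which the bounded case applies. The
    identity holds in the extended reals, so a finite stationary mean makes the cycle sum
    integrable, which is what the strong law asks for. *)
Lemma renewal_mean :
  (\int[P]_w (cycle_rv Z S h 0 w)%:E =
   (mean_cycle_length P Z S)%:E * \int[P1]_w (h (process_path Zs w 0))%:E)%E.
Proof.
have L1 : ((fun M => \int[P]_w (cycle_rv Z S (tr M) 0 w)%:E) @ \oo -->
    \int[P]_w (cycle_rv Z S h 0 w)%:E)%E.
  apply: cvg_integral_eventually_constant.
  - by move=> M; exact: (measurable_cycle_rv reg (mtr M)).
  - move=> M w; apply: sumr_ge0 => i _.
    by case/andP : (tr_bound M (fun t => (renewal_path Z S 0 w).1 (i + t)%N)).
  - by move=> w n m nm; apply: ler_sum => i _; exact: ndtr.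
  move=> w; have [M HM] := nat_above (cycle_rv Z S h 0 w).
  exists M => // m /= Mm; apply: eq_bigr => i _; apply: tr_id.
  apply: (le_trans (y := cycle_rv Z S h 0 w)); last first.
    by apply: (le_trans HM); rewrite ler_nat.
  by rewrite /cycle_rv /cycle_sum (bigD1 i)//= lerDl sumr_ge0.
have L2 : ((fun M => \int[P1]_w (tr M (process_path Zs w 0))%:E) @ \oo -->
    \int[P1]_w (h (process_path Zs w 0))%:E)%E.
  apply: cvg_integral_eventually_constant.
  - by move=> M; exact: (measurableT_comp (mtr M) (measurable_process_path stat 0)).
  - by move=> M w; case/andP : (tr_bound M (process_path Zs w 0)).
  - by move=> w n m nm; exact: ndtr.
  move=> w; have [M HM] := nat_above (h (process_path Zs w 0)).
  exists M => // m /= Mm; apply: tr_id.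
  by apply: (le_trans HM); rewrite ler_nat.
have t1 := mean_cycle_length_ge1 reg prec.
have E M : (\int[P]_w (cycle_rv Z S (tr M) 0 w)%:E =
    (mean_cycle_length P Z S)%:E * \int[P1]_w (tr M (process_path Zs w 0))%:E)%E.
  have f1 : (\int[P]_w (cycle_rv Z S (tr M) 0 w)%:E \is a fin_num)%E.
    rewrite ge0_fin_numE.
      exact: (bounded_cycle_integrable reg prec (mtr M) (tr_bound M)).
    apply: integral_ge0 => w _; rewrite lee_fin; apply: sumr_ge0 => i _.
    by case/andP : (tr_bound M (fun t => (renewal_path Z S 0 w).1 (i + t)%N)).
  have b : bounded_rv (fun w => tr M (process_path Zs w 0)).
    split.
      exact: (measurableT_comp (mtr M) (measurable_process_path stat 0)).
    exists M%:R => w; have /andP[c1 c2] := tr_bound M (process_path Zs w 0).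
    by rewrite ger0_norm.
  have f2 := integrable_fin_num measurableT (bounded_rv_integrable P1 b).
  rewrite -(fineK f1) -(fineK f2) -EFinM; congr EFin.
  have := bounded_renewal_mean reg prec stat (mtr M) (@trK M) (tr_bound M).
  rewrite /Rintegral => ->; rewrite mulrC divfK// gt_eqF//.
  exact: lt_le_trans t1.
have L3 : ((fun M => \int[P]_w (cycle_rv Z S (tr M) 0 w)%:E) @ \oo -->
    (mean_cycle_length P Z S)%:E * \int[P1]_w (h (process_path Zs w 0))%:E)%E.
  by under eq_fun do rewrite E; exact: cvgeZl.
exact: cvg_unique L1 L3.
Qed.

Theorem regenerative_slln :
  (\int[P1]_w (h (process_path Zs w 0))%:E < +oo)%E ->
  {ae P, forall w, (fun n => (\sum_(t < n) h (process_path Z w t)) / n%:R) @ \oo -->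
    Rintegral P1 setT (fun w => h (process_path Zs w 0))}.
Proof.
move=> hoo; have t1 := mean_cycle_length_ge1 reg prec.
have t0 : 0 < mean_cycle_length P Z S by exact: lt_le_trans t1.
have E := renewal_mean.
have hint : (\int[P]_w (cycle_rv Z S h 0 w)%:E < +oo)%E.
  by rewrite E lte_mul_pinfty// lee_fin ltW.
have := renewal_average reg prec mh h0 hK hint.
rewrite /cycle_mean E fineM//; last first.
  by rewrite ge0_fin_numE//; apply: integral_ge0 => w _; rewrite lee_fin.
by rewrite -/(Rintegral P1 setT (fun w => h (process_path Zs w 0))) /= mulrAC mulfV ?mul1r ?gt_eqF.
Qed.

End regenerative_slln.

(** Used to forget the decoded state: (X, Y) is regenerative for the same renewal times as (X, Y,
    V). *)
Lemma regenerative_map d (Omega : measurableType d) (R : realType)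
    (P : probability Omega R) d1 d2 (T1 : measurableType d1)
    (T2 : measurableType d2) (Z : nat -> Omega -> T1) (S : nat -> Omega -> nat)
    (g : T1 -> T2) :
  measurable_fun setT g -> regenerative P Z S ->
  regenerative P (fun t w => g (Z t w)) S.
Proof.
move=> mg [[mZ mS] incr ind id].
have mgp (A : nat -> set T2) : (forall i, measurable (A i)) ->
    forall i, measurable (g @^-1` A i).
  by move=> mA i; rewrite -[X in measurable X]setTI; exact: mg.
split => //.
- by split => // t; exact: measurableT_comp.
- by move=> k s A n B u /mgp mA /mgp mB; exact: ind mA mB.
- by move=> k n B u /mgp mB; exact: id mB.
Qed.

(** * Likelihoods of hidden Markov models *)

Section likelihoods.
Context {R : realType} {d : measure_display} {XX : measurableType d} {N : nat}.
Local Notation state := 'I_N.+1.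
Variables (p : 'M[R]_N.+1) (f : state -> XX -> R) (pi : state -> R).

(* [b = true] restarts the chain from [pi], whatever the previous state *)
Definition jump (b : bool) (i j : state) : R := if b then pi j else p i j.

Fixpoint path_weight (bs : seq bool) (i : state) (s : seq state) : R :=
  match bs, s with
  | b :: bs', j :: s' => jump b i j * path_weight bs' j s'
  | _, _ => 1
  end.

Definition emission (s : seq state) (x : nat -> XX) : R :=
  \prod_(t < size s) f (nth ord0 s t) (x t).

(** One recursion covers the likelihood of the whole sequence (a single restart, at the start) and
    the product of block likelihoods (a restart per block). The two can then be compared term by
    term. *)
Fixpoint mixlik (bs : seq bool) (i : state) (x : nat -> XX) : R :=
  if bs is b :: bs' then
    \sum_j jump b i j * f j (x 0%N) * mixlik bs' j (fun t => x t.+1)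
  else 1.

Definition block (k : nat) : seq bool :=
  if k is k'.+1 then true :: nseq k' false else [::].

Definition block_flags (sg : seq nat) : seq bool := flatten [seq block k | k <- sg].

(** [ord0] is a dummy previous state: a nonempty block begins with a restart. *)
Definition seglik (k : nat) (x : nat -> XX) : R := mixlik (block k) ord0 x.

Lemma size_block k : size (block k) = k.
Proof. by case: k => //= k; rewrite size_nseq. Qed.

Lemma size_block_flags sg : size (block_flags sg) = sumn sg.
Proof.
by elim: sg => //= k sg IH; rewrite size_cat size_block IH.
Qed.

Lemma emission_cons j s x :
  emission (j :: s) x = f j (x 0%N) * emission s (fun t => x t.+1).
Proof. by rewrite /emission big_ord_recl. Qed.

Lemma big_cons_tuple (V : nmodType) n (F : n.+1.-tuple state -> V) :
  \sum_s F s = \sum_j \sum_(s : n.-tuple state) F (cons_tuple j s).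
Proof.
rewrite pair_big/=.
rewrite (reindex (fun z : state * n.-tuple state => cons_tuple z.1 z.2))//=.
exists (fun s => (thead s, [tuple of behead s])) => [[j s] _|s _] /=.
  by congr pair; apply/val_inj.
by rewrite [RHS]tuple_eta; apply/val_inj.
Qed.

Lemma mixlikE n bs i x : size bs = n ->
  mixlik bs i x = \sum_(s : n.-tuple state) path_weight bs i s * emission s x.
Proof.
elim: bs n i x => [|b bs IH] [|n] i x //=.
  move=> _; rewrite (big_pred1 [tuple]); last first.
    by move=> s; rewrite [s]tuple0; apply/esym/eqP/val_inj.
  by rewrite /emission big_ord0 mulr1.
move=> [sn]; rewrite big_cons_tuple; apply: eq_bigr => j _.
rewrite (IH n)// mulr_sumr; apply: eq_bigr => s _ /=.
by rewrite emission_cons; ring.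
Qed.

Lemma mixlik_ext bs i x y : (forall t, (t < size bs)%N -> x t = y t) ->
  mixlik bs i x = mixlik bs i y.
Proof.
elim: bs i x y => //= b bs IH i x y xy; apply: eq_bigr => j _.
by rewrite xy// (IH j _ (fun t => y t.+1))// => t tb; rewrite xy.
Qed.

(** Whatever follows begins with a restart, so it does not depend on the state reached and factors
    out of the sum over states. *)
Lemma mixlik_cat_flags bs sg i x :
  mixlik (bs ++ block_flags sg) i x =
  mixlik bs i x * mixlik (block_flags sg) ord0 (fun t => x (size bs + t)%N).
Proof.
elim: bs i x => [|b bs IH] i x /=; last first.
  rewrite mulr_suml; apply: eq_bigr => j _.
  by rewrite IH mulrA.
rewrite mul1r; elim: sg => //= -[|k] sg IH //=.
Qed.

Lemma block_likelihood_cons k sg x :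
  mixlik (block_flags (k :: sg)) ord0 x =
  seglik k x * mixlik (block_flags sg) ord0 (fun t => x (k + t)%N).
Proof. by rewrite /block_flags/= mixlik_cat_flags size_block. Qed.

Lemma seglik0 x : seglik 0 x = 1.
Proof. by []. Qed.

Section nonneg.
Hypothesis p_ge0 : forall i j, 0 <= p i j.
Hypothesis pi_ge0 : forall j, 0 <= pi j.
Hypothesis f_ge0 : forall j x, 0 <= f j x.

Lemma jump_ge0 b i j : 0 <= jump b i j.
Proof. by rewrite /jump; case: b. Qed.

Lemma path_weight_ge0 bs i s : 0 <= path_weight bs i s.
Proof.
elim: bs i s => [|b bs IH] i [|j s] //=.
by rewrite mulr_ge0// jump_ge0.
Qed.

Lemma emission_ge0 s x : 0 <= emission s x.
Proof. by rewrite /emission prodr_ge0. Qed.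

Lemma mixlik_ge0 bs i x : 0 <= mixlik bs i x.
Proof.
elim: bs i x => //= b bs IH i x; rewrite sumr_ge0// => j _.
by rewrite !mulr_ge0// jump_ge0.
Qed.

Lemma path_le_mixlik bs i x (s : seq state) : size s = size bs ->
  path_weight bs i s * emission s x <= mixlik bs i x.
Proof.
move=> ss; rewrite (mixlikE _ _ (esym ss)).
rewrite (bigD1 (in_tuple s))//= lerDl sumr_ge0// => s' _.
by rewrite mulr_ge0 ?path_weight_ge0 ?emission_ge0.
Qed.

Variable C : R.
Hypothesis C_ge1 : 1 <= C.
Hypothesis pC : forall i j, p i j <= C * pi j.

(** Each restart replaces a factor [p i j] by [pi j], and [p i j <= C * pi j]. *)
Lemma mixlik_restart bs i x :
  mixlik (nseq (size bs) false) i x <= C ^+ count id bs * mixlik bs i x.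
Proof.
elim: bs i x => [|b bs IH] i x /=; first by rewrite expr0 mulr1.
rewrite mulr_sumr; apply: ler_sum => j _.
have C0 : 0 <= C by rewrite (le_trans ler01).
have h : p i j <= C ^+ b * jump b i j.
  by rewrite /jump; case: b; rewrite ?expr1 ?expr0 ?mul1r.
rewrite exprD [leRHS](_ : _ = (C ^+ b * jump b i j * f j (x 0%N)) *
  (C ^+ count id bs * mixlik bs j (fun t => x t.+1))); last by ring.
apply: ler_pM => //.
- by rewrite mulr_ge0.
- exact: mixlik_ge0.
- by rewrite ler_wpM2r.
Qed.

Lemma count_block k : (count id (block k) <= 1)%N.
Proof. by case: k => //= k; rewrite count_nseq. Qed.

Lemma count_block_flags sg : (count id (block_flags sg) <= size sg)%N.
Proof.
elim: sg => //= k sg IH; rewrite /block_flags/= count_cat -add1n leq_add//.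
exact: count_block.
Qed.

Lemma seglik_le_blocks sg x :
  seglik (sumn sg) x <= C ^+ size sg * mixlik (block_flags sg) ord0 x.
Proof.
have C0 : 0 <= C by rewrite (le_trans ler01).
have := size_block_flags sg; have := count_block_flags sg.
(* Blocks of length 0 carry no flag. Otherwise both likelihoods begin with a restart, so the first
   factor is common and only later restarts are paid for. *)
have : block_flags sg = [::] \/ exists bs, block_flags sg = true :: bs.
  elim: sg => [|[|k] sg IH]; [by left|exact: IH|right].
  by exists (nseq k false ++ block_flags sg).
case=> [->|[bs ->]] /=.
  by move=> _ <-; rewrite seglik0 mulr1 exprn_ege1.
move=> cnt <-; rewrite /seglik/=.
rewrite mulr_sumr; apply: ler_sum => j _.
rewrite mulrCA ler_wpM2l//; first by rewrite mulr_ge0.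
apply: le_trans (mixlik_restart _ _ _) _.
rewrite ler_wpM2r ?mixlik_ge0// ler_weXn2l//.
by apply: leq_trans cnt; rewrite leq_addl.
Qed.

Lemma block_likelihood_gt0 sg x :
  0 < seglik (sumn sg) x -> 0 < mixlik (block_flags sg) ord0 x.
Proof.
have C0 : 0 < C by rewrite (lt_le_trans ltr01).
move=> /lt_le_trans/(_ (seglik_le_blocks sg x)).
by rewrite pmulr_rgt0// exprn_gt0.
Qed.

End nonneg.

Lemma measurable_mixlik bs i : (forall j, measurable_fun setT (f j)) ->
  measurable_fun setT (mixlik bs i : seqspace XX -> R).
Proof.
move=> mf; elim: bs i => [|b bs IH] i /=; first exact: measurable_cst.
apply: measurable_sum => j; apply: measurable_funM.
  apply: measurable_funM; first exact: measurable_cst.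
  exact: measurableT_comp (mf j) (measurable_coord 0).
apply: (measurableT_comp (IH j)).
exact: (measurable_shift 1).
Qed.

Lemma measurable_emission s : (forall j, measurable_fun setT (f j)) ->
  measurable_fun setT (emission s : seqspace XX -> R).
Proof.
move=> mf; elim: s => [|j s IH].
  rewrite (_ : emission [::] = fun=> 1); first exact: measurable_cst.
  by apply/funext => x; rewrite /emission big_ord0.
rewrite (_ : emission _ = fun x => f j (x 0%N) * emission s (fun t => x t.+1)).
  apply: measurable_funM.
    exact: measurableT_comp (mf j) (measurable_coord 0).
  by apply: (measurableT_comp IH); exact: (measurable_shift 1).
by apply/funext => x; rewrite emission_cons.
Qed.

End likelihoods.

(** * Densities and product measures *)

Section density_integral.
Local Open Scope ereal_scope.
Context d (T : measurableType d) (R : realType).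
Variables (nu mu : {measure set T -> \bar R}) (g : T -> R).
Hypothesis mg : measurable_fun setT g.
Hypothesis g_ge0 : forall x, (0 <= g x)%R.
Hypothesis nu_g : forall A, measurable A -> nu A = \int[mu]_(x in A) (g x)%:E.

Import HBNNSimple.

(** The relation is known on sets; linearity extends it to simple functions and monotone limits to
    all nonnegative functions. *)
Lemma ge0_integral_density (F : T -> \bar R) :
  measurable_fun setT F -> (forall x, 0 <= F x) ->
  \int[nu]_x F x = \int[mu]_x (F x * (g x)%:E).
Proof.
move=> mF F0.
pose h := nnsfun_approx measurableT mF.
have mG : measurable_fun setT (EFin \o g) by exact/measurable_EFinP.
have mh n : measurable_fun setT (EFin \o h n) by exact/measurable_EFinP.
have -> : \int[nu]_x F x = limn (fun n => \int[nu]_x (EFin \o h n) x).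
  have FE x : setT x -> F x = limn (fun n => (EFin \o h n) x).
    by move=> _; apply/esym/cvg_lim => //; exact: cvg_nnsfun_approx.
  under eq_integral => x /[!inE] /FE -> //.
  apply: monotone_convergence => //.
  - by move=> n x _ /=; rewrite lee_fin.
  - by move=> x _ a b ab; rewrite lee_fin; exact/lefP/nd_nnsfun_approx.
have -> : \int[mu]_x (F x * (g x)%:E) =
    limn (fun n => \int[mu]_x ((EFin \o h n) x * (g x)%:E)).
  have FE x : setT x -> F x * (g x)%:E = limn (fun n => (EFin \o h n) x * (g x)%:E).
    move=> _; apply/esym/cvg_lim => //; apply: cvgeZr => //.
    exact: cvg_nnsfun_approx.
  under eq_integral => x /[!inE] /FE -> //.
  apply: monotone_convergence => //.
  - by move=> n; exact: emeasurable_funM.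
  - by move=> n x _ /=; rewrite mule_ge0 ?lee_fin.
  - move=> x _ a b ab /=; rewrite lee_wpmul2r ?lee_fin//.
    exact/lefP/nd_nnsfun_approx.
congr (limn _); apply/funext => n.
transitivity (\int[nu]_x (\sum_(y \in range (h n))
    (y * \1_(h n @^-1` [set y]) x)%:E)).
  by apply: eq_integral => t _; rewrite /= fimfunE -fsumEFin.
have mi r : measurable_fun setT (fun x => (r * \1_(h n @^-1` [set r]) x)%:E).
  by apply/measurable_EFinP; exact: measurable_funM.
have mi0 y x : 0 <= (y * \1_(h n @^-1` [set y]) x)%:E.
  by rewrite EFinM nnfun_muleindic_ge0.
rewrite ge0_integral_fsum//.
transitivity (\int[mu]_x (\sum_(y \in range (h n))
    ((y * \1_(h n @^-1` [set y]) x)%:E * (g x)%:E))); last first.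
  apply: eq_integral => t _.
  rewrite -ge0_mule_fsuml => [|y]; last exact: mi0.
  by rewrite fsumEFin// -fimfunE.
rewrite ge0_integral_fsum//; last 2 first.
- by move=> y; exact: emeasurable_funM.
- by move=> m y _; rewrite mule_ge0 ?lee_fin//; exact: mi0.
apply: eq_fsbigr => r rh.
have r0 : (0 <= r)%R by move: rh; rewrite inE => -[x _ <-].
have mA : measurable (h n @^-1` [set r]) by [].
under eq_integral do rewrite EFinM.
rewrite ge0_integralZl_EFin//; last exact/measurable_EFinP.
rewrite integral_indic// setIT nu_g//.
under [RHS]eq_integral do rewrite EFinM -muleA.
rewrite ge0_integralZl_EFin//; last 2 first.
- by move=> x _; rewrite mule_ge0 ?lee_fin.
- by apply: emeasurable_funM => //; exact/measurable_EFinP.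
congr (_ * _); rewrite integral_mkcond; apply: eq_integral => x _.
rewrite /patch indicE; case: (x \in _); first by rewrite mul1e.
by rewrite mul0e.
Qed.

Lemma ge0_integral_density_in (F : T -> \bar R) A : measurable A ->
  measurable_fun setT F -> (forall x, 0 <= F x) ->
  \int[nu]_(x in A) F x = \int[mu]_(x in A) (F x * (g x)%:E).
Proof.
move=> mA mF F0; rewrite integral_mkcond ge0_integral_density.
- rewrite [RHS]integral_mkcond; apply: eq_integral => x _.
  by rewrite /patch; case: ifP => // _; rewrite mul0e.
- apply/(measurable_restrictT _ mA); exact: measurable_funTS.
- by move=> x; rewrite /patch; case: ifP.
Qed.

(** The proofs are arguments so that the measure structure can be attached to the name itself. *)
Definition density_measure of measurable_fun setT g & (forall x, (0 <= g x)%R) :=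
  fun A => \int[mu]_(x in A) (g x)%:E.

End density_integral.

Section density_measure.
Local Open Scope ereal_scope.
Context d (T : measurableType d) (R : realType).
Variables (mu : {measure set T -> \bar R}) (g : T -> R).
Variables (mg : measurable_fun setT g) (g0 : forall x, (0 <= g x)%R).

Local Notation nu := (density_measure mu mg g0).

Let nu0 : nu set0 = 0. Proof. by rewrite /density_measure integral_set0. Qed.

Let nu_ge0 A : 0 <= nu A.
Proof. by apply: integral_ge0 => x _; rewrite lee_fin. Qed.

Let nu_sigma_additive : semi_sigma_additive nu.
Proof.
move=> F mF tF mUF.
rewrite {2}/density_measure ge0_integral_bigcup//; last 2 first.
- by apply: measurable_funTS; exact/measurable_EFinP.
- by move=> x _; rewrite lee_fin.
apply: is_cvg_nneseries => n _ _.
exact: nu_ge0.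
Qed.

HB.instance Definition _ := isMeasure.Build _ _ _ nu nu0 nu_ge0 nu_sigma_additive.

End density_measure.

Section tuple_rectangles.
Context d (T : measurableType d) (n : nat).

Definition rectangle (B : nat -> set T) : set (n.-tuple T) :=
  [set x | forall i : 'I_n, B i (tnth x i)].

Definition rectangles : set (set (n.-tuple T)) :=
  [set A | exists B, (forall i, measurable (B i)) /\ A = rectangle B].

Lemma measurable_rectangle B : (forall i, measurable (B i)) ->
  measurable (rectangle B).
Proof.
move=> mB; rewrite (_ : rectangle B =
  \bigcap_(i in @setT 'I_n) ((@tnth n T)^~ i @^-1` B i)).
  apply: fin_bigcap_measurable => // i _.
  by rewrite -[X in measurable X]setTI; exact: measurable_tnth.
by apply/seteqP; split => [x Bx i _|x Bx i]; [exact: Bx|exact: Bx].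
Qed.

Lemma rectangles_setI : setI_closed rectangles.
Proof.
move=> A1 A2 [B [mB ->]] [C [mC ->]]; exists (fun i => B i `&` C i); split.
  by move=> i; exact: measurableI.
apply/seteqP; split => [x [Bx Cx] i|x BC]; first by split.
by split => i; case: (BC i).
Qed.

Lemma rectangles_setT : rectangles setT.
Proof. by exists (fun=> setT); split => //; apply/seteqP; split. Qed.

Lemma measurable_tupleE : @measurable _ (n.-tuple T) = <<s rectangles >>.
Proof.
apply/seteqP; split.
  apply: smallest_sub; first exact: smallest_sigma_algebra.
  apply: (big_ind (fun X : set (set (n.-tuple T)) => X `<=` <<s rectangles >>)).
  - by [].
  - by move=> X Y Xs Ys A [/Xs|/Ys].
  move=> i _ _ [B mB <-]; apply: sub_sigma_algebra.
  exists (fun j : nat => if j == i :> nat then B else setT).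
  split; first by move=> j; case: ifP.
  rewrite setTI; apply/seteqP; split => [x Bx j|x Bx]; last first.
    by have := Bx i; rewrite eqxx.
  by case: eqP => // /val_inj ->.
apply: smallest_sub; first exact: sigma_algebra_measurable.
by move=> A [B [mB ->]]; exact: measurable_rectangle.
Qed.

End tuple_rectangles.

Section power_integrals.
Local Open Scope ereal_scope.
Context d (T : measurableType d) (R : realType).
Variable mu : {sigma_finite_measure set T -> \bar R}.

Lemma measurable_tuple_path n :
  measurable_fun setT ((fun x : n.-tuple T => nth point x) : n.-tuple T -> seqspace T).
Proof.
apply: measurable_fun_seq => i; have [ni|ni] := leqP n i.
  under eq_fun do rewrite nth_default ?size_tuple//.
  exact: measurable_cst.
rewrite (_ : (fun w => _) = (@tnth n T)^~ (Ordinal ni)).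
  exact: measurable_tnth.
by apply/funext => x; rewrite (tnth_nth point).
Qed.

Lemma integral_power_measureS n (F : n.+1.-tuple T -> \bar R) :
  measurable_fun setT F -> (forall x, 0 <= F x) ->
  \int[power_measure mu n.+1]_x F x =
  \int[mu]_x \int[power_measure mu n]_y F (cons_pair (x, y)).
Proof.
move=> mF F0.
pose c : {mfun (T * n.-tuple T)%type >-> n.+1.-tuple T} :=
  HB.pack (@cons_pair _ T n)
    (isMeasurableFun.Build _ _ _ _ _ (@measurable_cons_pair _ T n)).
transitivity (\int[pushforward (mu \x power_measure mu n) c]_x F x).
  by apply: eq_measure_integral => A mA _.
rewrite ge0_integral_pushforward// preimage_setT fubini_tonelli1//.
  exact: measurableT_comp.
by move=> x; exact: F0.
Qed.

Lemma measurable_prod_coords n (g : nat -> T -> R) :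
  (forall t, measurable_fun setT (g t)) ->
  measurable_fun setT ((fun x => \prod_(t < n) g t (x t))%R : seqspace T -> R).
Proof.
move=> mg; apply: measurable_prod => t _.
exact: measurableT_comp (mg t) (measurable_coord t).
Qed.

Lemma measurable_prod_tuple n (g : nat -> T -> R) :
  (forall t, measurable_fun setT (g t)) ->
  measurable_fun setT (fun x : n.-tuple T => \prod_(t < n) g t (nth point x t))%R.
Proof.
move=> mg; apply: (measurableT_comp (f := (fun x => \prod_(t < n) g t (x t))%R
  : seqspace T -> R) (g := fun x : n.-tuple T => nth point x)).
  exact: measurable_prod_coords.
exact: measurable_tuple_path.
Qed.

Lemma integral_power_measure_prod n (g : nat -> T -> R) :
  (forall t, measurable_fun setT (g t)) -> (forall t x, (0 <= g t x)%R) ->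
  \int[power_measure mu n]_x (\prod_(t < n) g t (nth point x t))%:E =
  \prod_(t < n) \int[mu]_y (g t y)%:E.
Proof.
elim: n g => [|n IH] g mg g0.
  under eq_integral do rewrite big_ord0.
  by rewrite big_ord0 integral_cst// mul1e /= diracT.
rewrite integral_power_measureS; last 2 first.
- by apply/measurable_EFinP; exact: measurable_prod_tuple.
- by move=> x; rewrite lee_fin prodr_ge0.
have mP : measurable_fun setT (fun y : n.-tuple T =>
    (\prod_(t < n) g t.+1 (nth point y t))%:E).
  apply/measurable_EFinP.
  exact: (measurable_prod_tuple (g := fun t => g t.+1) (fun t => mg t.+1)).
transitivity (\int[mu]_x ((g 0%N x)%:E * \int[power_measure mu n]_y
    (\prod_(t < n) g t.+1 (nth point y t))%:E)).
  apply: eq_integral => x _; rewrite -ge0_integralZl_EFin//.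
  - by apply: eq_integral => y _; rewrite big_ord_recl/= EFinM.
  - by move=> y _; rewrite lee_fin prodr_ge0.
rewrite (IH (fun t => g t.+1))// ge0_integralZr//.
- by rewrite big_ord_recl.
- exact/measurable_EFinP.
- by move=> x _; rewrite lee_fin.
- apply: (big_ind (fun x => 0 <= x)) => // [a b|i _]; first exact: mule_ge0.
  by apply: integral_ge0 => x _; rewrite lee_fin.
Qed.

End power_integrals.

Lemma measure_finite_partition d (W : measurableType d) (R : realType)
    (P : {measure set W -> \bar R}) (I : finType) (y : W -> I) (B : set W) :
  (forall i, measurable [set w | y w = i]) -> measurable B ->
  (P B = \sum_i P ([set w | y w = i] `&` B))%E.
Proof.
move=> my mB.
have mi i : measurable ([set w | y w = i] `&` B) by exact: measurableI.
transitivity (\int[P]_w (\sum_i \1_([set w | y w = i] `&` B) w)%:E)%E.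
  rewrite -[B in LHS]setIT -integral_indic//; apply: eq_integral => w _.
  congr EFin; rewrite (bigD1 (y w))//= big1 => [|i iy].
    by rewrite addr0 !indicE; congr (nat_of_bool _)%:R; apply/idP/idP; rewrite !inE//= => -[].
  rewrite indicE memNset// => -[/= yi _]; by rewrite yi eqxx in iy.
under eq_integral do rewrite -sumEFin.
rewrite ge0_integral_sum//; last by move=> i; exact/measurable_EFinP.
by apply: eq_bigr => i _; rewrite integral_indic// setIT.
Qed.

Lemma ae_pushforward d1 d2 (W : measurableType d1) (U : measurableType d2)
    (R : realType) (P : {measure set W -> \bar R}) (X : W -> U)
    (nu : {measure set U -> \bar R}) (Q : U -> Prop) :
  measurable_fun setT X -> (forall A, measurable A -> nu A = P (X @^-1` A)) ->
  {ae nu, forall x, Q x} -> {ae P, forall w, Q (X w)}.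
Proof.
move=> mX nuP [A [mA A0 QA]]; exists (X @^-1` A); split.
- by rewrite -[X in measurable X]setTI; exact: mX.
- by rewrite -nuP.
- by move=> w /= nQ; apply: QA.
Qed.

(** * Finite-dimensional laws of the hidden Markov model *)

Section hmm_laws.
Context d (Omega : measurableType d) (R : realType) (P : probability Omega R).
Context d' (XX : measurableType d') (mu : {sigma_finite_measure set XX -> \bar R}).
Variables (N : nat).
Local Notation state := 'I_N.+1.
Variables (X : nat -> Omega -> XX) (Y : nat -> Omega -> state).
Variables (p : 'M[R]_N.+1) (f : state -> XX -> R) (Pe : state -> probability XX R).
Hypothesis hHMM : ergodic_HMM P mu X Y p f Pe.

Definition initial (j : state) : R := fine (P [set w | Y 0 w = j]).

Local Notation pi := initial.

Lemma hmm_p_ge0 i j : 0 <= p i j.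
Proof. by case: hHMM => -[[]]. Qed.

Lemma hmm_p_sum i : \sum_j p i j = 1.
Proof. by case: hHMM => -[[_]]. Qed.

Lemma hmm_mX t : measurable_fun setT (X t).
Proof. by case: hHMM => _ [_ _ []]. Qed.

Lemma hmm_mY t : measurable_fun setT (Y t).
Proof. by case: hHMM => _ [[]]. Qed.

Lemma hmm_mf j : measurable_fun setT (f j).
Proof. by case: hHMM => _ [_ _ _ /(_ j)[]]. Qed.

Lemma hmm_f_ge0 j x : 0 <= f j x.
Proof. by case: hHMM => _ [_ _ _ /(_ j)[_ + _]]; exact. Qed.

Lemma hmm_density j A : measurable A ->
  Pe j A = (\int[mu]_(x in A) (f j x)%:E)%E.
Proof. by case: hHMM => _ [_ _ _ /(_ j)[_ _]]; exact. Qed.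

Lemma hmm_mYs t j : measurable [set w | Y t w = j].
Proof.
rewrite -[X in measurable X]setTI.
exact: (hmm_mY t measurableT (Y := [set j])).
Qed.

Lemma initialE j : (pi j)%:E = P [set w | Y 0 w = j].
Proof. by rewrite /initial fineK// fin_num_measure//; exact: hmm_mYs. Qed.

Lemma initial_ge0 j : 0 <= pi j.
Proof. by rewrite fine_ge0. Qed.

Lemma initial_sum : \sum_j pi j = 1.
Proof.
apply: EFin_inj; rewrite -sumEFin -(probability_setT P).
rewrite (measure_finite_partition P (fun j => hmm_mYs 0 j) measurableT).
by apply: eq_bigr => j _; rewrite initialE setIT.
Qed.

(** The Markov property extends a path at its end, while [path_weight] recurses from its
    beginning. *)
Lemma path_weight_rcons bs b i s j : size bs = size s ->
  path_weight p pi (rcons bs b) i (rcons s j) =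
  path_weight p pi bs i s * jump p pi b (last i s) j.
Proof.
elim: bs s i => [|b' bs IH] [|j' s] i //= ss; first by rewrite mulr1 mul1r.
by case: ss => ss; rewrite IH// mulrA.
Qed.

Lemma path_prob n (s : nat -> state) :
  P [set w | forall i, (i < n)%N -> Y i w = s i] =
  (path_weight p pi (block n) ord0 (mkseq s n))%:E.
Proof.
case: n => [|n].
  rewrite (_ : [set _ | _] = setT) ?probability_setT//.
  by apply/seteqP; split.
elim: n => [|n IH].
  rewrite /= mulr1 /jump initialE; congr (P _).
  by apply/seteqP; split => [w /(_ 0%N)|w /= ws [|i]//]; exact.
case: hHMM => _ [[_ markov] _ _ _].
rewrite markov IH -EFinM; congr EFin.
have -> : block n.+2 = rcons (block n.+1) false.
  by rewrite /=; congr cons; elim: (n) => //= m ->.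
rewrite [in RHS]mkseqS path_weight_rcons; last by rewrite size_block size_mkseq.
by rewrite /jump mkseqS last_rcons.
Qed.

Lemma YnE n (s : n.-tuple state) :
  [set w | Yn Y n w = s] =
  [set w | forall i, (i < n)%N -> Y i w = nth ord0 s i].
Proof.
apply/seteqP; split => [w /= <- i ni|w /= Ys].
  by rewrite -[i]/(nat_of_ord (Ordinal ni)) -tnth_nth tnth_mktuple.
apply: eq_from_tnth => i; rewrite tnth_mktuple Ys//.
by rewrite (tnth_nth ord0).
Qed.

Lemma measurable_Yns n (s : n.-tuple state) : measurable [set w | Yn Y n w = s].
Proof.
rewrite YnE (_ : [set _ | _] =
  \bigcap_(i in [set i | (i < n)%N]) [set w | Y i w = nth ord0 s i]).
  by apply: bigcap_measurableType => i _; exact: hmm_mYs.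
by apply/seteqP; split.
Qed.

Lemma measurable_Xn n : measurable_fun setT (Xn X n).
Proof.
apply/measurable_fun_tnthP => i.
rewrite (_ : _ \o _ = X i); first exact: hmm_mX.
by apply/funext => w /=; rewrite tnth_mktuple.
Qed.

Lemma Yn_prob n (s : n.-tuple state) :
  P [set w | Yn Y n w = s] = (path_weight p pi (block n) ord0 s)%:E.
Proof.
rewrite YnE path_prob; congr (path_weight _ _ _ _ _)%:E.
by apply: (@eq_from_nth _ ord0) => [|i]; rewrite size_mkseq ?size_tuple// => ni; rewrite nth_mkseq.
Qed.

Lemma nth_Xn n w t : (t < n)%N -> nth point (Xn X n w) t = X t w.
Proof.
by move=> tn; rewrite -[t]/(nat_of_ord (Ordinal tn)) -tnth_nth tnth_mktuple.
Qed.

Lemma measurable_emission_tuple n s :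
  measurable_fun setT (fun x : n.-tuple XX => emission f s (nth point x)).
Proof.
apply: (measurableT_comp (f := emission f s : seqspace XX -> R)
  (g := fun x : n.-tuple XX => nth point x)).
  exact: measurable_emission hmm_mf.
exact: measurable_tuple_path.
Qed.

Lemma measurable_mixlik_tuple n bs i :
  measurable_fun setT (fun x : n.-tuple XX => mixlik p f pi bs i (nth point x)).
Proof.
apply: (measurableT_comp (f := mixlik p f pi bs i : seqspace XX -> R)
  (g := fun x : n.-tuple XX => nth point x)).
  exact: measurable_mixlik hmm_mf.
exact: measurable_tuple_path.
Qed.

Lemma integral_emission_rectangle n (s : n.-tuple state) (A : nat -> set XX) :
  (forall i, measurable (A i)) ->
  (\int[power_measure mu n]_(x in @rectangle _ _ n A) (emission f s (nth point x))%:E =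
   \prod_(t < n) Pe (nth ord0 s t) (A t))%E.
Proof.
move=> mA.
pose g t x := f (nth ord0 s t) x * \1_(A t) x.
have mg t : measurable_fun setT (g t).
  by apply: measurable_funM; [exact: hmm_mf|].
have g0 t x : 0 <= g t x by rewrite mulr_ge0// hmm_f_ge0.
transitivity (\prod_(t < n) \int[mu]_y (g t y)%:E)%E; last first.
  apply: eq_bigr => t _; rewrite hmm_density// [RHS]integral_mkcond.
  apply: eq_integral => x _; rewrite /g /patch indicE.
  by case: (x \in A t); rewrite ?mulr1 ?mulr0.
rewrite -integral_power_measure_prod// [LHS]integral_mkcond.
apply: eq_integral => x _; rewrite /patch; case: ifPn => [/set_mem Ax|/negP Ax].
  rewrite /emission size_tuple; congr EFin; apply: eq_bigr => t _.
  have := Ax t; rewrite (tnth_nth point) => Axt.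
  by rewrite /g indicE mem_set// mulr1.
have [t nAt] : exists t : 'I_n, ~ A t (tnth x t).
  by apply/existsNP => H; apply: Ax; rewrite inE.
rewrite (bigD1 t)//= /g indicE memNset ?mulr0 ?mul0r//.
by rewrite -tnth_nth.
Qed.

(** Both sides are finite measures in [B]; on rectangles, which generate the sigma-algebra of
    tuples, the equality is the emission hypothesis. *)
Lemma joint_law n (s : n.-tuple state) B : measurable B ->
  P ([set w | Yn Y n w = s] `&` Xn X n @^-1` B) =
  (\int[power_measure mu n]_(x in B)
    (path_weight p pi (block n) ord0 s * emission f s (nth point x))%:E)%E.
Proof.
move=> mB.
pose w0 := path_weight p pi (block n) ord0 s.
have w0_ge0 : 0 <= w0 by apply: path_weight_ge0 => *; [exact: hmm_p_ge0|exact: initial_ge0].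
pose g (x : n.-tuple XX) := w0 * emission f s (nth point x).
have mg : measurable_fun setT g.
  by apply: measurable_funM => //; exact: measurable_emission_tuple.
have g0 x : 0 <= g x by rewrite mulr_ge0// emission_ge0//; exact: hmm_f_ge0.
pose m1' : {measure set (n.-tuple XX) -> \bar R} :=
  pushforward (mrestr P (measurable_Yns s)) (Xn X n).
pose m1 := m1' (@measurable_Xn n).
pose m2 : {measure set (n.-tuple XX) -> \bar R} :=
  density_measure (power_measure mu n) mg g0.
have m1E (A : set (n.-tuple XX)) : m1 A = P ([set w | Yn Y n w = s] `&` Xn X n @^-1` A).
  by rewrite /m1 /= /pushforward /mrestr setIC.
rewrite -m1E -[RHS]/(m2 B).
apply: (@measure_unique _ R (n.-tuple XX) (@rectangles _ _ n) (fun=> setT)) => //.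
- exact: measurable_tupleE.
- exact: rectangles_setI.
- by move=> _; exact: rectangles_setT.
- by apply/seteqP; split => // x _; exists 0%N.
- move=> _ [A [mA ->]]; rewrite m1E.
  case: hHMM => _ [_ _ [_ em] _].
  have := em n (nth ord0 s) A mA.
  rewrite -YnE Yn_prob => emE.
  transitivity (P [set w | forall i, (i < n)%N -> Y i w = nth ord0 s i /\ A i (X i w)]).
    congr (P _); rewrite YnE; apply/seteqP; split.
      move=> w [Ys Ax] i ni; split; first exact: Ys.
      by have := Ax (Ordinal ni); rewrite /= tnth_mktuple.
    move=> w H; split => [i ni|i]; first by case: (H i ni).
    by rewrite /= tnth_mktuple; case: (H i (ltn_ord i)).
  rewrite emE /m2 /= /density_measure /g.
  under [RHS]eq_integral do rewrite EFinM.
  rewrite ge0_integralZl_EFin//.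
  + by rewrite integral_emission_rectangle.
  + exact: measurable_rectangle.
  + by move=> x _; rewrite lee_fin emission_ge0//; exact: hmm_f_ge0.
  + by apply: measurable_funTS; apply/measurable_EFinP; exact: measurable_emission_tuple.
- move=> _; rewrite m1E; apply: le_lt_trans (probability_le1 P _) (ltry _).
  by rewrite preimage_setT setIT; exact: measurable_Yns.
Qed.

Local Notation lk n := (seglik p f pi n).

Lemma mixlik_nonneg bs i x : 0 <= mixlik p f pi bs i x.
Proof.
apply: mixlik_ge0 => *; [exact: hmm_p_ge0|exact: initial_ge0|exact: hmm_f_ge0].
Qed.

Lemma law_Xn n B : measurable B ->
  P (Xn X n @^-1` B) =
  (\int[power_measure mu n]_(x in B) (lk n (nth point x))%:E)%E.
Proof.
move=> mB.
have mXB : measurable (Xn X n @^-1` B).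
  by rewrite -[X in measurable X]setTI; exact: measurable_Xn.
rewrite (measure_finite_partition P (@measurable_Yns n) mXB).
transitivity (\sum_(s : n.-tuple state) \int[power_measure mu n]_(x in B)
    (path_weight p pi (block n) ord0 s * emission f s (nth point x))%:E)%E.
  by apply: eq_bigr => s _; exact: joint_law.
rewrite -ge0_integral_sum//.
- apply: eq_integral => x _; rewrite sumEFin; congr EFin.
  by rewrite /seglik (mixlikE _ _ _ _ _ (size_block n)).
- move=> s; apply: measurable_funTS; apply/measurable_EFinP.
  by apply: measurable_funM => //; exact: measurable_emission_tuple.
- move=> s x _; rewrite lee_fin mulr_ge0//.
    by apply: path_weight_ge0 => *; [exact: hmm_p_ge0|exact: initial_ge0].
  by apply: emission_ge0; exact: hmm_f_ge0.
Qed.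

Lemma sum_path_weight n bs i : size bs = n ->
  \sum_(s : n.-tuple state) path_weight p pi bs i s = 1.
Proof.
elim: bs n i => [|b bs IH] [|n] i //=.
  move=> _; rewrite (big_pred1 [tuple])//.
  by move=> s; rewrite [s]tuple0; apply/esym/eqP/val_inj.
move=> [sn]; rewrite big_cons_tuple.
rewrite (eq_bigr (fun j => jump p pi b i j)); last first.
  by move=> j _; rewrite -mulr_sumr IH// mulr1.
by case: b; [exact: initial_sum|exact: hmm_p_sum].
Qed.

(** Every pattern of restarts is the law of some process, so each [mixlik], and in particular the
    product over blocks, is a probability density. *)
Lemma integral_mixlik n bs i : size bs = n ->
  (\int[power_measure mu n]_x (mixlik p f pi bs i (nth point x))%:E = 1)%E.
Proof.
move=> sb.
transitivity (\int[power_measure mu n]_x (\sum_(s : n.-tuple state)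
    (path_weight p pi bs i s * emission f s (nth point x))%:E))%E.
  by apply: eq_integral => x _; rewrite sumEFin (mixlikE _ _ _ _ _ sb).
have w0 (s : n.-tuple state) : 0 <= path_weight p pi bs i s.
  by apply: path_weight_ge0 => *; [exact: hmm_p_ge0|exact: initial_ge0].
have e0 s (x : n.-tuple XX) : 0 <= emission f s (nth point x).
  by apply: emission_ge0; exact: hmm_f_ge0.
have me (s : n.-tuple state) := @measurable_emission_tuple n s.
rewrite ge0_integral_sum//; last 2 first.
- by move=> s; apply/measurable_EFinP; exact: measurable_funM.
- by move=> s x _; rewrite lee_fin mulr_ge0.
rewrite -[RHS]/(1%:E) -(sum_path_weight i sb) -sumEFin; apply: eq_bigr => s _.
under eq_integral do rewrite EFinM.
rewrite ge0_integralZl_EFin//; last 2 first.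
- by move=> x _; rewrite lee_fin.
- exact/measurable_EFinP.
have := @integral_emission_rectangle n s (fun=> setT) (fun=> measurableT).
rewrite (_ : rectangle _ = setT); last by apply/seteqP; split.
move=> ->; rewrite big1 ?mule1// => t _.
exact: probability_setT.
Qed.

End hmm_laws.

Lemma measurable_funV_ge0 d (T : measurableType d) (R : realType) (h : T -> R) :
  measurable_fun setT h -> (forall x, 0 <= h x) ->
  measurable_fun setT (fun x => (h x)^-1).
Proof.
move=> mh h0.
rewrite (_ : (fun x => _) = fun x => if 0 < h x then expR (-1 * ln (h x)) else 0).
  apply: measurable_fun_ifT => //; first exact: measurable_fun_ltr.
  apply: (measurableT_comp (@measurable_expR R)).
  by apply: measurable_funM => //; exact: (measurableT_comp (@measurable_ln R) mh).
apply/funext => x; case: ltP => hx; first by rewrite mulN1r expRN lnK.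
have -> : h x = 0 by apply/eqP; rewrite eq_le hx h0.
by rewrite invr0.
Qed.

Section hmm_ae.
Context d (Omega : measurableType d) (R : realType) (P : probability Omega R).
Context d' (XX : measurableType d') (mu : {sigma_finite_measure set XX -> \bar R}).
Variables (N : nat).
Local Notation state := 'I_N.+1.
Variables (X : nat -> Omega -> XX) (Y : nat -> Omega -> state).
Variables (p : 'M[R]_N.+1) (f : state -> XX -> R) (Pe : state -> probability XX R).
Hypothesis hHMM : ergodic_HMM P mu X Y p f Pe.

Local Notation pi := (initial P Y).
Local Notation lk n := (seglik p f pi n).
Local Notation pw n := (path_weight p pi (block n) ord0).

Lemma initial_invariant j : pi j = \sum_i pi i * p i j.
Proof.
apply: EFin_inj; rewrite (initialE hHMM) -sumEFin.
have [_ [_ stY _ _]] := hHMM.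
have := stY 1%N 1%N (fun=> [set j]) (fun=> Logic.I).
have e t : [set w | forall i, (i < 1)%N -> [set j] (Y (t + i)%N w)] = [set w | Y t w = j].
  apply/seteqP; split => [w /(_ 0%N isT)|w /= <- [|i]//]; rewrite ?addn0//.
rewrite e (e 0%N) => <-.
rewrite (measure_finite_partition P (fun i => hmm_mYs hHMM 0 i) (hmm_mYs hHMM 1 j)).
apply: eq_bigr => i _.
have := path_prob hHMM 2 (fun t => if t is 0%N then i else j).
rewrite /= mulr1 => <-; congr (P _); apply/seteqP; split.
  by move=> w [/= Y0 Y1] [|[|t]].
by move=> w /= H; split => /=; [exact: (H 0%N)|exact: (H 1%N)].
Qed.

(** Some state has positive mass, [pi] is invariant under every power of [p], and by irreducibility
    a power carries mass from that state to [j]. *)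
Lemma initial_gt0 j : 0 < pi j.
Proof.
have pi0 i : 0 <= pi i by exact: initial_ge0.
have inv k i : pi i = \sum_l pi l * (p ^+ k) l i.
  elim: k i => [|k IH] i.
    rewrite (bigD1 i)//= expr0 mxE eqxx mulr1 big1 ?addr0// => l li.
    by rewrite mxE (negbTE li) mulr0.
  rewrite initial_invariant; under eq_bigr do rewrite IH mulr_suml.
  rewrite exchange_big/=; apply: eq_bigr => l _.
  rewrite exprSr mxE mulr_sumr; apply: eq_bigr => m _.
  by rewrite mulrA.
have pk k l i : 0 <= (p ^+ k) l i.
  elim: k l i => [|k IH] l i; first by rewrite expr0 mxE; case: (_ == _).
  by rewrite exprSr mxE sumr_ge0// => m _; rewrite mulr_ge0// (hmm_p_ge0 hHMM).
have [i pii] : exists i, 0 < pi i.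
  apply: contrapT => /forallNP H; have := initial_sum hHMM.
  rewrite big1 => [/eqP|i _]; first by rewrite eq_sym oner_eq0.
  by apply/eqP; rewrite eq_le pi0 andbT leNgt; apply/negP; exact: H.
have [[_ irr _] _] := hHMM; have [k pkij] := irr i j.
rewrite (inv k) (bigD1 i)//=; apply: ltr_wpDr; last exact: mulr_gt0.
by apply: sumr_ge0 => l _; rewrite mulr_ge0.
Qed.

(** With [C] the sum of all [1 / pi j] one has [p i j <= 1 <= C * pi j]. *)
Lemma restart_constant : exists2 C : R, 1 <= C & forall i j, p i j <= C * pi j.
Proof.
have pi_le1 j : pi j <= 1.
  rewrite -(initial_sum hHMM) (bigD1 j)//= lerDl sumr_ge0// => i _.
  exact: initial_ge0.
have p_le1 i j : p i j <= 1.
  rewrite -(hmm_p_sum hHMM i) (bigD1 j)//= lerDl sumr_ge0// => l _.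
  exact: (hmm_p_ge0 hHMM).
pose C := \sum_j (pi j)^-1.
have CC j : (pi j)^-1 <= C.
  rewrite /C (bigD1 j)//= lerDl sumr_ge0// => l _.
  by rewrite invr_ge0 initial_ge0.
exists C.
  by apply: le_trans (CC ord0); rewrite invf_ge1// initial_gt0.
move=> i j; apply: (le_trans (p_le1 i j)).
by rewrite -ler_pdivrMr ?initial_gt0// mul1r.
Qed.

Lemma path_weight_nonneg bs i s : 0 <= path_weight p pi bs i s.
Proof.
by apply: path_weight_ge0 => *; [exact: (hmm_p_ge0 hHMM)|exact: initial_ge0].
Qed.

Lemma emission_nonneg s x : 0 <= emission f s x.
Proof. by apply: emission_ge0; exact: (hmm_f_ge0 hHMM). Qed.

Lemma mixlik_Xn bs i n w : (size bs <= n)%N ->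
  mixlik p f pi bs i (nth point (Xn X n w)) = mixlik p f pi bs i (X^~ w).
Proof.
move=> bn; apply: mixlik_ext => t tb; apply: nth_Xn.
exact: leq_trans bn.
Qed.

Lemma emission_Xn (s : seq state) n w : (size s <= n)%N ->
  emission f s (nth point (Xn X n w)) = emission f s (X^~ w).
Proof.
move=> sn; apply: eq_bigr => t _; rewrite nth_Xn//.
exact: leq_trans sn.
Qed.

Lemma seglik_Xn n w : lk n (nth point (Xn X n w)) = lk n (X^~ w).
Proof. by apply: mixlik_Xn; rewrite size_block. Qed.

(** By [joint_law] the event that the path is [s] and the observations lie where its density
    vanishes has probability 0. *)
Lemma true_path_likelihood_gt0 : {ae P, forall w, forall n,
  0 < pw n (Yn Y n w) * emission f (Yn Y n w) (X^~ w)}.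
Proof.
apply: ae_foralln => n.
have H (s : n.-tuple state) : {ae P, forall w, Yn Y n w = s ->
    0 < pw n s * emission f s (nth point (Xn X n w))}.
  pose B := [set x : n.-tuple XX | pw n s * emission f s (nth point x) <= 0].
  have mB : measurable B.
    rewrite -[B]setTI; apply: measurable_fun_ler => //.
    by apply: measurable_funM => //; exact: (measurable_emission_tuple hHMM).
  exists ([set w | Yn Y n w = s] `&` Xn X n @^-1` B); split.
  - apply: measurableI; first exact: (measurable_Yns hHMM).
    by rewrite -[X in measurable X]setTI; exact: (measurable_Xn hHMM).
  - rewrite (joint_law hHMM s mB) integral0_eq// => x /= Bx.
    congr EFin; apply/eqP; rewrite eq_le Bx mulr_ge0//.
    - exact: path_weight_nonneg.
    - exact: emission_nonneg.
  move=> w /= /not_implyP[Ys /negP]; rewrite -leNgt => h.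
  by split.
(* The path is random, so the null sets of all paths are united; [unpickle] makes this a countable
   union. *)
have H' : {ae P, forall w, forall k : nat, forall s : n.-tuple state,
    unpickle k = Some s -> Yn Y n w = s ->
    0 < pw n s * emission f s (nth point (Xn X n w))}.
  apply: ae_foralln => k; case: (unpickle k) => [s|]; last exact: aeW.
  by apply: filterS (H s) => w h _ [<-].
apply: filterS H' => w h; have := h _ _ (pickleK (Yn Y n w)) erefl.
by rewrite emission_Xn ?size_tuple.
Qed.

Lemma seglik_gt0 : {ae P, forall w, forall n, 0 < lk n (X^~ w)}.
Proof.
apply: filterS true_path_likelihood_gt0 => w h n.
apply: lt_le_trans (h n) _; apply: path_le_mixlik.
- exact: (hmm_p_ge0 hHMM).
- by move=> j; exact: initial_ge0.
- exact: (hmm_f_ge0 hHMM).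
- by rewrite size_block size_tuple.
Qed.

Section versions.
Variable n : nat.

Let mXn := @measurable_Xn _ _ _ _ _ _ _ _ _ _ _ _ _ hHMM n.

Let Xm : {mfun Omega >-> n.-tuple XX} :=
  HB.pack (Xn X n) (isMeasurableFun.Build _ _ _ _ _ mXn).

Let nu : probability (n.-tuple XX) R := distribution P Xm.

Let nuE A : nu A = P (Xn X n @^-1` A). Proof. by []. Qed.

Let m_lk : measurable_fun setT (fun x : n.-tuple XX => lk n (nth point x)).
Proof. exact: (measurable_mixlik_tuple hHMM). Qed.

Let lk_ge0 (x : n.-tuple XX) : 0 <= lk n (nth point x).
Proof. exact: (mixlik_nonneg hHMM). Qed.

Let nu_lk A : measurable A ->
  nu A = (\int[power_measure mu n]_(x in A) (lk n (nth point x))%:E)%E.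
Proof. exact: (law_Xn hHMM). Qed.

Lemma expectation_Xn (F : n.-tuple XX -> R) :
  measurable_fun setT F -> (forall x, 0 <= F x) ->
  (\int[P]_w (F (Xn X n w))%:E =
   \int[power_measure mu n]_x (F x * lk n (nth point x))%:E)%E.
Proof.
move=> mF F0.
have mF' : measurable_fun setT (EFin \o F) by exact/measurable_EFinP.
transitivity (\int[nu]_x (F x)%:E)%E.
  rewrite ge0_integral_pushforward// => x _.
  by rewrite lee_fin.
by rewrite (ge0_integral_density m_lk lk_ge0 nu_lk).
Qed.

(** [lik n] and [seglik] are densities of the same law, hence equal outside a [power_measure] null
    set. That law has a density, so the set is also null for it. *)
Lemma likelihood_version (lik : forall n, n.-tuple XX -> R) :
  likelihood P mu X lik -> {ae P, forall w, lik n (Xn X n w) = lk n (X^~ w)}.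
Proof.
move=> /(_ n)[mlik lik0 likE].
have mL : measurable_fun setT (EFin \o lik n) by exact/measurable_EFinP.
have mK : measurable_fun setT (fun x : n.-tuple XX => (lk n (nth point x))%:E).
  exact/measurable_EFinP.
have iL : (power_measure mu n).-integrable setT (EFin \o lik n).
  apply/integrableP; split => //.
  under eq_integral do rewrite /= ger0_norm//.
  by rewrite -likE// preimage_setT probability_setT ltry.
have : ae_eq (power_measure mu n) setT (EFin \o lik n)
    (fun x => (lk n (nth point x))%:E).
  apply: integral_ae_eq => // E _ mE.
  by rewrite -nu_lk// -likE.
move=> [A [mA A0 HA]]; exists (Xn X n @^-1` A); split.
- by rewrite -[X in measurable X]setTI; exact: mXn.
- rewrite -nuE nu_lk//; apply: null_set_integral => //.
  by apply: measurable_funTS.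
move=> w /= H; apply: HA => /= /(_ Logic.I)[]; rewrite seglik_Xn; exact: H.
Qed.

(** Bayes' formula is one version of the conditional probability, and two versions agree almost
    surely. *)
Lemma posterior_version (post : forall n, n.-tuple state -> n.-tuple XX -> R)
    (s : n.-tuple state) : posterior P X Y post ->
  {ae P, forall w, post n s (Xn X n w) =
    pw n s * emission f s (X^~ w) / lk n (X^~ w)}.
Proof.
move=> /(_ n s)[mpost postE].
pose q (x : n.-tuple XX) := pw n s * emission f s (nth point x) / lk n (nth point x).
have num_ge0 (x : n.-tuple XX) : 0 <= pw n s * emission f s (nth point x).
  by rewrite mulr_ge0 ?path_weight_nonneg ?emission_nonneg.
have num_le (x : n.-tuple XX) : pw n s * emission f s (nth point x) <= lk n (nth point x).
  apply: path_le_mixlik.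
  - exact: (hmm_p_ge0 hHMM).
  - by move=> j; exact: initial_ge0.
  - exact: (hmm_f_ge0 hHMM).
  - by rewrite size_block size_tuple.
have mq : measurable_fun setT q.
  apply: measurable_funM; last first.
    by apply: measurable_funV_ge0.
  by apply: measurable_funM => //; exact: (measurable_emission_tuple hHMM).
have q0 x : 0 <= q x by rewrite divr_ge0.
have q1 x : q x <= 1.
  have := lk_ge0 x; rewrite le_eqVlt => /predU1P[e|lk0].
    by rewrite /q -e invr0 mulr0.
  by rewrite ler_pdivrMr// mul1r.
(* This includes points where the likelihood vanishes: the numerator lies between 0 and the
   likelihood, so it vanishes too. *)
have qlk x : q x * lk n (nth point x) = pw n s * emission f s (nth point x).
  have := lk_ge0 x; rewrite le_eqVlt => /predU1P[e|lk0].
    rewrite /q -e mulr0; apply/eqP; rewrite eq_le num_ge0/=.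
    by rewrite [leRHS]e num_le.
  by rewrite /q divfK// gt_eqF.
have iq : nu.-integrable setT (EFin \o q).
  apply: bounded_rv_integrable; split => //; exists 1 => x.
  by rewrite ger0_norm.
have mpost' : measurable_fun setT (EFin \o post n s) by exact/measurable_EFinP.
have mq' : measurable_fun setT (EFin \o q) by exact/measurable_EFinP.
have : ae_eq nu setT (EFin \o q) (EFin \o post n s).
  apply: integral_ae_eq => // E _ mE.
  rewrite (ge0_integral_density_in m_lk lk_ge0 nu_lk)//.
  transitivity (P [set w | Yn Y n w = s /\ E (Xn X n w)]).
    rewrite (joint_law hHMM s mE); apply: eq_integral => x _.
    by rewrite /= -EFinM qlk.
  rewrite postE//.
  (* [post] comes with measurability only, not with a sign, so the change of variables is made on
     positive and negative parts. *)
  rewrite [LHS]integralE [RHS]integralE; congr (_ - _)%E.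
    rewrite [RHS]ge0_integral_pushforward//.
      by apply: eq_integral => w _; rewrite /= !funeposE.
    by apply: measurable_funTS; exact: measurable_funepos.
  rewrite [RHS]ge0_integral_pushforward//.
    by apply: eq_integral => w _; rewrite /= !funenegE.
  by apply: measurable_funTS; exact: measurable_funeneg.
move=> H; have H' : {ae nu, forall x, post n s x = q x}.
  by apply: filterS H => x /(_ Logic.I) [].
have := ae_pushforward mXn (fun A _ => nuE A) H'.
apply: filterS => w ->; rewrite /q seglik_Xn emission_Xn//.
by rewrite size_tuple.
Qed.

End versions.
End hmm_ae.

(** The restriction of [P] to [E] is treated as the measure with density [\1_E]. *)
Lemma ge0_integral_on_event d1 d2 (W : measurableType d1) (U : measurableType d2)
    (R : realType) (P : {measure set W -> \bar R}) (nu : {measure set U -> \bar R})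
    (E : set W) (X : W -> U) (u : U -> \bar R) :
  measurable E -> measurable_fun setT X ->
  (forall A, measurable A -> P (E `&` X @^-1` A) = nu A) ->
  measurable_fun setT u -> (forall x, 0 <= u x)%E ->
  (\int[P]_w (u (X w) * (\1_E w)%:E) = \int[nu]_x u x)%E.
Proof.
move=> mE mX PE mu u0.
have mI : measurable_fun setT (\1_E : W -> R) by [].
have I0 w : (0 <= \1_E w :> R)%R by [].
pose m : {measure set W -> \bar R} := density_measure P mI I0.
have mD B : measurable B -> m B = P (E `&` B).
  by move=> mB; rewrite /m /= /density_measure integral_indic.
transitivity (\int[m]_w u (X w))%E.
  apply/esym; apply: (ge0_integral_density mI I0) => //.
  exact: measurableT_comp.
apply: (ge0_integral_eq_law (X2 := id)) => //.
move=> A mA; rewrite mD ?PE//.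
by rewrite -[X in measurable X]setTI; exact: mX.
Qed.

Section hmm_stationarity.
Context d (Omega : measurableType d) (R : realType) (P : probability Omega R).
Context d' (XX : measurableType d') (mu : {sigma_finite_measure set XX -> \bar R}).
Variables (N : nat).
Local Notation state := 'I_N.+1.
Variables (X : nat -> Omega -> XX) (Y : nat -> Omega -> state).
Variables (p : 'M[R]_N.+1) (f : state -> XX -> R) (Pe : state -> probability XX R).
Hypothesis hHMM : ergodic_HMM P mu X Y p f Pe.

Local Notation pi := (initial P Y).

(** [emits] speaks of blocks that start at the first time. A later block is reached by summing over
    the first [t] states, with no constraint on their observations, and then using stationarity of
    [Y]. *)
Lemma shifted_emits t l (s : nat -> state) (A : nat -> set XX) :
  (forall i, measurable (A i)) ->
  P [set w | forall i, (i < l)%N -> Y (t + i)%N w = s i /\ A i (X (t + i)%N w)] =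
  (P [set w | forall i, (i < l)%N -> Y i w = s i] * \prod_(i < l) Pe (s i) (A i))%E.
Proof.
move=> mA; have [_ [_ stY [_ em] _]] := hHMM.
have mD (D : nat -> Omega -> Prop) : (forall i, measurable [set w | D i w]) ->
    measurable [set w | forall i, (i < l)%N -> D i w].
  move=> mDi; rewrite (_ : [set w | _] =
    \bigcap_(i in [set i | (i < l)%N]) [set w | D i w]).
    by apply: bigcap_measurableType => i _; exact: mDi.
  by apply/seteqP; split.
have mYs i j : measurable [set w | Y i w = j] by exact: (hmm_mYs hHMM).
pose E := [set w | forall i, (i < l)%N -> Y (t + i)%N w = s i].
have mE : measurable E by apply: mD.
have mEA : measurable
    [set w | forall i, (i < l)%N -> Y (t + i)%N w = s i /\ A i (X (t + i)%N w)].
  apply: (mD (fun i w => Y (t + i)%N w = s i /\ A i (X (t + i)%N w))) => i.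
  have mXA : measurable (X (t + i)%N @^-1` A i).
    by rewrite -[X in measurable X]setTI; exact: (hmm_mX hHMM).
  exact: (measurableI _ _ (mYs (t + i)%N (s i)) mXA).
rewrite (measure_finite_partition P (@measurable_Yns _ _ _ _ _ _ _ _ _ _ _ _ _ hHMM t) mEA).
pose c := (\prod_(i < l) Pe (s i) (A i))%E.
have stE : P [set w | forall i, (i < l)%N -> Y i w = s i] = P E.
  by have := stY t l (fun i => [set s i]) (fun=> Logic.I); rewrite /E /= => <-.
rewrite stE (measure_finite_partition P (@measurable_Yns _ _ _ _ _ _ _ _ _ _ _ _ _ hHMM t) mE).
rewrite ge0_sume_distrl//.
apply: eq_bigr => u _.
pose s' i := if (i < t)%N then nth ord0 u i else s (i - t)%N.
pose A' i := if (i < t)%N then setT else A (i - t)%N.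
have mA' i : measurable (A' i) by rewrite /A'; case: ifP.
have := em (t + l)%N s' A' mA'.
rewrite (_ : [set w | _] = [set w | Yn Y t w = u] `&`
  [set w | forall i, (i < l)%N -> Y (t + i)%N w = s i /\ A i (X (t + i)%N w)]); last first.
  rewrite YnE; apply/seteqP; split => [w H|w [H1 H2] i].
    split => [i it|i il].
      by have := H i (leq_trans it (leq_addr _ _)); rewrite /s' it => -[].
    have := H (t + i)%N; rewrite ltn_add2l => /(_ il).
    by rewrite /s' /A' ltnNge leq_addr/= addKn.
  rewrite /s' /A'; case: (ltnP i t) => it iltl; first by split => //; exact: H1.
  have il : (i - t < l)%N by lia.
  by have := H2 _ il; rewrite subnKC.
move=> eqE; apply: (etrans eqE); congr (_ * _)%E.
  congr (P _); rewrite YnE; apply/seteqP; split => [w H|w [H1 H2] i].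
    split => [i it|i il].
      by have := H i (leq_trans it (leq_addr _ _)); rewrite /s' it.
    have := H (t + i)%N; rewrite ltn_add2l => /(_ il).
    by rewrite /s' ltnNge leq_addr/= addKn.
  rewrite /s'; case: (ltnP i t) => it iltl; first exact: H1.
  have il : (i - t < l)%N by lia.
  by have := H2 _ il; rewrite subnKC.
rewrite big_split_ord/= big1 ?mul1e => [|i _]; last first.
  by rewrite /A' ltn_ord; exact: probability_setT.
by apply: eq_bigr => i _; rewrite /s' /A' ltnNge leq_addr/= addKn.
Qed.

(** Stationarity is assumed of [Y] alone; fixing the states on the window turns joint events into
    emission events, whose probabilities do not depend on the shift. *)
Lemma hmm_stationary : stationary P (fun t w => (X t w, Y t w)).
Proof.
move=> t l A mA.
have mXY i : measurable_fun setT (fun w => (X i w, Y i w)).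
  by apply: measurable_fun_pair; [exact: (hmm_mX hHMM)|exact: (hmm_mY hHMM)].
have mD t' : measurable
    [set w | forall i, (i < l)%N -> A i (X (t' + i)%N w, Y (t' + i)%N w)].
  rewrite (_ : [set w | _] = \bigcap_(i in [set i | (i < l)%N])
    ((fun w => (X (t' + i)%N w, Y (t' + i)%N w)) @^-1` A i)).
    apply: bigcap_measurableType => i _.
    by rewrite -[X in measurable X]setTI; exact: mXY.
  by apply/seteqP; split.
pose yy t' w : l.-tuple state := [tuple Y (t' + i)%N w | i < l].
have yyE t' (s : l.-tuple state) : [set w | yy t' w = s] =
    [set w | forall i, (i < l)%N -> Y (t' + i)%N w = nth ord0 s i].
  apply/seteqP; split => [w /= <- i il|w /= Ys].
    by rewrite -[i]/(nat_of_ord (Ordinal il)) -tnth_nth tnth_mktuple.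
  apply: eq_from_tnth => i; rewrite tnth_mktuple Ys//.
  by rewrite (tnth_nth ord0).
have myy t' (s : l.-tuple state) : measurable [set w | yy t' w = s].
  rewrite yyE (_ : [set w | _] = \bigcap_(i in [set i | (i < l)%N])
    [set w | Y (t' + i)%N w = nth ord0 s i]).
    by apply: bigcap_measurableType => i _; exact: (hmm_mYs hHMM).
  by apply/seteqP; split.
(* The slice of [A i] at the state that [s] prescribes at time [i]. *)
pose B (s : l.-tuple state) i := (fun x => (x, nth ord0 s i)) @^-1` A i.
have mB s i : measurable (B s i).
  have mp : measurable_fun setT (fun x : XX => (x, nth ord0 s i)).
    by apply: measurable_fun_pair => //; exact: measurable_cst.
  by rewrite -[X in measurable X]setTI; exact: mp.
have H t' : P [set w | forall i, (i < l)%N -> A i (X (t' + i)%N w, Y (t' + i)%N w)] =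
    (\sum_(s : l.-tuple state) (P [set w | forall i, (i < l)%N -> Y i w = nth ord0 s i] *
      \prod_(i < l) Pe (nth ord0 s i) (B s i)))%E.
  rewrite (measure_finite_partition P (myy t') (mD t')).
  apply: eq_bigr => s _; rewrite -(shifted_emits t' l (nth ord0 s) (mB s)).
  congr (P _); rewrite yyE; apply/seteqP; split.
    move=> w [H1 H2] i il; split; first exact: H1.
    by rewrite /B /= -(H1 i il); exact: H2.
  move=> w H; split => i il; first by case: (H i il).
  by case: (H i il) => -> /=.
by rewrite H -(H 0%N).
Qed.

Lemma time0_law j A : measurable A ->
  P ([set w | Y 0 w = j] `&` X 0 @^-1` A) = ((pi j)%:E * Pe j A)%E.
Proof.
move=> mA; have := shifted_emits 0 1 (fun=> j) (fun=> mA).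
rewrite big_ord_recl big_ord0 mule1 (initialE hHMM).
rewrite (_ : [set w | _] = [set w | Y 0 w = j] `&` X 0 @^-1` A); last first.
  by apply/seteqP; split => [w /(_ 0%N isT)|w YX [|i]].
move=> ->; congr (_ * _)%E; congr (P _).
by apply/seteqP; split => [w /(_ 0%N isT)|w /= Y0 [|i]].
Qed.

Lemma time0_expectation (u : XX -> state -> R) :
  (forall j, measurable_fun setT (u^~ j)) -> (forall x j, 0 <= u x j) ->
  (\int[P]_w (u (X 0 w) (Y 0 w))%:E =
   \sum_j (pi j)%:E * \int[Pe j]_x (u x j)%:E)%E.
Proof.
move=> mu' u0.
have mY j := hmm_mYs hHMM 0 j.
have mX := hmm_mX hHMM 0.
have mux j : measurable_fun setT (fun w => u (X 0 w) j).
  exact: (measurableT_comp (mu' j) mX).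
transitivity (\int[P]_w \sum_j (u (X 0 w) j * \1_[set w | Y 0 w = j] w)%:E)%E.
  apply: eq_integral => w _; rewrite sumEFin; congr EFin.
  rewrite (bigD1 (Y 0 w))//= big1 => [|j jY].
    by rewrite addr0 indicE mem_set// mulr1.
  rewrite indicE memNset ?mulr0// => /= Yj; by rewrite Yj eqxx in jY.
rewrite ge0_integral_sum//; last 2 first.
- by move=> j; apply/measurable_EFinP; apply: measurable_funM.
- by move=> j w _; rewrite lee_fin mulr_ge0.
apply: eq_bigr => j _.
pose m2 : {measure set XX -> \bar R} := mscale (NngNum (initial_ge0 P Y j)) (Pe j).
transitivity (\int[m2]_x (u x j)%:E)%E; last first.
  rewrite ge0_integral_mscale//; first exact/measurable_EFinP.
  by move=> x _; rewrite lee_fin.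
under eq_integral do rewrite EFinM.
apply: (ge0_integral_on_event (u := fun x => (u x j)%:E)) => //.
- by move=> A mA; exact: time0_law.
- exact/measurable_EFinP.
- by move=> x; rewrite lee_fin.
Qed.

End hmm_stationarity.

(** * Growth rate of the log-likelihood *)

Section signed_slln.
Context d (Omega : measurableType d) (R : realType) (P : probability Omega R).
Context d1 (Omega1 : measurableType d1) (P1 : probability Omega1 R).
Context d' (T : measurableType d').
Variables (Z : nat -> Omega -> T) (S : nat -> Omega -> nat).
Variables (Zs : nat -> Omega1 -> T) (Ss : nat -> Omega1 -> nat).
Hypothesis reg : regenerative P Z S.
Hypothesis prec : positive_recurrent P S.
Hypothesis stat : stationary_version P P1 Z S Zs Ss.

Lemma regenerative_slln_signed (h : (nat -> T) -> R) (K : nat) :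
  measurable_fun setT (h : seqspace T -> R) ->
  (forall x y, (forall i, (i < K)%N -> x i = y i) -> h x = h y) ->
  P1.-integrable setT (fun w => (h (process_path Zs w 0))%:E) ->
  {ae P, forall w, (fun n => (\sum_(t < n) h (process_path Z w t)) / n%:R) @ \oo -->
    Rintegral P1 setT (fun w => h (process_path Zs w 0))}.
Proof.
move=> mh hK ih.
pose hp y := Num.max (h y) 0; pose hn y := Num.max (- h y) 0.
have mhp : measurable_fun setT (hp : seqspace T -> R).
  by apply: measurable_maxr => //; exact: measurable_cst.
have mhn : measurable_fun setT (hn : seqspace T -> R).
  apply: measurable_maxr => //.
  rewrite (_ : (fun y => - h y) = fun y => -1 * h y); last first.
    by apply/funext => y; rewrite mulN1r.
  by apply: measurable_funM => //; exact: measurable_cst.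
have hp0 y : 0 <= hp y by rewrite le_max lexx orbT.
have hn0 y : 0 <= hn y by rewrite le_max lexx orbT.
have mpath := measurable_process_path stat 0.
have ip : P1.-integrable setT (fun w => (hp (process_path Zs w 0))%:E).
  apply: le_integrable ih => //.
    by apply/measurable_EFinP; exact: (measurableT_comp mhp mpath).
  by move=> w _; rewrite lee_fin ger0_norm// ge_max normr_ge0 ler_norm.
have in_ : P1.-integrable setT (fun w => (hn (process_path Zs w 0))%:E).
  apply: le_integrable ih => //.
    by apply/measurable_EFinP; exact: (measurableT_comp mhn mpath).
  by move=> w _; rewrite lee_fin ger0_norm// ge_max normr_ge0 -normrN ler_norm.
have loo (g : (nat -> T) -> R) : (forall y, 0 <= g y) ->
    P1.-integrable setT (fun w => (g (process_path Zs w 0))%:E) ->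
    (\int[P1]_w (g (process_path Zs w 0))%:E < +oo)%E.
  move=> g0 /integrableP[_]; apply: le_lt_trans.
  by under [leRHS]eq_integral do rewrite gee0_abs ?lee_fin//.
have A1 := regenerative_slln reg prec stat mhp hp0 (K := K)
  ltac:(by move=> x y xy; rewrite /hp (hK _ _ xy)) (loo _ hp0 ip).
have A2 := regenerative_slln reg prec stat mhn hn0 (K := K)
  ltac:(by move=> x y xy; rewrite /hn (hK _ _ xy)) (loo _ hn0 in_).
have hE y : h y = hp y - hn y.
  by rewrite /hp /hn; case: (leP (h y) 0) => ?; case: (leP (- h y) 0) => ?; lra.
have -> : Rintegral P1 setT (fun w => h (process_path Zs w 0)) =
    Rintegral P1 setT (fun w => hp (process_path Zs w 0)) -
    Rintegral P1 setT (fun w => hn (process_path Zs w 0)).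
  rewrite -RintegralB//; apply: eq_Rintegral => w _; exact: hE.
apply: filterS2 A1 A2 => w c1 c2.
have L : (fun n => (\sum_(t < n) hp (process_path Z w t)) / n%:R -
    (\sum_(t < n) hn (process_path Z w t)) / n%:R) @ \oo -->
    Rintegral P1 setT (fun w => hp (process_path Zs w 0)) -
    Rintegral P1 setT (fun w => hn (process_path Zs w 0)) by exact: cvgB.
apply: (cvg_trans _ L); apply: near_eq_cvg; apply: nearW => n /=.
rewrite -mulrBl; congr (_ / _); rewrite -sumrB; apply: eq_bigr => t _.
by rewrite -hE.
Qed.

End signed_slln.

Section log_bounds.
Context {R : realType} {d : measure_display} {XX : measurableType d} {N : nat}.
Local Notation state := 'I_N.+1.
Variables (p : 'M[R]_N.+1) (f : state -> XX -> R) (pi : state -> R).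
Hypothesis p_ge0 : forall i j, 0 <= p i j.
Hypothesis pi_ge0 : forall j, 0 <= pi j.
Hypothesis f_ge0 : forall j x, 0 <= f j x.

(** Dominates [ln (f j x)] for all states at once, so one function of the observation bounds the
    emissions of every path. *)
Definition logplus (x : XX) : R := \sum_j Num.max (ln (f j x)) 0.

Lemma logplus_ge0 x : 0 <= logplus x.
Proof. by apply: sumr_ge0 => j _; rewrite le_max lexx orbT. Qed.

Lemma ln_le_logplus j x : ln (f j x) <= logplus x.
Proof.
rewrite /logplus (bigD1 j)//=; apply: ler_wpDr; last by rewrite le_max lexx.
by apply: sumr_ge0 => i _; rewrite le_max lexx orbT.
Qed.

Lemma le_expR_logplus j x : f j x <= expR (logplus x).
Proof.
have [f0|f0] := ltP 0 (f j x); last exact: le_trans f0 (expR_ge0 _).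
by rewrite -[leLHS]lnK ?posrE// ler_expR ln_le_logplus.
Qed.

(** Forbidden transitions contribute [ln 0 = 0]; a path of positive weight uses none of them. *)
Definition jump_log_bound : R :=
  \sum_j `|ln (pi j)| + \sum_i \sum_j `|ln (p i j)|.

Lemma jump_log_bound_ge0 : 0 <= jump_log_bound.
Proof.
by rewrite addr_ge0// sumr_ge0// => i _; rewrite sumr_ge0.
Qed.

Lemma ln_jump_bound b i j : `|ln (jump p pi b i j)| <= jump_log_bound.
Proof.
have s1 : 0 <= \sum_j `|ln (pi j)| by rewrite sumr_ge0.
have s2 : 0 <= \sum_i \sum_j `|ln (p i j)|.
  by rewrite sumr_ge0// => l _; rewrite sumr_ge0.
case: b; rewrite /jump_log_bound /=.
  by apply: ler_wpDr => //; rewrite (bigD1 j)//= lerDl sumr_ge0.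
apply: ler_wpDl => //; rewrite (bigD1 i)//= (bigD1 j)//= -addrA lerDl.
by rewrite addr_ge0 ?sumr_ge0// => l _; rewrite sumr_ge0.
Qed.

Lemma ln_path_weight_bound bs i s : 0 < path_weight p pi bs i s ->
  `|ln (path_weight p pi bs i s)| <= (size bs)%:R * jump_log_bound.
Proof.
have h0 n : `|ln (1 : R)| <= n%:R * jump_log_bound.
  by rewrite ln1 normr0 mulr_ge0// jump_log_bound_ge0.
elim: bs i s => [|b bs IH] i [|j s] //= pos.
have pw0 : 0 <= path_weight p pi bs j s by exact: path_weight_ge0.
have j0 : 0 <= jump p pi b i j by exact: jump_ge0.
have jpos : 0 < jump p pi b i j.
  rewrite lt_neqAle j0 andbT; apply/eqP => e; by rewrite -e mul0r ltxx in pos.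
have wpos : 0 < path_weight p pi bs j s by rewrite pmulr_rgt0 in pos.
rewrite lnM ?posrE//; apply: (le_trans (ler_normD _ _)).
by rewrite -natr1 mulrDl mul1r addrC lerD// ?IH// ln_jump_bound.
Qed.

Lemma ln_emission s x : 0 < emission f s x ->
  ln (emission f s x) = \sum_(t < size s) ln (f (nth ord0 s t) (x t)).
Proof.
elim: s x => [|j s IH] x; first by rewrite /emission !big_ord0 ln1.
rewrite emission_cons => pos.
have e0 : 0 <= emission f s (fun t => x t.+1) by exact: emission_ge0.
have fpos : 0 < f j (x 0%N).
  rewrite lt_neqAle f_ge0 andbT; apply/eqP => e; by rewrite -e mul0r ltxx in pos.
have epos : 0 < emission f s (fun t => x t.+1) by rewrite pmulr_rgt0 in pos.
by rewrite lnM ?posrE// IH// big_ord_recl.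
Qed.

Lemma emission_le s x : emission f s x <= expR (\sum_(t < size s) logplus (x t)).
Proof.
rewrite expR_sum /emission; apply: ler_prod => t _.
by rewrite f_ge0 le_expR_logplus.
Qed.

Lemma measurable_logplus : (forall j, measurable_fun setT (f j)) ->
  measurable_fun setT logplus.
Proof.
move=> mf; apply: measurable_sum => j; apply: measurable_maxr => //.
exact: (measurableT_comp (@measurable_ln R) (mf j)).
Qed.

End log_bounds.

Section hmm_integrability.
Context d (Omega : measurableType d) (R : realType) (P : probability Omega R).
Context d' (XX : measurableType d') (mu : {sigma_finite_measure set XX -> \bar R}).
Variables (N : nat).
Local Notation state := 'I_N.+1.
Variables (X : nat -> Omega -> XX) (Y : nat -> Omega -> state).
Variables (p : 'M[R]_N.+1) (f : state -> XX -> R) (Pe : state -> probability XX R).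
Hypothesis hHMM : ergodic_HMM P mu X Y p f Pe.
Hypothesis hint : forall s, (Pe s).-integrable setT (fun x => lne (f s x)%:E).

Local Notation pi := (initial P Y).
Local Notation lk n := (seglik p f pi n).

Definition joint_process t (w : Omega) : XX * state := (X t w, Y t w).

Local Notation XY := joint_process.

Lemma measurable_ln_density j : measurable_fun setT (fun x => ln (f j x)).
Proof. exact: (measurableT_comp (@measurable_ln R) (hmm_mf hHMM j)). Qed.

Lemma abs_ln_density_lty j : (\int[Pe j]_x `|ln (f j x)|%:E < +oo)%E.
Proof.
have /integrableP[mlne] := hint j; apply: le_lt_trans.
apply: ge0_le_integral => //; last first.
- move=> x _; have [fx|fx] := ltP 0 (f j x); first by rewrite lne_EFin.
  by rewrite ln0// normr0 abse_ge0.
- exact: measurableT_comp.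
- by apply/measurable_EFinP; apply: measurableT_comp => //; exact: measurable_ln_density.
Qed.

(** The integrand times [f j] is at most [|ln f_j| f_j + |ln f_s| f_s]: where [f_s <= f_j] the
    logarithm is bounded by [|ln f_j|], elsewhere the weight [f_j] is below [f_s]. *)
Lemma ln_max_density_lty s j : (\int[Pe j]_x (Num.max (ln (f s x)) 0)%:E < +oo)%E.
Proof.
have f0 := hmm_f_ge0 hHMM.
have mln := measurable_ln_density.
have mabs i : measurable_fun setT (fun x => `|ln (f i x)|).
  by apply: measurableT_comp => //; exact: mln.
have mm : measurable_fun setT (fun x => Num.max (ln (f s x)) 0).
  by apply: measurable_maxr => //; exact: mln.
have dens i (u : XX -> R) : measurable_fun setT u -> (forall x, 0 <= u x) ->
    (\int[Pe i]_x (u x)%:E = \int[mu]_x (u x * f i x)%:E)%E.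
  move=> mu' u0.
  rewrite (ge0_integral_density (hmm_mf hHMM i) (f0 i) (hmm_density hHMM i))//.
    exact/measurable_EFinP.
have m0 x : 0 <= Num.max (ln (f s x)) 0 by rewrite le_max lexx orbT.
rewrite (dens j _ mm m0).
have mabsf i : measurable_fun setT (fun x => `|ln (f i x)| * f i x).
  by apply: measurable_funM => //; exact: (hmm_mf hHMM).
apply: (@le_lt_trans _ _ (\int[mu]_x ((`|ln (f j x)| * f j x)%:E +
    (`|ln (f s x)| * f s x)%:E))%E).
  apply: ge0_le_integral => //.
  - by move=> x _; rewrite lee_fin mulr_ge0.
  - by apply/measurable_EFinP; apply: measurable_funM => //; exact: (hmm_mf hHMM).
  - by apply: emeasurable_funD; apply/measurable_EFinP.
  move=> x _; rewrite lee_fin.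
  have a0 i : 0 <= `|ln (f i x)| * f i x by rewrite mulr_ge0.
  have [sj|js] := leP (f s x) (f j x).
    apply: ler_wpDr => //; rewrite ler_wpM2r// ge_max normr_ge0 andbT.
    have [fs|fs] := ltP 0 (f s x); last by rewrite ln0.
    apply: le_trans (ler_norm _); rewrite ler_ln// posrE//.
    exact: lt_le_trans sj.
  apply: ler_wpDl => //; apply: ler_pM => //; last exact: ltW.
  by rewrite ge_max normr_ge0 ler_norm.
rewrite ge0_integralD//.
- by rewrite lte_add_pinfty// -dens// abs_ln_density_lty.
- by move=> x _; rewrite lee_fin mulr_ge0.
- exact/measurable_EFinP.
- by move=> x _; rewrite lee_fin mulr_ge0.
- exact/measurable_EFinP.
Qed.

Lemma time0_lty (u : XX -> state -> R) :
  (forall j, measurable_fun setT (u^~ j)) -> (forall x j, 0 <= u x j) ->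
  (forall j, \int[Pe j]_x (u x j)%:E < +oo)%E ->
  (\int[P]_w (u (X 0 w) (Y 0 w))%:E < +oo)%E.
Proof.
move=> mu' u0 uoo; rewrite (time0_expectation hHMM mu' u0).
apply: lte_sum_pinfty => j _; rewrite lte_mul_pinfty// lee_fin.
exact: initial_ge0.
Qed.

Lemma logplus_lty : (\int[P]_w (logplus f (X 0 w))%:E < +oo)%E.
Proof.
have mm j : measurable_fun setT (fun x => Num.max (ln (f j x)) 0).
  by apply: measurable_maxr => //; exact: measurable_ln_density.
apply: (time0_lty (u := fun x _ => logplus f x)).
- by move=> j; apply: measurable_logplus; exact: (hmm_mf hHMM).
- by move=> x _; exact: logplus_ge0.
move=> j; under eq_integral do rewrite -sumEFin.
rewrite ge0_integral_sum//.
- by apply: lte_sum_pinfty => s _; exact: ln_max_density_lty.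
- by move=> s; exact/measurable_EFinP.
- by move=> s x _; rewrite lee_fin le_max lexx orbT.
Qed.

Lemma abs_ln_true_density_lty : (\int[P]_w `|ln (f (Y 0 w) (X 0 w))|%:E < +oo)%E.
Proof.
apply: (time0_lty (u := fun x j => `|ln (f j x)|)) => //.
- by move=> j; apply: measurableT_comp => //; exact: measurable_ln_density.
- by move=> j; exact: abs_ln_density_lty.
Qed.

Variable S : nat -> Omega -> nat.
Hypothesis reg : regenerative P XY S.
Hypothesis prec : positive_recurrent P S.

(** Lets the regenerative strong law be applied to (X, Y) with means taken under [P] itself. *)
Lemma joint_stationary_version : stationary_version P P XY S XY S.
Proof. by split => //; exact: (hmm_stationary hHMM). Qed.

Local Notation stat := joint_stationary_version.

(* the two one-time functions that dominate all log-likelihoods *)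
Definition log_envelope (z : XX * state) : R :=
  logplus f z.1 + `|ln (f z.2 z.1)|.

Lemma log_envelope_ge0 z : 0 <= log_envelope z.
Proof. by rewrite addr_ge0// logplus_ge0. Qed.

Lemma measurable_state_fun (g : state -> XX -> R) :
  (forall j, measurable_fun setT (g j)) ->
  measurable_fun setT (fun z : XX * state => g z.2 z.1).
Proof.
move=> mg _ A mA; rewrite setTI.
rewrite (_ : _ @^-1` A = \bigcup_(j in @setT state)
    ((g j @^-1` A) `*` [set j])).
  apply: fin_bigcup_measurable => // j _; apply: measurableX => //.
  by rewrite -[X in measurable X]setTI; exact: mg.
apply/seteqP; split => [[x j] /= h|[x j] [i _ [/= h ji]]]; first by exists j.
by rewrite /= ji.
Qed.

Lemma measurable_log_envelope : measurable_fun setT log_envelope.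
Proof.
apply: measurable_funD.
  apply: (measurableT_comp (f := logplus f)) => //.
  by apply: measurable_logplus; exact: (hmm_mf hHMM).
apply: (measurable_state_fun (g := fun j x => `|ln (f j x)|)) => j.
by apply: measurableT_comp => //; exact: measurable_ln_density.
Qed.

Lemma measurable_joint_process t : measurable_fun setT (XY t).
Proof. by case: reg => -[]. Qed.

Lemma log_envelope_lty t : (\int[P]_w (log_envelope (XY t w))%:E < +oo)%E.
Proof.
have mf : measurable_fun setT
    ((fun y => (log_envelope (y 0%N))%:E) : seqspace (XX * state)%type -> \bar R).
  apply/measurable_EFinP.
  exact: (measurableT_comp measurable_log_envelope (measurable_coord 0)).
have := stationary_mean stat t mf (fun y => log_envelope_ge0 _).
rewrite /process_path addn0 => ->.
under eq_integral do rewrite EFinD.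
rewrite ge0_integralD//.
- by rewrite lte_add_pinfty// ?logplus_lty// abs_ln_true_density_lty.
- by move=> w _; rewrite lee_fin logplus_ge0.
- apply/measurable_EFinP; apply: (measurableT_comp (f := logplus f)) => //.
    by apply: measurable_logplus; exact: (hmm_mf hHMM).
  exact: (hmm_mX hHMM).
- apply/measurable_EFinP.
  apply: (measurableT_comp (f := fun z : XX * state => `|ln (f z.2 z.1)|)
    (g := XY 0)); last exact: measurable_joint_process.
  apply: (measurable_state_fun (g := fun j x => `|ln (f j x)|)) => j.
  by apply: measurableT_comp => //; exact: measurable_ln_density.
Qed.

(** The states are ignored; they are carried along because the strong law applies to functions of
    the path of the regenerative process (X, Y). *)
Definition loglik k (y : nat -> XX * state) : R := ln (lk k (fun t => (y t).1)).

Lemma measurable_loglik k :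
  measurable_fun setT (loglik k : seqspace (XX * state)%type -> R).
Proof.
apply: (measurableT_comp (@measurable_ln R)).
apply: (measurableT_comp (f := lk k : seqspace XX -> R)).
  by apply: measurable_mixlik; exact: (hmm_mf hHMM).
apply: measurable_fun_seq => t.
exact: (measurableT_comp measurable_fst (measurable_coord t)).
Qed.

Lemma loglik_window k x y : (forall i, (i < k)%N -> x i = y i) ->
  loglik k x = loglik k y.
Proof.
move=> xy; rewrite /loglik /seglik; congr ln; apply: mixlik_ext => t.
by rewrite size_block => tk; rewrite xy.
Qed.

Lemma seglik_le_expR k (x : nat -> XX) :
  lk k x <= expR (\sum_(t < k) logplus f (x t)).
Proof.
rewrite /seglik (mixlikE _ _ _ _ _ (size_block k)).
rewrite -[leRHS]mul1r -(sum_path_weight hHMM ord0 (size_block k)) mulr_suml.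
apply: ler_sum => s _; rewrite ler_wpM2l ?(path_weight_nonneg hHMM)//.
have := emission_le (hmm_f_ge0 hHMM) s x.
by rewrite size_tuple.
Qed.

Lemma true_path_log_bound : {ae P, forall w k,
  - (k%:R * jump_log_bound p pi + \sum_(t < k) log_envelope (XY t w)) <=
  ln (path_weight p pi (block k) ord0 (Yn Y k w) * emission f (Yn Y k w) (X^~ w))}.
Proof.
apply: filterS (true_path_likelihood_gt0 hHMM) => w pos k.
have pw0 := path_weight_nonneg hHMM (block k) ord0 (Yn Y k w).
have em0 := emission_nonneg hHMM (Yn Y k w) (X^~ w).
have ppos : 0 < path_weight p pi (block k) ord0 (Yn Y k w).
  rewrite lt_neqAle pw0 andbT; apply/eqP => e.
  by have := pos k; rewrite -e mul0r ltxx.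
have epos : 0 < emission f (Yn Y k w) (X^~ w).
  rewrite lt_neqAle em0 andbT; apply/eqP => e.
  by have := pos k; rewrite -e mulr0 ltxx.
rewrite lnM ?posrE// opprD lerD//.
  have := ln_path_weight_bound (hmm_p_ge0 hHMM) (initial_ge0 P Y) ppos.
  by rewrite size_block ler_norml => /andP[].
rewrite ln_emission//; last exact: (hmm_f_ge0 hHMM).
rewrite size_tuple -sumrN; apply: ler_sum => t _.
have -> : nth ord0 (Yn Y k w) t = Y t w by rewrite -tnth_nth tnth_mktuple.
rewrite /log_envelope /= lerNl.
apply: ler_wpDl; first exact: logplus_ge0.
by rewrite -normrN ler_norm.
Qed.

(** From below the likelihood is at least the term of the true path; from above it is an average,
    with weights of sum 1, of emissions bounded through [logplus]. *)
Lemma abs_loglik_bound : {ae P, forall w k,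
  `|loglik k (process_path XY w 0)| <=
  k%:R * jump_log_bound p pi + \sum_(t < k) log_envelope (XY t w)}.
Proof.
apply: filterS3 true_path_log_bound (true_path_likelihood_gt0 hHMM)
  (seglik_gt0 hHMM) => w b1 pos lpos k.
have D0 : 0 <= k%:R * jump_log_bound p pi by rewrite mulr_ge0// jump_log_bound_ge0.
have -> : loglik k (process_path XY w 0) = ln (lk k (X^~ w)) by [].
rewrite ler_norml; apply/andP; split.
  apply: (le_trans (b1 k)); rewrite ler_ln ?posrE; [|exact: pos|exact: lpos].
  apply: path_le_mixlik; rewrite ?size_block ?size_tuple//.
  - exact: (hmm_p_ge0 hHMM).
  - exact: initial_ge0.
  - exact: (hmm_f_ge0 hHMM).
apply: (@le_trans _ _ (\sum_(t < k) logplus f (X t w))).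
  rewrite -[leRHS]expRK ler_ln; [exact: seglik_le_expR|exact: lpos|].
  by rewrite posrE expR_gt0.
apply: ler_wpDl => //; apply: ler_sum => t _.
by rewrite /log_envelope /= lerDl.
Qed.

Lemma loglik_integrable k :
  P.-integrable setT (fun w => (loglik k (process_path XY w 0))%:E).
Proof.
have mh : measurable_fun setT (fun w => loglik k (process_path XY w 0)).
  exact: (measurableT_comp (measurable_loglik k) (measurable_process_path stat 0)).
have me t : measurable_fun setT (fun w => log_envelope (XY t w)).
  exact: (measurableT_comp measurable_log_envelope (measurable_joint_process t)).
apply/integrableP; split; first exact/measurable_EFinP.
apply: (@le_lt_trans _ _ (\int[P]_w ((k%:R * jump_log_bound p pi)%:E +
    \sum_(t < k) (log_envelope (XY t w))%:E))%E).
  apply: ae_ge0_le_integral => //.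
  - by apply: measurableT_comp => //; exact/measurable_EFinP.
  - move=> w _; rewrite sumEFin lee_fin addr_ge0//.
      by rewrite mulr_ge0// jump_log_bound_ge0.
    by rewrite sumr_ge0// => t _; exact: log_envelope_ge0.
  - apply: emeasurable_funD => //.
    by apply: emeasurable_sum => t; exact/measurable_EFinP.
  apply: filterS abs_loglik_bound => w h _.
  by rewrite sumEFin lee_fin h.
rewrite ge0_integralD//.
- rewrite lte_add_pinfty//.
    by rewrite integral_cst// [X in (_ * X)%E](probability_setT P) mule1 ltry.
  rewrite ge0_integral_sum//.
  + by apply: lte_sum_pinfty => t _; exact: log_envelope_lty.
  + by move=> t; exact/measurable_EFinP.
  + by move=> t w _; rewrite lee_fin log_envelope_ge0.
- by move=> w _; rewrite lee_fin mulr_ge0// jump_log_bound_ge0.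
- by move=> w _; rewrite sumEFin lee_fin sumr_ge0// => t _; exact: log_envelope_ge0.
- by apply: emeasurable_sum => t; exact/measurable_EFinP.
Qed.

Definition mean_loglik k := Rintegral P setT (fun w => loglik k (process_path XY w 0)).

Lemma loglik_slln k : {ae P, forall w,
  (fun n => (\sum_(t < n) loglik k (process_path XY w t)) / n%:R) @ \oo -->
  mean_loglik k}.
Proof.
exact: (regenerative_slln_signed reg prec stat (measurable_loglik k)
  (@loglik_window k) (loglik_integrable k)).
Qed.

(** Needed for the incomplete blocks: convergence of these averages makes any bounded number of last
    terms o(n). *)
Lemma abs_loglik_slln k : {ae P, forall w,
  (fun n => (\sum_(t < n) `|loglik k (process_path XY w t)|) / n%:R) @ \oo -->
  Rintegral P setT (fun w => `|loglik k (process_path XY w 0)|)}.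
Proof.
apply: (regenerative_slln reg prec stat (h := fun y => `|loglik k y|) (K := k)).
- by apply: measurableT_comp => //; exact: measurable_loglik.
- by [].
- by move=> x y /loglik_window ->.
have /integrableP[_] := loglik_integrable k.
by [].
Qed.

Lemma envelope_slln : {ae P, forall w,
  (fun n => (\sum_(t < n) log_envelope (XY t w)) / n%:R) @ \oo -->
  Rintegral P setT (fun w => log_envelope (XY 0 w))}.
Proof.
have := regenerative_slln reg prec stat (h := fun y => log_envelope (y 0%N)) (K := 1)
  (measurableT_comp measurable_log_envelope (measurable_coord 0))
  (fun=> log_envelope_ge0 _)
  (fun x y xy => congr1 log_envelope (xy 0%N isT)) (log_envelope_lty 0).
by apply: filterS => w; under eq_fun do under eq_bigr do rewrite /process_path addn0.
Qed.

(* The likelihood ratio has expectation at most 1, so [b ^+ n] times it is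
   summable in expectation. *)
Lemma likelihood_ratio_bound (b : R) (sg : nat -> seq nat) :
  0 < b < 1 -> (forall n, sumn (sg n) = n) ->
  {ae P, forall w, \forall n \near \oo,
    ln (mixlik p f pi (block_flags (sg n)) ord0 (X^~ w)) <=
    loglik n (process_path XY w 0) - n%:R * ln b}.
Proof.
move=> /andP[b0 b1] sgn.
pose D n (x : nat -> XX) := mixlik p f pi (block_flags (sg n)) ord0 x.
pose r n (x : n.-tuple XX) := D n (nth point x) / lk n (nth point x).
have sbn n : size (block_flags (sg n)) = n by rewrite size_block_flags.
have D0 n x : 0 <= D n x by exact: (mixlik_nonneg hHMM).
have L0 n x : 0 <= lk n x by exact: (mixlik_nonneg hHMM).
have mD n : measurable_fun setT (fun x : n.-tuple XX => D n (nth point x)).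
  exact: (measurable_mixlik_tuple hHMM).
have mL n : measurable_fun setT (fun x : n.-tuple XX => lk n (nth point x)).
  exact: (measurable_mixlik_tuple hHMM).
have mr n : measurable_fun setT (r n).
  have mI := measurable_funV_ge0 (mL n) (fun x => L0 n (nth point x)).
  exact: (measurable_funM (mD n) mI).
have r0 n x : 0 <= r n x by rewrite divr_ge0.
have Er n : (\int[P]_w (r n (Xn X n w))%:E <= 1)%E.
  rewrite (expectation_Xn hHMM (mr n))//.
  rewrite -(integral_mixlik hHMM ord0 (sbn n)).
  apply: ge0_le_integral => //.
  - by move=> x _; rewrite lee_fin mulr_ge0.
  - by apply/measurable_EFinP; exact: (measurable_funM (mr n) (mL n)).
  - by apply/measurable_EFinP; exact: mD.
  move=> x _; rewrite lee_fin /r.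
  (* Where the likelihood vanishes the ratio is 0, as [0^-1 = 0]; hence an inequality rather than an
     equality. *)
  have := L0 n (nth point x); rewrite le_eqVlt => /predU1P[<-|Lpos].
    by rewrite mulr0; exact: D0.
  by rewrite divfK// gt_eqF.
have mrX n : measurable_fun setT (fun w => r n (Xn X n w)).
  exact: (measurableT_comp (mr n) (measurable_Xn hHMM (n := n))).
have : {ae P, forall w, (fun n => b ^+ n * r n (Xn X n w)) @ \oo --> (0 : R)}.
  apply: (ae_cvg0_of_summable_integrals (P := P)
    (f := fun n w => b ^+ n * r n (Xn X n w))).
  - by move=> n; apply: measurable_funM.
  - by move=> n w; rewrite mulr_ge0// exprn_ge0// ltW.
  have le n : (\int[P]_w (b ^+ n * r n (Xn X n w))%:E <= (b ^+ n)%:E)%E.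
    under eq_integral do rewrite EFinM.
    rewrite ge0_integralZl_EFin//.
    + by rewrite -[leRHS]mule1 lee_wpmul2l// lee_fin exprn_ge0// ltW.
    + by move=> w _; rewrite lee_fin.
    + exact/measurable_EFinP.
    + by rewrite exprn_ge0// ltW.
  apply: (@le_lt_trans _ _ (\sum_(n <oo) (b ^+ n)%:E)%E).
    apply: lee_nneseries => // n _ _; apply: integral_ge0 => w _.
    by rewrite lee_fin mulr_ge0// exprn_ge0// ltW.
  apply: (@le_lt_trans _ _ ((1 - b)^-1)%:E); last exact: ltry.
  apply: lime_le.
    by apply: is_cvg_nneseries => n _ _; rewrite lee_fin exprn_ge0// ltW.
  apply: nearW => n; rewrite sumEFin lee_fin big_mkord.
  by apply: geometric_sum_le; rewrite (ltW b0).
apply: filterS2 (seglik_gt0 hHMM) => w Lpos /cvgr_lt/(_ 1 ltr01).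
apply: filterS => n; rewrite /r /D seglik_Xn mixlik_Xn ?sbn//.
have -> : loglik n (process_path XY w 0) = ln (lk n (X^~ w)) by [].
have [C C1 pC] := restart_constant hHMM.
have Dpos : 0 < mixlik p f pi (block_flags (sg n)) ord0 (X^~ w).
  apply: (block_likelihood_gt0 (hmm_p_ge0 hHMM) (initial_ge0 P Y) (hmm_f_ge0 hHMM) C1 pC).
  by rewrite sgn; exact: Lpos.
rewrite mulrA ltr_pdivrMr// mul1r => h.
have bn : 0 < b ^+ n by rewrite exprn_gt0.
have : ln (b ^+ n * mixlik p f pi (block_flags (sg n)) ord0 (X^~ w)) <= ln (lk n (X^~ w)).
  by rewrite ler_ln ?posrE ?mulr_gt0//; exact: ltW.
rewrite lnM ?posrE// lnXn// -mulr_natl; lra.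
Qed.

End hmm_integrability.

(** * Averaging over block decompositions *)

Section block_sums.
Context {R : realType}.
Implicit Types (u : nat -> nat -> R) (k o n : nat).

Fixpoint block_sum u a (sg : seq nat) : R :=
  if sg is k :: sg' then u a k + block_sum u (a + k) sg' else 0.

(* the blocks of length [k] with offset [o]; the last block has length < 2k *)
Definition offset_blocks k o n : seq nat :=
  if (n < k)%N then [:: n]
  else o :: rcons (nseq (n %/ k).-1 k) (n - o - (n %/ k).-1 * k)%N.

(** One full block fewer than [n %/ k] makes room for an offset below [k] and leaves a remainder
    below [2 * k]. *)
Lemma divn_pred_bound k n : (0 < k)%N -> (k <= n)%N ->
  ((n %/ k).-1 * k + k <= n)%N /\ (n < (n %/ k).-1 * k + 2 * k)%N.
Proof.
move=> k0 kn; have := divn_eq n k; have := ltn_pmod n k0.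
have q0 : (0 < n %/ k)%N by rewrite divn_gt0.
by case: (n %/ k)%N q0 => //= q _; rewrite mulSn; lia.
Qed.

Lemma sumn_offset_blocks k o n : (o < k)%N -> sumn (offset_blocks k o n) = n.
Proof.
move=> ok; rewrite /offset_blocks; case: ltnP => kn /=; first by rewrite addn0.
have [h1 h2] := @divn_pred_bound k n (leq_ltn_trans (leq0n _) ok) kn.
rewrite sumn_rcons; have -> m : sumn (nseq m k) = (m * k)%N.
  by elim: m => //= m ->; rewrite mulSn.
by lia.
Qed.

Lemma size_offset_blocks k o n : (k <= n)%N ->
  size (offset_blocks k o n) = ((n %/ k).-1 + 2)%N.
Proof.
move=> kn; rewrite /offset_blocks ltnNge kn /= size_rcons size_nseq; lia.
Qed.

Lemma block_sum_rcons_nseq u a j k e :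
  block_sum u a (rcons (nseq j k) e) =
  \sum_(i < j) u (a + i * k)%N k + u (a + j * k)%N e.
Proof.
elim: j a => [|j IH] a /=; first by rewrite big_ord0 mul0n addn0 add0r addr0.
rewrite IH big_ord_recl/= mul0n addn0 -addrA; congr (_ + (_ + _)).
  by apply: eq_bigr => i _; congr u; rewrite /bump/= mulnDl mul1n; lia.
by congr u; rewrite mulSn; lia.
Qed.

Lemma big_ord_mul (g : nat -> R) k j :
  \sum_(o < k) \sum_(i < j) g (o + i * k)%N = \sum_(t < j * k) g t.
Proof.
elim: j => [|j IH].
  by rewrite mul0n big_ord0 big1// => o _; rewrite big_ord0.
under eq_bigr do rewrite big_ord_recr/=.
rewrite big_split/= IH mulSn addnC.
rewrite (big_ord_cat_nat g (leq_addr k (j * k))) addKn; congr (_ + _).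
by apply: eq_bigr => o _; rewrite addnC.
Qed.

Lemma sum_offset_block_sums u k n : (0 < k)%N -> (k <= n)%N ->
  \sum_(o < k) block_sum u 0 (offset_blocks k o n) =
  \sum_(o < k) u 0%N o + \sum_(t < (n %/ k).-1 * k) u t k +
  \sum_(o < k) u (o + (n %/ k).-1 * k)%N (n - o - (n %/ k).-1 * k)%N.
Proof.
move=> k0 kn; rewrite -(big_ord_mul (fun t => u t k)) -!big_split/=.
apply: eq_bigr => o _; rewrite /offset_blocks ltnNge kn /= block_sum_rcons_nseq.
by rewrite addrA.
Qed.

(** Consecutive sums, both divided by [n], have the same limit, so a single term is o(n). This
    serves incomplete blocks here and the current renewal cycle later. *)
Lemma cvg_last_term (b : nat -> R) (B : R) s :
  (fun n => (\sum_(t < n) b t) / n%:R) @ \oo --> B ->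
  (fun n => b (n - s)%N / n%:R) @ \oo --> (0 : R).
Proof.
move=> bB.
have h : (fun n => (\sum_(t < n.+1) b t) / n%:R - (\sum_(t < n) b t) / n%:R) @ \oo
    --> (0 : R).
  rewrite -[X in _ --> X](subrr B); apply: cvgB => //.
  exact: (cvg_average_shift 1 (u := fun n => \sum_(t < n) b t)).
move/cvgrPdist_le : h => h; apply/cvgrPdist_le => e e0.
have [M _ hM] := h e e0; exists (M + s).+1 => // n /= Mn.
have n0 : 0 < n%:R :> R by rewrite ltr0n; lia.
have m0 : 0 < (n - s)%:R :> R by rewrite ltr0n; lia.
have := hM (n - s)%N ltac:(rewrite /=; lia).
rewrite /= big_ord_recr/= mulrDl [_ + _ / _]addrC addrK !sub0r !normrN.
rewrite !normrM ![`|_^-1|]ger0_norm ?invr_ge0 ?(ltW n0) ?(ltW m0)//.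
rewrite !ler_pdivrMr// => /le_trans; apply; rewrite ler_wpM2l ?(ltW e0)//.
by rewrite ler_nat leq_subr.
Qed.

Lemma cvg0_sum_ord m (g : nat -> nat -> R) :
  (forall e, (fun n => g n e) @ \oo --> (0 : R)) ->
  (fun n => \sum_(e < m) g n e) @ \oo --> (0 : R).
Proof.
move=> h; elim: m => [|m IH].
  by under eq_fun do rewrite big_ord0; exact: cvg_cst.
under eq_fun do rewrite big_ord_recr/=.
have := cvgD IH (h m); rewrite addr0; exact.
Qed.

Variables (u : nat -> nat -> R) (v : nat -> R) (k : nat) (A c : R) (B : nat -> R).
Hypothesis k_gt0 : (0 < k)%N.
Hypothesis uA : (fun n => (\sum_(t < n) u t k) / n%:R) @ \oo --> A.
Hypothesis uB : forall m, (fun n => (\sum_(t < n) `|u t m|) / n%:R) @ \oo --> B m.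
Hypothesis v_lower : forall o, (o < k)%N -> forall dl, 0 < dl -> \forall n \near \oo,
  block_sum u 0 (offset_blocks k o n) <= v n + n%:R * dl.
Hypothesis c_ge0 : 0 <= c.
Hypothesis v_upper : forall o, (o < k)%N -> forall n, (k <= n)%N ->
  v n <= block_sum u 0 (offset_blocks k o n) + ((n %/ k).-1 + 2)%:R * c.

(** Three boundary effects: the first pieces of length [o]; the last pieces, whose lengths
    [e < 2 * k] vary with [n], so that each of the [k] offsets is charged the sum over all [e]; and
    the windows of length [k] started near the end, which the blocks omit. *)
Let err n : R := \sum_(o < k) `|u 0%N o| +
  (k%:R * \sum_(e < 2 * k) `|u (n - e)%N e| + \sum_(e < 2 * k) `|u (n - e.+1)%N k|).

Let err_cvg : (fun n => err n / n%:R) @ \oo --> (0 : R).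
Proof.
have h1 : (fun n => k%:R * \sum_(e < 2 * k) (`|u (n - e)%N e| / n%:R)) @ \oo --> (0 : R).
  rewrite -[X in _ --> X](mulr0 k%:R); apply: cvgM; first exact: cvg_cst.
  apply: (@cvg0_sum_ord (2 * k) (fun n e => `|u (n - e)%N e| / n%:R)) => e.
  have := @cvg_last_term (fun t => `|u t e|) _ e (@uB e); exact.
have h2 : (fun n => \sum_(e < 2 * k) (`|u (n - e.+1)%N k| / n%:R)) @ \oo --> (0 : R).
  apply: (@cvg0_sum_ord (2 * k) (fun n e => `|u (n - e.+1)%N k| / n%:R)) => e.
  have := @cvg_last_term (fun t => `|u t k|) _ e.+1 (@uB k); exact.
have h3 : (fun n => (\sum_(o < k) `|u 0%N o|) / n%:R +
    (k%:R * \sum_(e < 2 * k) (`|u (n - e)%N e| / n%:R) +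
     \sum_(e < 2 * k) (`|u (n - e.+1)%N k| / n%:R))) @ \oo --> (0 : R).
  rewrite -[X in _ --> X]addr0; apply: cvgD; first exact: cvg_cst_div_nat.
  by rewrite -[X in _ --> X]addr0; exact: cvgD.
apply: (cvg_trans _ h3); apply: near_eq_cvg; apply: nearW => n /=.
by rewrite /err !mulrDl -!mulr_suml mulrA.
Qed.

Let err_bound n : (k <= n)%N ->
  `|\sum_(o < k) block_sum u 0 (offset_blocks k o n) - \sum_(t < n) u t k| <= err n.
Proof.
move=> kn; rewrite sum_offset_block_sums//.
have [h1 h2] := @divn_pred_bound k n k_gt0 kn.
set j := (n %/ k).-1 in h1 h2 *.
have jn : (j * k <= n)%N by lia.
rewrite (big_ord_cat_nat (fun t => u t k) jn).
set a := \sum_(o < k) u 0%N o; set b := \sum_(t < j * k) u t k.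
set t1 := \sum_(o < k) _; set t2 := \sum_(i < n - j * k) _.
have -> : a + b + t1 - (b + t2) = a + (t1 - t2) by ring.
apply: (le_trans (ler_normD _ _)); rewrite /err; apply: lerD.
  exact: ler_norm_sum.
apply: (le_trans (ler_normB _ _)); apply: lerD.
  apply: (le_trans (ler_norm_sum _ _ _)).
  rewrite mulr_natl -[X in _ *+ X]card_ord -sumr_const; apply: ler_sum => o _.
  have ok := ltn_ord o.
  have e2 : (n - o - j * k < 2 * k)%N by lia.
  rewrite (bigD1 (Ordinal e2))//= (_ : (n - (n - o - j * k))%N = (o + j * k)%N); last by lia.
  by rewrite lerDl sumr_ge0.
apply: (le_trans (ler_norm_sum _ _ _)).
have m2 : (n - j * k <= 2 * k)%N by lia.
rewrite (big_ord_cat_nat (fun e => `|u (n - e.+1)%N k|) m2).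
apply: ler_wpDr; first by rewrite sumr_ge0.
rewrite (reindex_inj rev_ord_inj)/=; apply: ler_sum => i _.
by rewrite (_ : (j * k + (n - j * k - i.+1))%N = (n - i.+1)%N)//; have := ltn_ord i; lia.
Qed.

(* Averaging over the [k] offsets turns the block sums into the average of
   [u t k] over all times [t]. *)
Lemma block_sandwich e : 0 < e -> \forall n \near \oo,
  A / k%:R - e <= v n / n%:R <= A / k%:R + c / k%:R + e.
Proof.
move=> e0.
have k0 : 0 < k%:R :> R by rewrite ltr0n.
(* After multiplication by [k] each side collects three errors of size [k * dl * n], which must stay
   below [k * e * n]. *)
pose dl := e / 4.
have dl0 : 0 < dl by rewrite divr_gt0.
have low : \forall n \near \oo, forall o : 'I_k,
    block_sum u 0 (offset_blocks k o n) <= v n + n%:R * dl.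
  by apply: filter_forall => o; exact: v_lower.
have kdl0 : 0 < k%:R * dl by rewrite mulr_gt0.
have [N1 _ H1] := low.
have /cvgrPdist_le/(_ _ kdl0)[N2 _ H2] := uA.
have /cvgrPdist_le/(_ _ kdl0)[N3 _ H3] := err_cvg.
have /cvgrPdist_le/(_ _ kdl0)[N4 _ H4] := (cvg_cst_div_nat (k%:R * c)).
exists (maxn (maxn N1 N2) (maxn (maxn N3 N4) k.+1)) => // n /=.
rewrite !geq_max => /andP[/andP[n1 n2] /andP[/andP[n3 n4] nk]].
have n0 : 0 < n%:R :> R by rewrite ltr0n; lia.
have kn : (k <= n)%N by lia.
have := err_bound kn; rewrite ler_distl => /andP[B1 B2].
have := H2 _ n2; rewrite /= ler_distlC => /andP[].
rewrite ler_pdivrMr// ler_pdivlMr// => C1 C2.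
have := H3 _ n3; rewrite /= sub0r normrN => /(le_trans (ler_norm _)).
rewrite ler_pdivrMr// => E1.
have := H4 _ n4; rewrite /= sub0r normrN => /(le_trans (ler_norm _)).
rewrite ler_pdivrMr// => E2.
have L1 : \sum_(o < k) block_sum u 0 (offset_blocks k o n) <=
    k%:R * (v n + n%:R * dl).
  apply: (@le_trans _ _ (\sum_(o < k) (v n + n%:R * dl))).
    by apply: ler_sum => o _; exact: H1.
  by rewrite sumr_const card_ord -[leLHS]mulr_natl.
have [h1 h2] := @divn_pred_bound k n k_gt0 kn.
have j2 : k%:R * ((n %/ k).-1 + 2)%:R <= n%:R + k%:R :> R.
  by rewrite -natrM -natrD ler_nat (mulnC k) mulnDl mul2n -addnn addnA leq_add2r.
have U1 : k%:R * v n <= \sum_(o < k) block_sum u 0 (offset_blocks k o n) +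
    (n%:R + k%:R) * c.
  rewrite mulr_natl -[X in _ *+ X]card_ord -sumr_const.
  apply: (@le_trans _ _ (\sum_(o < k) (block_sum u 0 (offset_blocks k o n) +
      ((n %/ k).-1 + 2)%:R * c))).
    by apply: ler_sum => o _; exact: v_upper.
  rewrite big_split/= lerD2l sumr_const card_ord -[leLHS]mulr_natl mulrA.
  by rewrite ler_wpM2r.
apply/andP; split.
  rewrite ler_pdivlMr// -(ler_pM2l k0).
  rewrite (_ : k%:R * ((A / k%:R - e) * n%:R) = (A - k%:R * e) * n%:R); last first.
    by field; rewrite gt_eqF.
  have : k%:R * e * n%:R = 4 * (k%:R * dl) * n%:R by rewrite /dl; field.
  lra.
rewrite ler_pdivrMr// -(ler_pM2l k0).
rewrite (_ : k%:R * ((A / k%:R + c / k%:R + e) * n%:R) =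
  (A + c + k%:R * e) * n%:R); last by field; rewrite gt_eqF.
have : k%:R * e * n%:R = 4 * (k%:R * dl) * n%:R by rewrite /dl; field.
lra.
Qed.

End block_sums.

(** One sequence [v], sandwiched with block lengths [k] and [l], gives [a k / k <= a l / l + c / l].
    Hence [a k / k] lies at most [c / k] below the infimum of the right sides, and this infimum is
    the limit of every sequence that satisfies the sandwich, not only of the witness. *)
Lemma cvg_of_block_sandwich (R : realType) (a : nat -> R) (c : R) :
  0 <= c ->
  (exists v : nat -> R, forall k, (0 < k)%N -> forall e, 0 < e -> \forall n \near \oo,
    a k / k%:R - e <= v n / n%:R <= a k / k%:R + c / k%:R + e) ->
  exists g : R, (fun k => a k / k%:R) @ \oo --> g /\
    forall v : nat -> R,
    (forall k, (0 < k)%N -> forall e, 0 < e -> \forall n \near \oo,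
    a k / k%:R - e <= v n / n%:R <= a k / k%:R + c / k%:R + e) ->
    (fun n => v n / n%:R) @ \oo --> g.
Proof.
move=> c0 [v Hv].
have comp k l : (0 < k)%N -> (0 < l)%N -> a k / k%:R <= a l / l%:R + c / l%:R.
  move=> k0 l0; apply/ler_addgt0Pr => e e0.
  have e2 : 0 < e / 2 by rewrite divr_gt0.
  have [N1 _ H1] := Hv k k0 _ e2; have [N2 _ H2] := Hv l l0 _ e2.
  have /andP[L _] := H1 _ (leq_maxl N1 N2).
  have /andP[_ U] := H2 _ (leq_maxr N1 N2).
  move: L U => /=; lra.
pose E := [set a l.+1 / l.+1%:R + c / l.+1%:R | l in [set: nat]].
have E0 : has_inf E.
  split; first by exists (a 1%N / 1%:R + c / 1%:R), 0%N.
  by exists (a 1%N / 1%:R) => _ [l _ <-]; exact: comp.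
have lo k : (0 < k)%N -> inf E - c / k%:R <= a k / k%:R.
  case: k => // k _; rewrite lerBlDr; apply: ge_inf; first exact: E0.2.
  by exists k.
have hi k : (0 < k)%N -> a k / k%:R <= inf E.
  move=> k0; apply: lb_le_inf; first exact: E0.1.
  by move=> _ [l _ <-]; exact: comp.
exists (inf E); split.
  apply/cvgrPdist_le => e e0.
  have /cvgrPdist_le/(_ _ e0)[M _ hM] := (cvg_cst_div_nat c).
  exists M.+1 => // n /= Mn; have n0 : (0 < n)%N by lia.
  have := hM n ltac:(rewrite /=; lia); rewrite /= sub0r normrN => /(le_trans (ler_norm _)).
  by have := lo n n0; have := hi n n0; rewrite ler_distlC; lra.
move=> v' Hv'; apply/cvgrPdist_le => e e0.
have e2 : 0 < e / 2 by rewrite divr_gt0.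
have /cvgrPdist_le/(_ _ e2)[M _ hM] := (cvg_cst_div_nat c).
have [N _ hN] := Hv' M.+1 isT _ e2.
exists N => // n /hN /= /andP[].
have := hM M.+1 (leqnSn M); rewrite /= sub0r normrN => /(le_trans (ler_norm _)).
have := lo M.+1 isT; have := hi M.+1 isT; rewrite ler_distlC.
move: (a M.+1 / _) (c / _) (v' n / _) => q1 q2 q3; lra.
Qed.

(** A deterministic statement that follows from an almost sure event can be read off at a single
    sample point. *)
Lemma ae_exists d (T : measurableType d) (R : realType) (P : probability T R)
    (A : T -> Prop) : {ae P, forall w, A w} -> exists w, A w.
Proof.
move=> [B [mB B0 AB]]; apply: contrapT => nA.
have BT : B = setT.
  by apply/seteqP; split => // w _; apply: AB => Aw; apply: nA; exists w.
move: B0; rewrite BT [X in X = _](probability_setT P) => /eqP.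
by rewrite onee_eq0.
Qed.

Lemma measurable_lne_EFin d (T : measurableType d) (R : realType) (g : T -> R) :
  measurable_fun setT g -> measurable_fun setT (fun x => lne (g x)%:E).
Proof.
move=> mg; rewrite (_ : (fun x => _) =
  fun x => if 0 < g x then (ln (g x))%:E else -oo%E); last first.
  by apply/funext => x; case: ltP => g0; [rewrite lne_EFin|rewrite le0_lneNy].
apply: measurable_fun_ifT => //.
  exact: measurable_fun_ltr.
by apply/measurable_EFinP; exact: (measurableT_comp (@measurable_ln R) mg).
Qed.

Section entropy.
Context d (Omega : measurableType d) (R : realType) (P : probability Omega R).
Context d' (XX : measurableType d') (mu : {sigma_finite_measure set XX -> \bar R}).
Variables (N : nat).
Local Notation state := 'I_N.+1.
Variables (X : nat -> Omega -> XX) (Y : nat -> Omega -> state).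
Variables (p : 'M[R]_N.+1) (f : state -> XX -> R) (Pe : state -> probability XX R).
Hypothesis hHMM : ergodic_HMM P mu X Y p f Pe.
Hypothesis hint : forall s, (Pe s).-integrable setT (fun x => lne (f s x)%:E).
Variable S : nat -> Omega -> nat.
Hypothesis reg : regenerative P (joint_process X Y) S.
Hypothesis prec : positive_recurrent P S.

Local Notation pi := (initial P Y).
Local Notation lk n := (seglik p f pi n).
Local Notation XY := (joint_process X Y).
Local Notation ll := (loglik P Y p f).

(** The likelihood up to time [a + k] is at most a constant times the product for the blocks
    [[:: a; k]], so this product is positive, and with it its second factor. *)
Lemma windows_gt0 (x : nat -> XX) : (forall n, 0 < lk n x) ->
  forall a k, 0 < lk k (fun t => x (a + t)%N).
Proof.
move=> xpos a k; have [C C1 pC] := restart_constant hHMM.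
have := @block_likelihood_gt0 _ _ _ _ p f pi (hmm_p_ge0 hHMM) (initial_ge0 P Y)
  (hmm_f_ge0 hHMM) C C1 pC [:: a; k] x.
rewrite !block_likelihood_cons/= addn0 => /(_ (xpos _)).
by rewrite mulr1 pmulr_rgt0.
Qed.

Lemma ln_block_likelihood (x : nat -> XX) a sg : (forall n, 0 < lk n x) ->
  ln (mixlik p f pi (block_flags sg) ord0 (fun t => x (a + t)%N)) =
  block_sum (fun b k => ln (lk k (fun t => x (b + t)%N))) a sg.
Proof.
move=> xpos; have [C C1 pC] := restart_constant hHMM.
elim: sg a => [|k sg IH] a /=; first by rewrite ln1.
rewrite block_likelihood_cons.
have sh : (fun t => x (a + (k + t))%N) = (fun t => x (a + k + t)%N).
  by apply/funext => t; rewrite addnA.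
rewrite sh lnM ?posrE ?IH//; first exact: windows_gt0.
apply: (block_likelihood_gt0 (hmm_p_ge0 hHMM) (initial_ge0 P Y)
  (hmm_f_ge0 hHMM) C1 pC).
exact: windows_gt0.
Qed.

(** The fallback makes the lengths add up to [n] for every [o], so that the almost sure bound can be
    quantified over all natural numbers [k] and [o]. *)
Let cut k o n := if (o < k)%N then offset_blocks k o n else [:: n].

Let sumn_cut k o n : sumn (cut k o n) = n.
Proof.
by rewrite /cut; case: ifP => ok; [rewrite sumn_offset_blocks|rewrite /= addn0].
Qed.

Lemma loglik_average_cvg : exists2 g : R,
  (fun k => mean_loglik P X Y p f k / k%:R) @ \oo --> g &
  {ae P, forall w, (fun n => ll n (process_path XY w 0) / n%:R) @ \oo --> g}.
Proof.
have [C C1 pC] := restart_constant hHMM.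
(* Countably many bases with [- ln (b q) = 1 / q.+1], which gives arbitrarily small exponential
   rates on one almost sure event. *)
pose b q : R := expR (- (q.+1%:R)^-1).
have b01 q : 0 < b q < 1.
  by rewrite expR_gt0 expR_lt1 oppr_lt0 invr_gt0 ltr0n.
have low : {ae P, forall w, forall q k o, \forall n \near \oo,
    ln (mixlik p f pi (block_flags (cut k o n)) ord0 (X^~ w)) <=
    ll n (process_path XY w 0) - n%:R * ln (b q)}.
  apply/ae_foralln => q; apply/ae_foralln => k; apply/ae_foralln => o.
  exact: (likelihood_ratio_bound hHMM (b01 q) (sumn_cut k o)).
have avg : {ae P, forall w, forall k,
    (fun n => (\sum_(t < n) ll k (process_path XY w t)) / n%:R) @ \oo -->
    mean_loglik P X Y p f k}.
  by apply/ae_foralln => k; exact: (loglik_slln hHMM hint reg prec).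
have aavg : {ae P, forall w, forall k,
    (fun n => (\sum_(t < n) `|ll k (process_path XY w t)|) / n%:R) @ \oo -->
    Rintegral P setT (fun w => `|ll k (process_path XY w 0)|)}.
  by apply/ae_foralln => k; exact: (abs_loglik_slln hHMM hint reg prec).
have sandwich : {ae P, forall w, forall k, (0 < k)%N -> forall e, 0 < e ->
    \forall n \near \oo, mean_loglik P X Y p f k / k%:R - e <=
      ll n (process_path XY w 0) / n%:R <=
      mean_loglik P X Y p f k / k%:R + ln C / k%:R + e}.
  apply: filterS3 (filterI low (seglik_gt0 hHMM)) avg aavg => w [hl hp] ha haa k k0 e e0.
  have blocks sg : ln (mixlik p f pi (block_flags sg) ord0 (X^~ w)) =
      block_sum (fun a m => ll m (process_path XY w a)) 0 sg.
    exact: (ln_block_likelihood 0 sg hp).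
  apply: (@block_sandwich R (fun a m => ll m (process_path XY w a))
    (fun n => ll n (process_path XY w 0)) k _ (ln C) _ k0 (ha k) haa) => //.
  - move=> o ok dl dl0.
    pose q := Num.truncn (dl^-1).
    have : (q.+1%:R)^-1 <= dl.
      rewrite invf_ple ?posrE ?ltr0n//; apply/ltW; exact: truncnS_gt.
    move=> qdl; have := hl q k o; apply: filterS => n.
    rewrite /cut ok blocks /b expRK => /le_trans; apply.
    by rewrite mulrN opprK lerD2l ler_wpM2l.
  - exact: ln_ge0.
  move=> o ok n kn.
  have := seglik_le_blocks (hmm_p_ge0 hHMM) (initial_ge0 P Y) (hmm_f_ge0 hHMM) C1 pC
    (offset_blocks k o n) (X^~ w).
  rewrite sumn_offset_blocks// size_offset_blocks// => le.
  have C0 : 0 < C by exact: lt_le_trans C1.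
  have Bpos : 0 < mixlik p f pi (block_flags (offset_blocks k o n)) ord0 (X^~ w).
    apply: (block_likelihood_gt0 (hmm_p_ge0 hHMM) (initial_ge0 P Y)
      (hmm_f_ge0 hHMM) C1 pC).
    exact: hp.
  have : ln (lk n (X^~ w)) <= ln (C ^+ ((n %/ k).-1 + 2) *
      mixlik p f pi (block_flags (offset_blocks k o n)) ord0 (X^~ w)).
    by rewrite ler_ln ?posrE// mulr_gt0// exprn_gt0.
  rewrite lnM ?posrE ?exprn_gt0// lnXn// blocks addrC -[ln C *+ _]mulr_natl; exact.
(* The limit [g] depends only on the means, so one sample point produces it and all others share
   it. *)
have [w0 hw0] := ae_exists sandwich.
have [g [mg hg]] := @cvg_of_block_sandwich R (mean_loglik P X Y p f) (ln C) (ln_ge0 C1)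
  (ex_intro _ _ hw0).
by exists g => //; apply: filterS sandwich => w hw; exact: hg.
Qed.
Lemma entropy_rate_of_mean_loglik (lik : forall n, n.-tuple XX -> R) (g : R) :
  likelihood P mu X lik ->
  (fun k => mean_loglik P X Y p f k / k%:R) @ \oo --> g ->
  entropy_rate P X lik = (- g)%:E.
Proof.
move=> hlik hg; rewrite /entropy_rate.
have E n : (\int[P]_w lne (lik n (Xn X n w))%:E = (mean_loglik P X Y p f n)%:E)%E.
  have i := loglik_integrable hHMM hint reg n.
  rewrite /mean_loglik /Rintegral fineK; last exact: integrable_fin_num i.
  have [mlik _ _] := hlik n.
  apply: ae_eq_integral => //.
  - apply: measurable_lne_EFin.
    exact: (measurableT_comp mlik (measurable_Xn hHMM (n := n))).
  - by have /integrableP[] := i.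
  apply: filterS2 (likelihood_version hHMM n hlik) (seglik_gt0 hHMM).
  by move=> w -> pos _; rewrite lne_EFin.
under eq_fun do rewrite E -EFinM.
rewrite EFinN; congr (- _)%E; apply/cvg_lim => //.
apply: cvg_EFin; first exact: nearW.
by apply: cvg_trans hg; apply: near_eq_cvg; apply: nearW => n /=; rewrite mulrC.
Qed.

End entropy.

(** * Log-likelihood of the Viterbi path *)

Lemma cvg_average_delayed (R : realType) (a : nat -> R) (l : R) (q : nat -> nat) :
  (fun n => a n / n%:R) @ \oo --> l ->
  (fun n => (q n)%:R / n%:R) @ \oo --> (1 : R) ->
  (fun n => a (q n) / n%:R) @ \oo --> l.
Proof.
move=> al q1.
have qoo A : \forall n \near \oo, (A <= q n)%N.
  have h2 : 0 < 1 / 2 :> R by rewrite divr_gt0.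
  have /cvgrPdist_le/(_ _ h2)[M _ hM] := q1.
  exists (maxn M (2 * A).+1) => // n /=; rewrite geq_max => /andP[Mn An].
  have n0 : 0 < n%:R :> R by rewrite ltr0n; apply: leq_trans An.
  have := hM n Mn; rewrite /= ler_distlC => /andP[+ _].
  rewrite ler_pdivlMr// => h.
  have {}An : 2 * A%:R < n%:R :> R by rewrite -natrM ltr_nat.
  by rewrite -(ler_nat R); lra.
have qcvg : q @ \oo --> \oo by apply/cvgnyPge.
have L : (fun n => a (q n) / (q n)%:R * ((q n)%:R / n%:R)) @ \oo --> l * 1.
  by apply: cvgM => //; exact: (cvg_comp _ _ qcvg al).
rewrite mulr1 in L; apply: (cvg_trans _ L); apply: near_eq_cvg.
apply: filterS (qoo 1%N) => n q0 /=.
by rewrite mulrA divfK// pnatr_eq0 -lt0n.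
Qed.

Section renewal_delay.
Context d (Omega : measurableType d) (R : realType) (P : probability Omega R).
Context d' (T : measurableType d').
Variables (Z : nat -> Omega -> T) (S : nat -> Omega -> nat).
Hypothesis reg : regenerative P Z S.
Hypothesis prec : positive_recurrent P S.

(** For the last renewal with [S j + m <= n], the gap [n - S j] is at most [m] plus the length of
    cycle [j]. That length is o(j) by the strong law, and [j <= S j <= n]. *)
Lemma renewal_delay (m : nat) : {ae P, forall w, exists j : nat -> nat,
  (forall n, (S 0 w + m <= n)%N -> (S (j n) w + m <= n)%N) /\
  (fun n => (S (j n) w)%:R / n%:R) @ \oo --> (1 : R)}.
Proof.
have A := cycle_rv_slln reg (K := 0) (@measurable_fun1 R _ T) (fun=> ler01)
  (fun _ _ _ => erefl) (cycle_length_integrable Z prec).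
have [_ incr _ _] := reg.
apply: filterS2 A incr => w h incr.
have Sge i : (i <= S i w)%N.
  by elim: i => // i IH; exact: leq_ltn_trans IH (incr i).
have Sn : {homo S^~ w : i j / (i <= j)%N}.
  move=> i j ij; rewrite -(subnKC ij).
  exact: leq_trans (leq_addr _ _) (renewal_growth _ _ incr).
have /choice[j hj] : forall n, exists i, (S 0 w + m <= n)%N ->
    (S i w + m <= n < S i.+1 w + m)%N.
  move=> n; case: (leqP (S 0 w + m) n) => [sn|_]; last by exists 0%N.
  have [|i i1 i2] := @nat_interval_containing (fun i => S i w + m)%N n sn.
    by exists n.+1; apply: leq_trans (Sge n.+1) (leq_addr _ _).
  by exists i; rewrite i1 i2.
exists j; split; first by move=> n /hj /andP[].
have gap := @cvg_last_term R (fun i => cycle_rv Z S (fun=> 1 : R) i w) _ 0 h.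
apply/cvgrPdist_le => e e0.
have e2 : 0 < e / 2 by rewrite divr_gt0.
have /cvgrPdist_le/(_ _ e2)[J _ hJ] := gap.
have /cvgrPdist_le/(_ _ e2)[M _ hM] := cvg_cst_div_nat (m%:R : R).
exists (maxn M (S J.+1 w + m).+1) => // n /=; rewrite geq_max => /andP[Mn Sn'].
have n0 : 0 < n%:R :> R by rewrite ltr0n; apply: leq_trans Sn'.
have s0n : (S 0 w + m <= n)%N.
  by apply: leq_trans (ltnW Sn'); rewrite leq_add2r Sn.
have /andP[j1 j2] := hj n s0n.
have Jj : (J < j n)%N.
  rewrite ltnNge; apply/negP => jJ.
  have := Sn (j n).+1 J.+1 jJ; lia.
have j0 : 0 < (j n)%:R :> R by rewrite ltr0n; exact: leq_trans Jj.
have := hJ _ (ltnW Jj); rewrite /= subn0 cycle_rv_cst1 sub0r normrN.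
move=> /(le_trans (ler_norm _)); rewrite ler_pdivrMr// => g.
have := hM n Mn; rewrite /= sub0r normrN => /(le_trans (ler_norm _)).
rewrite ler_pdivrMr// => mn.
have jn : (j n)%:R <= n%:R :> R.
  by rewrite ler_nat; apply: leq_trans (Sge _) _; exact: leq_trans (leq_addr _ _) j1.
have Sjn : (S (j n) w)%:R <= n%:R :> R.
  by rewrite ler_nat; exact: leq_trans (leq_addr _ _) j1.
have gn : n%:R <= (S (j n).+1 w - S (j n) w)%:R + (S (j n) w)%:R + m%:R :> R.
  by rewrite -!natrD ler_nat; have := incr (j n); lia.
have ej : e / 2 * (j n)%:R <= e / 2 * n%:R by rewrite ler_wpM2l// ltW.
rewrite ler_distlC ler_pdivlMr// ler_pdivrMr//; apply/andP; split; last by nra.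
nra.
Qed.

End renewal_delay.

Section stationary_integral_le.
Context d (Omega : measurableType d) (R : realType) (P : probability Omega R).
Context d1 (Omega1 : measurableType d1) (P1 : probability Omega1 R).
Context d' (T : measurableType d').
Variables (Z : nat -> Omega -> T) (S : nat -> Omega -> nat).
Variables (Zs : nat -> Omega1 -> T) (Ss : nat -> Omega1 -> nat).
Hypothesis reg : regenerative P Z S.
Hypothesis prec : positive_recurrent P S.
Hypothesis stat : stationary_version P P1 Z S Zs Ss.

(* Bounding the averages along a random subsequence of times suffices, since
   the averages of the truncations of [h] converge. *)
Lemma stationary_integral_le (h : (nat -> T) -> R) (K : nat) (c : R) :
  measurable_fun setT (h : seqspace T -> R) -> (forall y, 0 <= h y) ->
  (forall x y, (forall i, (i < K)%N -> x i = y i) -> h x = h y) ->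
  {ae P, forall w, exists2 b : nat -> R, b @ \oo --> c &
    forall N, exists2 n, (N <= n)%N &
      (\sum_(t < n) h (process_path Z w t)) / n%:R <= b n} ->
  (\int[P1]_w (h (process_path Zs w 0))%:E <= c%:E)%E.
Proof.
move=> mh h0 hK H.
have mpath := measurable_process_path stat 0.
pose g M y := Num.min (h y) M%:R.
have mg M : measurable_fun setT (g M : seqspace T -> R).
  by apply: measurable_minr => //; exact: measurable_cst.
have g0 M y : 0 <= g M y by rewrite le_min h0 ler0n.
have gM M y : g M y <= M%:R by rewrite ge_min lexx orbT.
have gint M : (\int[P1]_w (g M (process_path Zs w 0))%:E < +oo)%E.
  apply: (@le_lt_trans _ _ (\int[P1]_w (M%:R%:E))%E).
    apply: ge0_le_integral => //.
    - by move=> w _; rewrite lee_fin.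
    - by apply/measurable_EFinP; exact: (measurableT_comp (mg M) mpath).
    - by move=> w _; rewrite lee_fin.
  by rewrite integral_cst// [X in (_ * X)%E](probability_setT P1) mule1 ltry.
have le_c M : (\int[P1]_w (g M (process_path Zs w 0))%:E <= c%:E)%E.
  have A := regenerative_slln reg prec stat (mg M) (g0 M) (K := K)
    ltac:(by move=> x y xy; rewrite /g (hK _ _ xy)) (gint M).
  (* At one sample point the averages converge to the truncated mean and fall, at arbitrarily late
     times, below a sequence tending to [c]; this settles the deterministic inequality. *)
  have [w [lim [b bc freq]]] := ae_exists (filterI A H).
  rewrite -[leLHS]fineK; last first.
    by rewrite ge0_fin_numE//; apply: integral_ge0 => ? _; rewrite lee_fin.
  rewrite lee_fin leNgt; apply/negP; rewrite -/(Rintegral P1 setT _).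
  set l := Rintegral _ _ _ in lim * => cl.
  have e0 : 0 < (l - c) / 3 by rewrite divr_gt0// subr_gt0.
  have /cvgrPdist_le/(_ _ e0)[N1 _ h1] := lim.
  have /cvgrPdist_le/(_ _ e0)[N2 _ h2] := bc.
  have [n Nn hn] := freq (maxn N1 N2).
  have := h1 n (leq_trans (leq_maxl _ _) Nn).
  have := h2 n (leq_trans (leq_maxr _ _) Nn).
  have : (\sum_(t < n) g M (process_path Z w t)) / n%:R <=
      (\sum_(t < n) h (process_path Z w t)) / n%:R.
    rewrite ler_wpM2r ?invr_ge0//; apply: ler_sum => t _.
    by rewrite ge_min lexx.
  rewrite /= !ler_distlC => ? /andP[_ ?] /andP[? _]; lra.
have mc := @cvg_monotone_convergence _ _ _ P1 setT measurableT
  (fun M w => (g M (process_path Zs w 0))%:E).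
have E : (fun w => limn (fun M => (g M (process_path Zs w 0))%:E)) =
    fun w => (h (process_path Zs w 0))%:E.
  apply/funext => w; apply/cvg_lim => //; apply: cvg_near_cst.
  exists (Num.truncn (h (process_path Zs w 0))).+1 => // M /= hM; congr EFin.
  rewrite /g; apply/min_idPl; apply: ltW; apply: lt_le_trans (truncnS_gt _) _.
  by rewrite ler_nat.
rewrite -E.
have {}mc := mc ltac:(by move=> M; apply/measurable_EFinP; exact: (measurableT_comp (mg M) mpath))
  ltac:(by move=> M w _; rewrite lee_fin)
  ltac:(by move=> w _ M M' MM'; rewrite lee_fin /g le_min ge_min lexx /= ge_min ler_nat MM' orbT).
rewrite -(cvg_lim _ mc)//; apply: lime_le; first by apply/cvg_ex; eexists; exact: mc.
exact: nearW.
Qed.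

End stationary_integral_le.

Section path_likelihood.
Context {R : realType} {d : measure_display} {XX : measurableType d} {N : nat}.
Local Notation state := 'I_N.+1.
Variables (p : 'M[R]_N.+1) (f : state -> XX -> R) (pi : state -> R).
Implicit Types (y : nat -> state) (x : nat -> XX).

(** Indexing the factor by its arrival time, on infinite sequences, lets the likelihoods of one path
    at different lengths be compared by splitting a product. *)
Definition step y t : R := if t is t'.+1 then p (y t') (y t) else pi (y 0%N).

Definition path_likelihood n y x : R := \prod_(t < n) (step y t * f (y t) (x t)).

Lemma path_weight_nseq n i (s : seq state) : size s = n ->
  path_weight p pi (nseq n false) i s =
  \prod_(t < n) p (nth ord0 (i :: s) t) (nth ord0 s t).
Proof.
elim: n i s => [|n IH] i [|j s] //=; first by rewrite big_ord0.
by move=> [sn]; rewrite big_ord_recl/= IH.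
Qed.

Lemma path_likelihoodE n (s : n.-tuple state) x :
  path_weight p pi (block n) ord0 s * emission f s x =
  path_likelihood n (nth ord0 s) x.
Proof.
rewrite /path_likelihood big_split/= /emission size_tuple; congr (_ * _).
case: n s => [|n] s; first by rewrite big_ord0 [s]tuple0.
rewrite big_ord_recl/=; case/tupleP: s => j s /=.
by rewrite path_weight_nseq ?size_tuple.
Qed.

Lemma path_likelihood_ext n y y' x : (forall t, (t < n)%N -> y t = y' t) ->
  path_likelihood n y x = path_likelihood n y' x.
Proof.
move=> yy'; apply: eq_bigr => -[[|t] tn] _ /=; first by rewrite yy'.
by rewrite !yy'// ltnW.
Qed.

Hypothesis p_ge0 : forall i j, 0 <= p i j.
Hypothesis p_le1 : forall i j, p i j <= 1.
Hypothesis pi_ge0 : forall j, 0 <= pi j.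
Hypothesis pi_le1 : forall j, pi j <= 1.
Hypothesis f_ge0 : forall j z, 0 <= f j z.

Lemma ln_step_le0 y t : ln (step y t) <= 0.
Proof. by apply: ln_le0; case: t => [|t] /=. Qed.

Lemma path_likelihood_factors_gt0 n y x : 0 < path_likelihood n y x ->
  forall t, (t < n)%N -> 0 < step y t /\ 0 < f (y t) (x t).
Proof.
move=> pos t tn.
have s0 : 0 <= step y t by case: t {tn} => [|t] /=.
have : step y t * f (y t) (x t) != 0.
  apply/eqP => e0; move: pos; rewrite /path_likelihood (bigD1 (Ordinal tn))//= e0.
  by rewrite mul0r ltxx.
by rewrite mulf_eq0 negb_or => /andP[sn fn]; rewrite !lt0r sn fn s0 f_ge0.
Qed.

Lemma ln_path_likelihood n y x :
  (forall t, (t < n)%N -> 0 < step y t /\ 0 < f (y t) (x t)) ->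
  0 < path_likelihood n y x /\
  ln (path_likelihood n y x) = \sum_(t < n) (ln (step y t) + ln (f (y t) (x t))).
Proof.
elim: n => [|n IH] H; first by rewrite /path_likelihood !big_ord0 ltr01 ln1.
have [|pos E] := IH; first by move=> t tn; apply: H; exact: ltnW.
have [s0 f0] := H n (ltnSn n).
have -> : path_likelihood n.+1 y x = path_likelihood n y x * (step y n * f (y n) (x n)).
  by rewrite /path_likelihood big_ord_recr.
by rewrite big_ord_recr/= -E !lnM ?posrE ?mulr_gt0.
Qed.

(** Every factor before [q] involves only states before [q], where the paths agree. After [q] the
    transitions contribute at most 0 and the emissions at most [logplus]. *)
Lemma ln_path_likelihood_le n q y y' x : (q <= n)%N ->
  0 < path_likelihood n y' x -> (forall t, (t < q)%N -> y' t = y t) ->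
  ln (path_likelihood n y' x) <=
  \sum_(t < q) (ln (step y t) + ln (f (y t) (x t))) +
  (\sum_(t < n) logplus f (x t) - \sum_(t < q) logplus f (x t)).
Proof.
move=> qn pos yy'.
have [_ ->] := ln_path_likelihood (path_likelihood_factors_gt0 pos).
rewrite (big_ord_cat_nat (fun t => ln (step y' t) + ln (f (y' t) (x t))) qn).
rewrite (big_ord_cat_nat (fun t => logplus f (x t)) qn) [X in _ + (X - _)]addrC addrK.
apply: lerD.
  rewrite le_eqVlt; apply/orP; left; apply/eqP; apply: eq_bigr => -[[|t] tq] _ /=.
    by rewrite yy'.
  by rewrite !yy'// ltnW.
apply: ler_sum => i _; rewrite -[leRHS]add0r; apply: lerD.
  exact: ln_step_le0.
exact: ln_le_logplus.
Qed.

(** The two sums differ by the initial factor and by the one transition that leaves the window. *)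
Lemma ln_step_sum_shift n y :
  `|\sum_(t < n) ln (step y t) - \sum_(t < n) ln (p (y t) (y t.+1))| <=
  2 * jump_log_bound p pi.
Proof.
case: n => [|n].
  by rewrite !big_ord0 subrr normr0 mulr_ge0// jump_log_bound_ge0.
have -> : \sum_(t < n.+1) ln (step y t) =
    ln (pi (y 0%N)) + \sum_(t < n) ln (p (y t) (y t.+1)) by rewrite big_ord_recl.
rewrite big_ord_recr/= [ln (pi _) + _]addrC opprD addrACA subrr add0r mulr_natl mulr2n.
apply: (le_trans (ler_normB _ _)); apply: lerD.
  exact: (ln_jump_bound p pi true ord0 (y 0%N)).
exact: (ln_jump_bound p pi false (y n) (y n.+1)).
Qed.

End path_likelihood.

Section viterbi_path.
Context d (Omega : measurableType d) (R : realType) (P : probability Omega R).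
Context d' (XX : measurableType d') (mu : {sigma_finite_measure set XX -> \bar R}).
Variables (N : nat).
Local Notation state := 'I_N.+1.
Variables (X : nat -> Omega -> XX) (Y : nat -> Omega -> state).
Variables (p : 'M[R]_N.+1) (f : state -> XX -> R) (Pe : state -> probability XX R).
Hypothesis hHMM : ergodic_HMM P mu X Y p f Pe.
Variable post : forall n, n.-tuple state -> n.-tuple XX -> R.
Hypothesis hpost : posterior P X Y post.
Variable v : forall n, n.-tuple XX -> n.-tuple state.
Hypothesis hv : Viterbi_alignment post v.
Variable vinf : (nat -> XX) -> nat -> state.
Hypothesis hvinf : infinite_Viterbi_alignment P X v vinf.

Local Notation pi := (initial P Y).
Local Notation lk n := (seglik p f pi n).
Local Notation Vi := (V X vinf).
Local Notation tv n w := ((tilde_V X v n)^~ w).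
Local Notation pl := (path_likelihood p f pi).

Lemma p_le1 i j : p i j <= 1.
Proof.
rewrite -(hmm_p_sum hHMM i) (bigD1 j)//= lerDl sumr_ge0// => l _.
exact: (hmm_p_ge0 hHMM).
Qed.

Lemma initial_le1 j : pi j <= 1.
Proof.
rewrite -(initial_sum hHMM) (bigD1 j)//= lerDl sumr_ge0// => i _.
exact: initial_ge0.
Qed.

Lemma posterior_of_path : {ae P, forall w n (s : n.-tuple state),
  post s (Xn X n w) = pl n (nth ord0 s) (X^~ w) / lk n (X^~ w)}.
Proof.
apply/ae_foralln => n; apply: filter_forall => s.
apply: filterS (posterior_version hHMM s hpost) => w ->.
by rewrite path_likelihoodE.
Qed.

(** For fixed observations the posterior is the joint likelihood divided by a positive number that
    does not depend on the path, so both have the same maximisers. Positivity is inherited from the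
    true path. *)
Lemma viterbi_path_optimal : {ae P, forall w n,
  0 < pl n (tv n w) (X^~ w) /\
  forall y, pl n y (X^~ w) <= pl n (tv n w) (X^~ w)}.
Proof.
apply: filterS3 posterior_of_path (seglik_gt0 hHMM) (true_path_likelihood_gt0 hHMM).
move=> w hp lpos ypos n.
have opt y : pl n y (X^~ w) <= pl n (tv n w) (X^~ w).
  have := (hv n).2 (Xn X n w) [tuple y i | i < n].
  rewrite !hp ler_pM2r ?invr_gt0//.
  rewrite (@path_likelihood_ext _ _ _ _ p f pi n (nth ord0 _) y)// => t tn.
  by rewrite -[t]/(nat_of_ord (Ordinal tn)) -tnth_nth tnth_mktuple.
split=> //; apply: lt_le_trans (opt (nth ord0 (Yn Y n w))).
by rewrite -path_likelihoodE.
Qed.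

(** Up to any time the infinite alignment is a prefix of some finite Viterbi path, all of whose
    factors are positive. *)
Lemma infinite_path_gt0 : {ae P, forall w t,
  0 < step p pi (Vi^~ w) t /\ 0 < f (Vi t w) (X t w)}.
Proof.
apply: filterS2 viterbi_path_optimal hvinf => w opt inf t.
have [n tn /(_ n (leqnn n)) E] := inf t.+1.
have [pos _] := opt n.
have := path_likelihood_factors_gt0 (hmm_p_ge0 hHMM) (initial_ge0 P Y)
  (hmm_f_ge0 hHMM) pos tn.
rewrite E//; suff -> : step p pi (tv n w) t = step p pi (Vi^~ w) t by [].
by case: t tn E => [|t] tn E /=; rewrite !E.
Qed.

End viterbi_path.

Lemma cvg_sum_fin (R : realType) (I : finType) (g : I -> nat -> R) (l : I -> R) :
  (forall i, g i @ \oo --> l i) ->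
  (fun n => \sum_i g i n) @ \oo --> \sum_i l i.
Proof. by move=> gl; apply: cvg_big => //; exact: add_continuous. Qed.

Section viterbi_averages.
Context d (Omega : measurableType d) (R : realType) (P : probability Omega R).
Context d' (XX : measurableType d') (mu : {sigma_finite_measure set XX -> \bar R}).
Variables (N : nat).
Local Notation state := 'I_N.+1.
Variables (X : nat -> Omega -> XX) (Y : nat -> Omega -> state).
Variables (p : 'M[R]_N.+1) (f : state -> XX -> R) (Pe : state -> probability XX R).
Hypothesis hHMM : ergodic_HMM P mu X Y p f Pe.
Hypothesis hint : forall s, (Pe s).-integrable setT (fun x => lne (f s x)%:E).
Variable post : forall n, n.-tuple state -> n.-tuple XX -> R.
Hypothesis hpost : posterior P X Y post.
Variable v : forall n, n.-tuple XX -> n.-tuple state.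
Hypothesis hv : Viterbi_alignment post v.
Variable vinf : (nat -> XX) -> nat -> state.
Hypothesis hvinf : infinite_Viterbi_alignment P X v vinf.
Variable S : nat -> Omega -> nat.
Context d1 (Omega1 : measurableType d1) (P1 : probability Omega1 R).
Variables (Xs : nat -> Omega1 -> XX) (Ys Vs : nat -> Omega1 -> state).
Variable Ss : nat -> Omega1 -> nat.

Local Notation pi := (initial P Y).
Local Notation lk n := (seglik p f pi n).
Local Notation Vi := (V X vinf).
Local Notation tv n w := ((tilde_V X v n)^~ w).
Local Notation pl := (path_likelihood p f pi).
Local Notation Z := (triple X Y Vi).
Local Notation Zs := (triple Xs Ys Vs).
Local Notation ZT := (XX * state * state)%type.
Local Notation env := (log_envelope f).

Hypothesis reg : regenerative P Z S.
Hypothesis prec : positive_recurrent P S.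
Hypothesis stat : stationary_version P P1 Z S Zs Ss.
Variable m : nat.
Hypothesis agree : {ae P, forall w j n, (S j w + m <= n)%N ->
  forall t, (t < S j w)%N -> tilde_V X v n t w = Vi t w}.

Lemma joint_regenerative : regenerative P (joint_process X Y) S.
Proof. exact: (regenerative_map (measurable_fst : measurable_fun setT (@fst (XX * state)%type state)) reg). Qed.

Lemma measurable_decoded_fun (g : state -> XX -> R) :
  (forall j, measurable_fun setT (g j)) ->
  measurable_fun setT ((fun y => g (y 0%N).2 (y 0%N).1.1) : seqspace ZT -> R).
Proof.
move=> mg.
have m0 := @measurable_coord _ ZT 0.
have m1 : measurable_fun setT ((fun y => ((y 0%N).1.1, (y 0%N).2)) : seqspace ZT -> XX * state).
  apply: measurable_fun_pair.
    exact: (measurableT_comp measurable_fst (measurableT_comp measurable_fst m0)).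
  exact: (measurableT_comp measurable_snd m0).
exact: (measurableT_comp (measurable_state_fun mg) m1).
Qed.

Lemma measurable_decoded_state t i :
  measurable_fun setT ((fun y => ((y t).2 == i)%:R) : seqspace ZT -> R).
Proof.
have ms : measurable_fun setT (fun j : state => (j == i)%:R : R) by [].
exact: (measurableT_comp ms (measurableT_comp measurable_snd (@measurable_coord _ ZT t))).
Qed.

Lemma measurable_stationary_triple t : measurable_fun setT (Zs t).
Proof. by have [[[mZ _] _ _ _] _ _] := stat. Qed.

Lemma measurable_stationary_X t : measurable_fun setT (Xs t).
Proof.
exact: (measurableT_comp measurable_fst (measurableT_comp measurable_fst
  (measurable_stationary_triple t))).
Qed.

Lemma measurable_stationary_V t : measurable_fun setT (Vs t).
Proof. exact: (measurableT_comp measurable_snd (measurable_stationary_triple t)). Qed.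

Lemma measurable_stationary_Vs t i : measurable [set w | Vs t w = i].
Proof.
rewrite (_ : [set w | _] = setT `&` Vs t @^-1` [set i]); last by rewrite setTI.
exact: measurable_stationary_V.
Qed.

Definition decoded_jump i j (y : nat -> ZT) : R :=
  ((y 0%N).2 == i)%:R * ((y 1%N).2 == j)%:R.

Lemma decoded_jump_integral i j :
  (\int[P1]_w (decoded_jump i j (process_path Zs w 0))%:E)%E =
  P1 [set w | Vs 0%N w = i /\ Vs 1%N w = j].
Proof.
have mE : measurable [set w | Vs 0%N w = i /\ Vs 1%N w = j].
  by apply: measurableI; exact: measurable_stationary_Vs.
have := integral_indic P1 measurableT mE; rewrite setIT => <-; apply: eq_integral => w _.
rewrite indicE /decoded_jump /process_path /= -natrM mulnb; congr (_%:R)%:E.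
congr nat_of_bool; apply/idP/idP; first by move=> /andP[/eqP ? /eqP ?]; rewrite inE.
by rewrite inE => -[-> ->]; rewrite !eqxx.
Qed.

Lemma measurable_decoded_jump i j :
  measurable_fun setT (decoded_jump i j : seqspace ZT -> R).
Proof.
exact: (measurable_funM (measurable_decoded_state 0 i) (measurable_decoded_state 1 j)).
Qed.

Lemma decoded_jump_ge0 i j y : 0 <= decoded_jump i j y.
Proof. by rewrite mulr_ge0. Qed.

Lemma decoded_jump_window i j x y : (forall t, (t < 2)%N -> x t = y t) ->
  decoded_jump i j x = decoded_jump i j y.
Proof. by move=> xy; rewrite /decoded_jump !xy. Qed.

(** The indicator of [f <= 0] vanishes all along [Z], so its averages are 0 and so is its stationary
    mean. *)
Lemma decoded_density_gt0 : {ae P1, forall w, 0 < f (Vs 0%N w) (Xs 0%N w)}.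
Proof.
have mf := hmm_mf hHMM.
pose g (s : state) (x : XX) : R := (f s x <= 0)%R%:R.
have mg s : measurable_fun setT (g s).
  have mb : measurable_fun setT (fun x => f s x <= 0).
    by apply: measurable_fun_ler => //; exact: measurable_cst.
  rewrite (_ : g s = fun x => if f s x <= 0 then 1 else 0); last first.
    by apply/funext => x; rewrite /g; case: leP.
  by apply: measurable_fun_ifT => //; exact: measurable_cst.
pose h (y : nat -> ZT) := g (y 0%N).2 (y 0%N).1.1.
have mh : measurable_fun setT (h : seqspace ZT -> R) by exact: measurable_decoded_fun.
have h0 y : 0 <= h y by rewrite ler0n.
have := stationary_integral_le reg prec stat (h := h) (K := 1) (c := 0) mh h0.
move=> /(_ (fun x y xy => congr1 (fun z : ZT => g z.2 z.1.1) (xy 0%N isT))).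
have H : {ae P, forall w, exists2 b : nat -> R, b @ \oo --> (0 : R) &
    forall N0, exists2 n, (N0 <= n)%N &
      (\sum_(t < n) h (process_path Z w t)) / n%:R <= b n}.
  apply: filterS (infinite_path_gt0 hHMM hpost hv hvinf) => w pos.
  exists (fun=> 0); first exact: cvg_cst.
  move=> n; exists n => //; rewrite big1 ?mul0r// => t _.
  rewrite /h /process_path addn0 /= /g leNgt.
  by have [_ ->] := pos t.
move=> /(_ H) le0.
have mpath := measurable_process_path stat 0.
have mhp : measurable_fun setT (fun w => (h (process_path Zs w 0))%:E).
  by apply/measurable_EFinP; exact: (measurableT_comp mh mpath).
have /(ae_eq_integral_abs P1 measurableT mhp) : (\int[P1]_w `|(h (process_path Zs w 0))%:E| = 0)%E.
  apply/eqP; rewrite eq_le; apply/andP; split; last exact: integral_ge0.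
  by under eq_integral do rewrite gee0_abs ?lee_fin//.
apply: filterS => w /(_ Logic.I); rewrite /h /process_path /= /g addn0.
by rewrite ltNge; case: (f _ _ <= 0) => // -[] /eqP; rewrite oner_eq0.
Qed.

(** The limit contains [lne 0], which is minus infinity; the term of a forbidden transition vanishes
    only because its stationary probability is exactly 0. *)
Lemma decoded_jump0 i j : p i j = 0 ->
  P1 [set w | Vs 0%N w = i /\ Vs 1%N w = j] = 0%E.
Proof.
move=> p0.
have := stationary_integral_le reg prec stat (c := 0)
  (measurable_decoded_jump i j) (decoded_jump_ge0 i j) (@decoded_jump_window i j).
have H : {ae P, forall w, exists2 b : nat -> R, b @ \oo --> (0 : R) &
    forall N0, exists2 n, (N0 <= n)%N &
      (\sum_(t < n) decoded_jump i j (process_path Z w t)) / n%:R <= b n}.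
  apply: filterS (infinite_path_gt0 hHMM hpost hv hvinf) => w pos.
  exists (fun=> 0); first exact: cvg_cst.
  move=> n; exists n => //; rewrite big1 ?mul0r// => t _.
  rewrite /decoded_jump /process_path addn0 addn1 /= -natrM mulnb.
  case: andP => // -[/eqP Vi0 /eqP Vj]; have [+ _] := pos t.+1.
  by rewrite /= Vi0 Vj p0 ltxx.
move=> /(_ H); rewrite decoded_jump_integral => h1.
by apply/eqP; rewrite -measure_le0.
Qed.

Lemma measurable_ln_decoded :
  measurable_fun setT ((fun y => ln (f (y 0%N).2 (y 0%N).1.1)) : seqspace ZT -> R).
Proof.
apply: (measurable_decoded_fun (g := fun j x => ln (f j x))) => j.
exact: (measurable_ln_density hHMM).
Qed.

Lemma measurable_decoded_logplus :
  measurable_fun setT ((fun y => logplus f (y 0%N).1.1) : seqspace ZT -> R).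
Proof.
apply: (measurable_decoded_fun (g := fun _ => logplus f)) => j.
by apply: measurable_logplus; exact: (hmm_mf hHMM).
Qed.

Let mean_env := Rintegral P setT (fun w => env (joint_process X Y 0 w)).

Let env_slln : {ae P, forall w,
  (fun n => (\sum_(t < n) env (joint_process X Y t w)) / n%:R) @ \oo --> mean_env}.
Proof. exact: (envelope_slln hHMM hint joint_regenerative prec). Qed.

Let logplus_le_env t w : logplus f (X t w) <= env (joint_process X Y t w).
Proof. by rewrite lerDl. Qed.

Lemma decoded_logplus_lty : (\int[P1]_w (logplus f (Xs 0%N w))%:E < +oo)%E.
Proof.
have := stationary_integral_le reg prec stat (c := mean_env) (K := 1)
  measurable_decoded_logplus (fun=> logplus_ge0 _ _)
  (fun x y xy => congr1 (fun z : ZT => logplus f z.1.1) (xy 0%N isT)).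
move=> H; apply: le_lt_trans (ltry mean_env); apply: H.
apply: filterS env_slln => w cv; eexists; first exact: cv.
move=> n; exists n => //; rewrite ler_wpM2r ?invr_ge0//.
by apply: ler_sum => t _; rewrite /process_path addn0; exact: logplus_le_env.
Qed.

(* The Viterbi path is at least as likely as the true path, whose
   log-likelihood is bounded below by integrable terms. *)
Lemma decoded_neglog_lty :
  (\int[P1]_w (Num.max (- ln (f (Vs 0%N w) (Xs 0%N w))) 0)%:E < +oo)%E.
Proof.
pose jb := jump_log_bound p pi.
pose h (y : nat -> ZT) := Num.max (- ln (f (y 0%N).2 (y 0%N).1.1)) 0.
have mh : measurable_fun setT (h : seqspace ZT -> R).
  apply: measurable_maxr => //.
  by apply: measurable_funN; exact: measurable_ln_decoded.
have h0 y : 0 <= h y by rewrite le_max lexx orbT.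
(* The constant: [jb] bounds the transitions of the true path, one [mean_env] its emissions, and the
   second one the positive parts along the decoded path. *)
have := stationary_integral_le reg prec stat (c := jb + 2 * mean_env) (K := 1) mh h0
  (fun x y xy => congr1 (fun z : ZT => Num.max (- ln (f z.2 z.1.1)) 0) (xy 0%N isT)).
move=> H; apply: le_lt_trans (ltry (jb + 2 * mean_env)); apply: H.
have [_ incr _ _] := reg.
apply: filterS3 (filterI env_slln agree) (filterI incr (viterbi_path_optimal hHMM hpost hv))
  (filterI (true_path_log_bound hHMM) (true_path_likelihood_gt0 hHMM)).
move=> w [cv ag] [{}incr opt] [low ypos].
have Sge i : (i <= S i w)%N.
  by elim: i => // i IH; exact: leq_ltn_trans IH (incr i).
pose E n := \sum_(t < n) env (joint_process X Y t w).
exists (fun n => ((m + n)%:R * jb + 2 * E (m + n)%N) / n%:R).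
  apply: (cvg_average_shift m (u := fun n => n%:R * jb + 2 * E n)).
  have one : (fun n => n%:R / n%:R : R) @ \oo --> (1 : R).
    apply: cvg_near_cst; exists 1%N => // n /= n0.
    by rewrite divff// pnatr_eq0 -lt0n.
  have L : (fun n => jb * (n%:R / n%:R) + 2 * (E n / n%:R)) @ \oo --> jb * 1 + 2 * mean_env.
    have cvE : (fun n => E n / n%:R) @ \oo --> mean_env by exact: cv.
    by apply: cvgD; apply: cvgMr.
  rewrite mulr1 in L; apply: (cvg_trans _ L); apply: near_eq_cvg; apply: nearW => n /=.
  by rewrite [RHS]mulrDl !mulrA [jb * _]mulrC.
(* The bound is available only at renewal times, where the alignment of length [m + S j] agrees with
   [V]; arbitrarily late times are enough. *)
move=> j; exists (S j w); first exact: Sge.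
set q := S j w; set n := (m + q)%N; rewrite ler_wpM2r ?invr_ge0//.
have [pos opt'] := opt n.
have lo : - (n%:R * jb + E n) <= ln (pl n (tv n w) (X^~ w)).
  apply: (le_trans (low n)); have := ypos n; rewrite path_likelihoodE => yp.
  by rewrite ler_ln ?posrE.
have up := ln_path_likelihood_le (hmm_p_ge0 hHMM) (p_le1 hHMM) (initial_ge0 P Y)
  (initial_le1 hHMM) (hmm_f_ge0 hHMM) (leq_addl m q) pos (y := Vi^~ w)
  (ag j n ltac:(by rewrite /n addnC)).
have st : \sum_(t < q) (ln (step p pi (Vi^~ w) t) + ln (f (Vi t w) (X t w))) <=
    - (\sum_(t < q) h (process_path Z w t)) + \sum_(t < q) logplus f (X t w).
  rewrite -sumrN -big_split/=; apply: ler_sum => t _; rewrite /h /process_path addn0 /=.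
  have s0 := ln_step_le0 (p_le1 hHMM) (initial_le1 hHMM) (Vi^~ w) t.
  have lp := ln_le_logplus f (Vi t w) (X t w).
  have lp0 := logplus_ge0 f (X t w).
  by case: (leP (- ln (f (Vi t w) (X t w))) 0) => ?; lra.
have le_env : \sum_(t < n) logplus f (X t w) <= E n by exact: ler_sum.
move: lo up st le_env; lra.
Qed.

Definition mean_ln_density := Rintegral P1 setT (fun w => ln (f (Vs 0%N w) (Xs 0%N w))).

Definition mean_ln_jump :=
  \sum_i \sum_j ln (p i j) * fine (P1 [set w | Vs 0%N w = i /\ Vs 1%N w = j]).

Lemma decoded_ln_integrable :
  P1.-integrable setT (fun w => (ln (f (Vs 0%N w) (Xs 0%N w)))%:E).
Proof.
have mpath := measurable_process_path stat 0.
have mln : measurable_fun setT (fun w => ln (f (Vs 0%N w) (Xs 0%N w))).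
  exact: (measurableT_comp measurable_ln_decoded mpath).
have mlp : measurable_fun setT (fun w => logplus f (Xs 0%N w)).
  exact: (measurableT_comp measurable_decoded_logplus mpath).
apply/integrableP; split; first exact/measurable_EFinP.
apply: (@le_lt_trans _ _ (\int[P1]_w ((logplus f (Xs 0%N w))%:E +
    (Num.max (- ln (f (Vs 0%N w) (Xs 0%N w))) 0)%:E))%E).
  apply: ge0_le_integral => //.
  - by apply: measurableT_comp => //; exact/measurable_EFinP.
  - apply: emeasurable_funD; apply/measurable_EFinP => //.
    by apply: measurable_maxr => //; exact: measurable_funN.
  move=> w _; rewrite lee_fin.
  have := ln_le_logplus f (Vs 0%N w) (Xs 0%N w); have := logplus_ge0 f (Xs 0%N w).
  by case: (leP (- ln (f (Vs 0%N w) (Xs 0%N w))) 0) => ? ? ?; rewrite ler_norml; lra.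
rewrite ge0_integralD//.
- by rewrite lte_add_pinfty// ?decoded_logplus_lty// decoded_neglog_lty.
- by move=> w _; rewrite lee_fin logplus_ge0.
- exact/measurable_EFinP.
- by move=> w _; rewrite lee_fin le_max lexx orbT.
- apply/measurable_EFinP; apply: measurable_maxr => //; exact: measurable_funN.
Qed.

Lemma ln_density_slln : {ae P, forall w,
  (fun n => (\sum_(t < n) ln (f (Vi t w) (X t w))) / n%:R) @ \oo --> mean_ln_density}.
Proof.
have := regenerative_slln_signed reg prec stat (K := 1) measurable_ln_decoded
  (fun x y xy => congr1 (fun z : ZT => ln (f z.2 z.1.1)) (xy 0%N isT))
  decoded_ln_integrable.
by apply: filterS => w; under eq_fun do under eq_bigr do rewrite /process_path addn0.
Qed.

Lemma logplus_slln : {ae P, forall w,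
  (fun n => (\sum_(t < n) logplus f (X t w)) / n%:R) @ \oo -->
  Rintegral P1 setT (fun w => logplus f (Xs 0%N w))}.
Proof.
have := regenerative_slln reg prec stat (K := 1) measurable_decoded_logplus
  (fun=> logplus_ge0 _ _)
  (fun x y xy => congr1 (fun z : ZT => logplus f z.1.1) (xy 0%N isT)) decoded_logplus_lty.
by apply: filterS => w; under eq_fun do under eq_bigr do rewrite /process_path addn0.
Qed.

(** [ln p] takes finitely many values, so the average is a fixed combination of transition
    frequencies, each with its own strong law. *)
Lemma ln_jump_slln : {ae P, forall w,
  (fun n => (\sum_(t < n) ln (p (Vi t w) (Vi t.+1 w))) / n%:R) @ \oo --> mean_ln_jump}.
Proof.
have freq : {ae P, forall w i j,
    (fun n => (\sum_(t < n) decoded_jump i j (process_path Z w t)) / n%:R) @ \oo -->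
    fine (P1 [set w | Vs 0%N w = i /\ Vs 1%N w = j])}.
  apply: filter_forall => i; apply: filter_forall => j.
  rewrite -(decoded_jump_integral i j).
  apply: (regenerative_slln reg prec stat (K := 2) (measurable_decoded_jump i j)
    (decoded_jump_ge0 i j) (@decoded_jump_window i j)).
  rewrite decoded_jump_integral.
  by apply: le_lt_trans (probability_le1 _ _) (ltry _); apply: measurableI;
    exact: measurable_stationary_Vs.
apply: filterS freq => w h.
have L : (fun n => \sum_i \sum_j ln (p i j) *
    ((\sum_(t < n) decoded_jump i j (process_path Z w t)) / n%:R)) @ \oo --> mean_ln_jump.
  by apply: cvg_sum_fin => i; apply: cvg_sum_fin => j; apply: cvgMr.
apply: (cvg_trans _ L); apply: near_eq_cvg; apply: nearW => n /=.
under eq_bigr do under eq_bigr do rewrite mulrA.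
under eq_bigr do rewrite -mulr_suml.
rewrite -mulr_suml; congr (_ / _).
transitivity (\sum_i \sum_(t < n) \sum_j
    ln (p i j) * decoded_jump i j (process_path Z w t)).
  apply: eq_bigr => i _; rewrite exchange_big/=; apply: eq_bigr => j _.
  by rewrite mulr_sumr.
rewrite exchange_big/=; apply: eq_bigr => t _.
rewrite (bigD1 (Vi t w))//= [X in _ + X]big1 ?addr0; last first.
  move=> i /negPf it; rewrite big1// => j _.
  by rewrite /decoded_jump /process_path addn0 /= eq_sym it mul0r mulr0.
rewrite (bigD1 (Vi t.+1 w))//= [X in _ + X]big1 ?addr0; last first.
  move=> i /negPf it.
  by rewrite /decoded_jump /process_path addn1 /= [_ == i]eq_sym it !mulr0.
by rewrite /decoded_jump /process_path addn0 addn1 /= !eqxx !mulr1.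
Qed.

(* Below: [V] is itself a candidate path. Above: up to the last renewal the
   Viterbi path agrees with [V], and the remaining stretch is o(n). *)
Lemma viterbi_log_likelihood_average : {ae P, forall w,
  (fun n => ln (pl n (tv n w) (X^~ w)) / n%:R) @ \oo --> mean_ln_jump + mean_ln_density}.
Proof.
have pos := infinite_path_gt0 hHMM hpost hv hvinf.
apply: filterS3 (filterI (filterI ln_density_slln logplus_slln) ln_jump_slln)
  (filterI (renewal_delay reg prec m) agree)
  (filterI pos (viterbi_path_optimal hHMM hpost hv)).
move=> w [[cd clp] cj] [[j [jle j1]] ag] [{}pos opt].
pose ell t := ln (step p pi (Vi^~ w) t) + ln (f (Vi t w) (X t w)).
set Lam := mean_ln_jump + mean_ln_density.
have cl : (fun n => (\sum_(t < n) ell t) / n%:R) @ \oo --> Lam.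
  have cs : (fun n => (\sum_(t < n) ln (step p pi (Vi^~ w) t)) / n%:R) @ \oo -->
      mean_ln_jump.
    have c0 : (fun n => (\sum_(t < n) ln (step p pi (Vi^~ w) t) -
        \sum_(t < n) ln (p (Vi t w) (Vi t.+1 w))) / n%:R) @ \oo --> (0 : R).
      have c1 := cvg_cst_div_nat (2 * jump_log_bound p pi).
      apply/cvgrPdist_le => e e0.
      have /cvgrPdist_le/(_ _ e0) := c1; apply: filterS => n /=.
      rewrite !sub0r !normrN; apply: le_trans.
      rewrite normrM [leRHS]normrM ler_wpM2r//.
      apply: (le_trans (ln_step_sum_shift p pi n (Vi^~ w))); exact: ler_norm.
    have L : (fun n => (\sum_(t < n) ln (step p pi (Vi^~ w) t) -
        \sum_(t < n) ln (p (Vi t w) (Vi t.+1 w))) / n%:R +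
        (\sum_(t < n) ln (p (Vi t w) (Vi t.+1 w))) / n%:R) @ \oo --> 0 + mean_ln_jump.
      exact: cvgD.
    rewrite add0r in L; apply: (cvg_trans _ L); apply: near_eq_cvg.
    by apply: nearW => n /=; rewrite -mulrDl subrK.
  have L : (fun n => (\sum_(t < n) ln (step p pi (Vi^~ w) t)) / n%:R +
      (\sum_(t < n) ln (f (Vi t w) (X t w))) / n%:R) @ \oo --> Lam by exact: cvgD.
  apply: (cvg_trans _ L); apply: near_eq_cvg.
  by apply: nearW => n /=; rewrite -mulrDl -big_split.
pose LP n := \sum_(t < n) logplus f (X t w).
(* Since [S (j n) / n] tends to 1, the averages of [ell] at the delayed time keep their limit, and
   the two [logplus] averages cancel in the limit. *)
have cu : (fun n => (\sum_(t < S (j n) w) ell t) / n%:R +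
    (LP n / n%:R - LP (S (j n) w) / n%:R)) @ \oo --> Lam.
  rewrite -[X in _ --> X]addr0 -[X in _ --> _ + X](subrr (Rintegral P1 setT (fun w => logplus f (Xs 0%N w)))).
  apply: cvgD; first exact: (cvg_average_delayed (q := fun n => S (j n) w) cl j1).
  by apply: cvgB => //; exact: (cvg_average_delayed (q := fun n => S (j n) w) clp j1).
apply: (squeeze_cvgr _ cl cu).
exists (S 0 w + m)%N => // n /= Sn.
have [npos nopt] := opt n.
apply/andP; split.
  rewrite ler_wpM2r ?invr_ge0//.
  have [vpos <-] := ln_path_likelihood (n := n) (fun t _ => pos t).
  by rewrite ler_ln ?posrE.
rewrite -mulrBl -mulrDl ler_wpM2r ?invr_ge0//.
have jn := jle n Sn.
apply: (ln_path_likelihood_le (hmm_p_ge0 hHMM) (p_le1 hHMM) (initial_ge0 P Y)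
  (initial_le1 hHMM) (hmm_f_ge0 hHMM) (y := Vi^~ w) _ npos (ag _ _ jn)).
exact: leq_trans (leq_addr _ _) jn.
Qed.

End viterbi_averages.

(** * Conditional laws and the value of the limit *)

Section conditional_integral.
Local Open Scope ereal_scope.
Context d1 d2 (W : measurableType d1) (T : measurableType d2) (R : realType).
Variables (P : probability W R) (Q : probability T R) (E : set W) (X : W -> T).
Hypothesis mE : measurable E.
Hypothesis mX : measurable_fun setT X.
Hypothesis PQ : forall A, measurable A -> P (E `&` X @^-1` A) = P E * Q A.

Lemma ge0_integral_conditional (u : T -> \bar R) :
  measurable_fun setT u -> (forall x, 0 <= u x) ->
  P E * \int[Q]_x u x = \int[P]_w (u (X w) * (\1_E w)%:E).
Proof.
move=> mu u0.
have fE : P E \is a fin_num by exact: fin_num_measure.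
pose r : {nonneg R} := NngNum (fine_ge0 (measure_ge0 P E)).
have rE : (r%:num)%:E = P E by rewrite /= fineK.
rewrite (@ge0_integral_on_event _ _ _ _ _ P (mscale r Q) E X u)//; last first.
  by move=> A mA; apply: (etrans (PQ mA)); rewrite /= /mscale rE.
by rewrite (ge0_integral_mscale Q measurableT r mu)// rE.
Qed.

(** Integrability is required under [P] on [E] only, since [Q] is arbitrary when [P E = 0]; in that
    case both sides are 0. *)
Lemma integral_conditional (g : T -> R) : measurable_fun setT g ->
  P.-integrable setT (fun w => (g (X w) * \1_E w)%:E) ->
  P E * \int[Q]_x (g x)%:E = \int[P]_w (g (X w) * \1_E w)%:E.
Proof.
move=> mg iF.
have mG : measurable_fun setT (fun x => (g x)%:E) by exact/measurable_EFinP.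
pose F w := (g (X w) * \1_E w)%:E.
have pos : (F^\+ = fun w => (fun x => (g x)%:E)^\+ (X w) * (\1_E w)%:E).
  apply/funext => w; rewrite !funeposE /F indicE; case: (w \in E).
    by rewrite mulr1 mule1.
  by rewrite mulr0 mule0 maxxx.
have neg : (F^\- = fun w => (fun x => (g x)%:E)^\- (X w) * (\1_E w)%:E).
  apply/funext => w; rewrite !funenegE /F indicE; case: (w \in E).
    by rewrite mulr1 mule1.
  by rewrite mulr0 mule0 oppe0 maxxx.
have a := ge0_integral_conditional (measurable_funepos mG) (fun=> funepos_ge0 _ _).
have b := ge0_integral_conditional (measurable_funeneg mG) (fun=> funeneg_ge0 _ _).
have fa : \int[P]_w F^\+ w \is a fin_num by exact: integrable_pos_fin_num.
have fb : \int[P]_w F^\- w \is a fin_num by exact: integrable_neg_fin_num.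
rewrite -/(F _) [RHS]integralE [X in P E * X]integralE.
rewrite pos -a neg -b; rewrite pos -a in fa; rewrite neg -b in fb.
(* When [P E > 0], finiteness of [P E] times the integral of the negative part forces that integral
   to be finite, so the subtraction distributes. *)
have := measure_ge0 P E; rewrite le_eqVlt => /predU1P[<-|PE].
  by rewrite !mul0e sube0.
rewrite muleBr//; first exact: fin_num_measure.
rewrite fin_num_adde_defl// fin_numN.
move: fb; rewrite !ge0_fin_numE; last 2 first.
- by apply: integral_ge0 => x _; exact: funeneg_ge0.
- by rewrite mule_ge0//; apply: integral_ge0 => x _; exact: funeneg_ge0.
move: (\int[Q]_x _) => [c| |]//; rewrite ?ltry// gt0_muley//.
Qed.

End conditional_integral.

Section viterbi_limit.
Context d (Omega : measurableType d) (R : realType) (P : probability Omega R).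
Context d' (XX : measurableType d') (mu : {sigma_finite_measure set XX -> \bar R}).
Variables (N : nat).
Local Notation state := 'I_N.+1.
Variables (X : nat -> Omega -> XX) (Y : nat -> Omega -> state).
Variables (p : 'M[R]_N.+1) (f : state -> XX -> R) (Pe : state -> probability XX R).
Hypothesis hHMM : ergodic_HMM P mu X Y p f Pe.
Hypothesis hint : forall s, (Pe s).-integrable setT (fun x => lne (f s x)%:E).
Variable post : forall n, n.-tuple state -> n.-tuple XX -> R.
Hypothesis hpost : posterior P X Y post.
Variable v : forall n, n.-tuple XX -> n.-tuple state.
Hypothesis hv : Viterbi_alignment post v.
Variable vinf : (nat -> XX) -> nat -> state.
Hypothesis hvinf : infinite_Viterbi_alignment P X v vinf.
Variable S : nat -> Omega -> nat.
Context d1 (Omega1 : measurableType d1) (P1 : probability Omega1 R).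
Variables (Xs : nat -> Omega1 -> XX) (Ys Vs : nat -> Omega1 -> state).
Variable Ss : nat -> Omega1 -> nat.

Local Notation pi := (initial P Y).
Local Notation lk n := (seglik p f pi n).
Local Notation Vi := (V X vinf).
Local Notation tv n w := ((tilde_V X v n)^~ w).
Local Notation pl := (path_likelihood p f pi).
Local Notation Z := (triple X Y Vi).
Local Notation Zs := (triple Xs Ys Vs).
Local Notation ZT := (XX * state * state)%type.
Local Notation env := (log_envelope f).

Hypothesis reg : regenerative P Z S.
Hypothesis prec : positive_recurrent P S.
Hypothesis stat : stationary_version P P1 Z S Zs Ss.
Variable m : nat.
Hypothesis agree : {ae P, forall w j n, (S j w + m <= n)%N ->
  forall t, (t < S j w)%N -> tilde_V X v n t w = Vi t w}.

Variable Q : state -> probability XX R.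
Hypothesis hQ : conditional_law P1 (Xs 0%N) (Vs 0%N) Q.
Variable lik : forall n, n.-tuple XX -> R.
Hypothesis hlik : likelihood P mu X lik.

Let mXs := measurable_stationary_X stat.
Let mE s : measurable [set w | Vs 0%N w = s] := measurable_stationary_Vs stat 0 s.

Let lnV w := ln (f (Vs 0%N w) (Xs 0%N w)).
Let lnV_on s w := ln (f s (Xs 0%N w)) * \1_[set w | Vs 0%N w = s] w.

Let lnV_onE s w : lnV_on s w = if Vs 0%N w == s then lnV w else 0.
Proof.
rewrite /lnV_on indicE; case: eqP => [<-|ne]; first by rewrite mem_set// mulr1.
by rewrite memNset ?mulr0.
Qed.

Let integrable_on s : P1.-integrable setT (fun w => (lnV_on s w)%:E).
Proof.
apply: le_integrable (decoded_ln_integrable hHMM hint hpost hv reg prec stat agree) => //.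
  apply/measurable_EFinP; apply: measurable_funM => //.
  exact: (measurableT_comp (measurable_ln_density hHMM s) (mXs 0)).
move=> w _; rewrite lee_fin lnV_onE; case: ifP => // _.
by rewrite normr0.
Qed.

(** [lne] and [ln] differ only where [f s] vanishes. If state [s] has positive stationary
    probability, [Q s] gives this set measure 0 by [decoded_density_gt0]; otherwise both sides are
    0. *)
Lemma integral_lne_decoded s :
  (P1 [set w | Vs 0%N w = s] * \int[Q s]_x lne (f s x)%:E =
   \int[P1]_w (lnV_on s w)%:E)%E.
Proof.
have PQ A : measurable A -> P1 ([set w | Vs 0%N w = s] `&` Xs 0%N @^-1` A) =
    (P1 [set w | Vs 0%N w = s] * Q s A)%E.
  by move=> mA; rewrite -(hQ s mA) setIC.
have mln := measurable_ln_density hHMM s.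
rewrite -(integral_conditional (mE s) (mXs 0) PQ mln (integrable_on s)).
have := measure_ge0 P1 [set w | Vs 0%N w = s].
rewrite le_eqVlt => /predU1P[<-|Ppos]; first by rewrite !mul0e.
congr (_ * _)%E; apply: ae_eq_integral => //.
- by apply: measurable_lne_EFin; exact: (hmm_mf hHMM).
- exact/measurable_EFinP.
have mA : measurable [set x | f s x <= 0].
  rewrite -[X in measurable X]setTI.
  by apply: measurable_fun_ler => //; exact: (hmm_mf hHMM).
exists [set x | f s x <= 0]; split => //; last first.
  move=> x /= H; rewrite leNgt; apply/negP => fx; apply: H => _.
  by rewrite leNgt fx.
have [B [mB B0 subB]] := decoded_density_gt0 hHMM hpost hv hvinf reg prec stat.
have : P1 ([set w | Vs 0%N w = s] `&` Xs 0%N @^-1` [set x | f s x <= 0]) = 0%E.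
  apply: (subset_measure0 _ mB _ B0).
    apply: measurableI => //.
    by rewrite -[X in measurable X]setTI; exact: mXs.
  move=> w [/= Vw fx]; apply: subB => /=; rewrite Vw ltNge fx.
  by [].
by rewrite PQ// => /eqP; rewrite mule_eq0 gt_eqF//= => /eqP.
Qed.

Lemma limit_valueE (g : R) :
  (fun k => mean_loglik P X Y p f k / k%:R) @ \oo --> g ->
  limit_value P1 p f Vs Q (entropy_rate P X lik) =
  (mean_ln_jump p P1 Vs + mean_ln_density f P1 Xs Vs - g)%:E.
Proof.
move=> hg; rewrite /limit_value.
rewrite (entropy_rate_of_mean_loglik hHMM hint (joint_regenerative reg) hlik hg).
rewrite [(_ + _ - _)%:E]EFinD; congr (_ + _)%E; rewrite (addrC (mean_ln_jump _ _ _)) EFinD; congr (_ + _)%E.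
  under eq_bigr do rewrite integral_lne_decoded.
  rewrite -integral_sum//.
  rewrite /mean_ln_density /Rintegral fineK; last first.
    exact: integrable_fin_num (decoded_ln_integrable hHMM hint hpost hv reg prec stat agree).
  apply: eq_integral => w _; rewrite sumEFin; congr EFin.
  under eq_bigr do rewrite lnV_onE.
  by rewrite -big_mkcond/= (big_pred1 (Vs 0%N w))// => i; rewrite /= eq_sym.
rewrite /mean_ln_jump -sumEFin; apply: eq_bigr => i _.
rewrite -sumEFin; apply: eq_bigr => j _.
have := hmm_p_ge0 hHMM i j; rewrite le_eqVlt => /predU1P[p0|pij].
  by rewrite (decoded_jump0 hHMM hpost hv hvinf reg prec stat (esym p0)) mule0 mulr0.
rewrite lne_EFin// EFinM fineK//; apply: fin_num_measure.
by apply: measurableI; exact: (measurable_stationary_Vs stat).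
Qed.

End viterbi_limit.

(** * The risk as a difference of log-likelihoods *)

Section empirical_risk.
Context d (Omega : measurableType d) (R : realType) (P : probability Omega R).
Context d' (XX : measurableType d') (mu : {sigma_finite_measure set XX -> \bar R}).
Variables (N : nat).
Local Notation state := 'I_N.+1.
Variables (X : nat -> Omega -> XX) (Y : nat -> Omega -> state).
Variables (p : 'M[R]_N.+1) (f : state -> XX -> R) (Pe : state -> probability XX R).
Hypothesis hHMM : ergodic_HMM P mu X Y p f Pe.
Variable post : forall n, n.-tuple state -> n.-tuple XX -> R.
Hypothesis hpost : posterior P X Y post.
Variable v : forall n, n.-tuple XX -> n.-tuple state.
Hypothesis hv : Viterbi_alignment post v.

Local Notation pi := (initial P Y).
Local Notation lk n := (seglik p f pi n).
Local Notation tv n w := ((tilde_V X v n)^~ w).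
Local Notation pl := (path_likelihood p f pi).

Lemma riskE : {ae P, forall w n, (- risk X post v n w)%E =
  ((ln (pl n (tv n w) (X^~ w)) - ln (lk n (X^~ w))) / n%:R)%:E}.
Proof.
apply: filterS3 (posterior_of_path hHMM hpost) (viterbi_path_optimal hHMM hpost hv)
  (seglik_gt0 hHMM) => w hp opt lpos n.
have [pos _] := opt n.
rewrite /risk hp lne_EFin; last by rewrite divr_gt0.
rewrite ln_div ?posrE// -EFinM -EFinN; congr EFin.
by rewrite mulNr opprK mulrC.
Qed.

(** The likelihood is a sum over [N.+1 ^ n] paths, none of which exceeds the Viterbi path, itself
    one of the terms. *)
Lemma risk_bound : {ae P, forall w n,
  (`|- risk X post v n w| <= (ln N.+1%:R : R)%:E)%E}.
Proof.
have ln0 : 0 <= ln N.+1%:R :> R by rewrite ln_ge0// ler1n.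
apply: filterS3 riskE (viterbi_path_optimal hHMM hpost hv) (seglik_gt0 hHMM).
move=> w E opt lpos n; rewrite E lee_fin.
have [pos le] := opt n.
have up : pl n (tv n w) (X^~ w) <= lk n (X^~ w).
  rewrite -path_likelihoodE.
  apply: (path_le_mixlik (hmm_p_ge0 hHMM) (initial_ge0 P Y) (hmm_f_ge0 hHMM)).
  by rewrite size_block size_tuple.
have lo : lk n (X^~ w) <= N.+1%:R ^+ n * pl n (tv n w) (X^~ w).
  rewrite /seglik (mixlikE _ _ _ _ _ (size_block n)).
  apply: (@le_trans _ _ (\sum_(s : n.-tuple state) pl n (tv n w) (X^~ w))).
    by apply: ler_sum => s _; rewrite path_likelihoodE.
  by rewrite sumr_const card_tuple card_ord -[leLHS]mulr_natl natrX.
have {}up : ln (pl n (tv n w) (X^~ w)) <= ln (lk n (X^~ w)) by rewrite ler_ln ?posrE.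
have {}lo : ln (lk n (X^~ w)) <= n%:R * ln N.+1%:R + ln (pl n (tv n w) (X^~ w)).
  rewrite mulr_natl -lnXn ?ltr0n// -lnM ?posrE ?exprn_gt0 ?ltr0n//.
  by rewrite ler_ln ?posrE// mulr_gt0// exprn_gt0 ?ltr0n.
(* For [n = 0] the quotient is 0 because [0^-1 = 0]. *)
case: n {opt le} pos up lo => [|n] pos up lo; first by rewrite invr0 mulr0 normr0.
rewrite normrM [`|_^-1|]ger0_norm ?invr_ge0// ler_pdivrMr ?ltr0n//.
by rewrite ler_norml; apply/andP; split; lra.
Qed.

(** The path plugged into [post] varies with the observations but has finitely many values, so the
    plug-in posterior is a finite sum of measurable functions times indicators. *)
Lemma measurable_risk n : measurable_fun setT (risk X post v n).
Proof.
have mpost s : measurable_fun setT (@post n s) by have [] := hpost s.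
have mset (s : n.-tuple state) : measurable [set t : n.-tuple state | t = s].
  rewrite (_ : [set _ | _] = \bigcap_(i in @setT 'I_n)
      (setT `&` (fun t : n.-tuple state => tnth t i) @^-1` [set tnth s i])).
    apply: fin_bigcap_measurable; first exact: finite_finset.
    by move=> i _; exact: measurable_tnth.
  apply/seteqP; split => [t -> i _ //|t h]; apply: eq_from_tnth => i.
  by have [] := h i Logic.I.
have mI (s : n.-tuple state) : measurable [set x : n.-tuple XX | v x = s].
  rewrite (_ : [set _ | _] = setT `&` @v n @^-1` [set t | t = s]).
    exact: (hv n).1.
  by rewrite setTI.
have mp : measurable_fun setT (fun x : n.-tuple XX => post (v x) x).
  rewrite (_ : (fun x => _) = fun x =>
      \sum_(s : n.-tuple state) post s x * \1_[set x | v x = s] x).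
    apply: measurable_sum => s; apply: measurable_funM => //.
  apply/funext => x; rewrite (bigD1 (v x))//= big1 ?addr0.
    by rewrite indicE mem_set// mulr1.
  by move=> s sv; rewrite indicE memNset ?mulr0// => /= /esym; exact/eqP.
apply: measurable_funeM; apply: measurable_lne_EFin.
exact: (measurableT_comp mp (measurable_Xn hHMM (n := n))).
Qed.

End empirical_risk.

Local Open Scope ereal_scope.

Theorem theorem5p1 (R : realType)
  (d : measure_display) (Omega : measurableType d) (P : probability Omega R)
  (d' : measure_display) (XX : measurableType d')
  (mu : {sigma_finite_measure set XX -> \bar R})
  (N : nat) (X : nat -> Omega -> XX) (Y : nat -> Omega -> 'I_N.+1)
  (p : 'M[R]_N.+1) (f : 'I_N.+1 -> XX -> R)
  (Pe : 'I_N.+1 -> probability XX R)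
  (hHMM : ergodic_HMM P mu X Y p f Pe)
  (C : {set 'I_N.+1}) (r : nat) (hA1 : A1 p f Pe C r)
  (hA2 : A2 p f Pe)
  (Xo : set XX) (eps M : R) (hXo : good_set mu f C Xo eps M)
  (post : forall n, n.-tuple 'I_N.+1 -> n.-tuple XX -> R)
  (hpost : posterior P X Y post)
  (lik : forall n, n.-tuple XX -> R) (hlik : likelihood P mu X lik)
  (v : forall n, n.-tuple XX -> n.-tuple 'I_N.+1)
  (hv : Viterbi_alignment post v)
  (vinf : (nat -> XX) -> nat -> 'I_N.+1)
  (hvinf : infinite_Viterbi_alignment P X v vinf)
  (S : nat -> Omega -> nat) (hS : consistent P X Y v vinf Xo r S)
  (d1 : measure_display) (Omega1 : measurableType d1)
  (P1 : probability Omega1 R)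
  (Xs : nat -> Omega1 -> XX) (Ys Vs : nat -> Omega1 -> 'I_N.+1)
  (Ss : nat -> Omega1 -> nat)
  (hstat : stationary_version P P1
    (triple X Y (V X vinf)) S (triple Xs Ys Vs) Ss)
  (Q : 'I_N.+1 -> probability XX R)
  (hQ : conditional_law P1 (Xs 0%N) (Vs 0%N) Q)
  (hint : forall s, (Pe s).-integrable setT (fun x => lne (f s x)%:E)) :
  let L := limit_value P1 p f Vs Q (entropy_rate P X lik) in
  {ae P, forall w, (fun n => - risk X post v n w) @ \oo --> L} /\
  (fun n => \int[P]_w `| - risk X post v n w - L |) @ \oo --> 0.
Proof.
have [reg prec _ [m _ hren]] := hS.
have agree : {ae P, forall w j n, (S j w + m <= n)%N ->
    forall t, (t < S j w)%N -> tilde_V X v n t w = V X vinf t w}.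
  by apply: filterS hren => w [].
have regj := joint_regenerative reg.
(* The same [g] is the limit of the normalised means, which define the entropy rate, and of the
   sample log-likelihoods. *)
have [g mean_g lim_g] := loglik_average_cvg hHMM hint regj prec.
move=> L; have LE : L = (mean_ln_jump p P1 Vs + mean_ln_density f P1 Xs Vs - g)%:E.
  exact: (limit_valueE hHMM hint hpost hv hvinf reg prec hstat agree hQ hlik mean_g).
have cv : {ae P, forall w, (fun n => - risk X post v n w) @ \oo --> L}.
  have lim_v := viterbi_log_likelihood_average hHMM hint hpost hv hvinf reg prec
    hstat agree.
  apply: filterS3 lim_v lim_g (riskE hHMM hpost hv) => w cv cg rE.
  rewrite LE; under eq_fun do rewrite rE.
  apply: cvg_EFin; first exact: nearW.
  have lim : (fun n => ln (path_likelihood p f (initial P Y) n ((tilde_V X v n)^~ w) (X^~ w)) / n%:R -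
      loglik P Y p f n (process_path (joint_process X Y) w 0) / n%:R)%R @ \oo -->
      (mean_ln_jump p P1 Vs + mean_ln_density f P1 Xs Vs - g)%R by exact: cvgB.
  apply: (cvg_trans _ lim); apply: near_eq_cvg; apply: nearW => n /=.
  by rewrite -mulrBl.
split=> //.
have iK : P.-integrable setT (fun=> (ln N.+1%:R : R)%:E).
  by apply: (bounded_rv_integrable P); exact: bounded_rv_cst.
have [_ + _] := @dominated_convergence _ _ _ P setT measurableT
  (fun n w => - risk X post v n w) (fun=> L) (fun=> (ln N.+1%:R : R)%:E)
  (fun n => measurableT_comp (@oppe_measurable R setT) (measurable_risk hHMM hpost hv n))
  (measurable_cst L) (filterS (fun w h _ => h) cv) iK
  (filterS (fun w h n _ => h n) (risk_bound hHMM hpost hv)).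
exact.
Qed.
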